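(* Let $\kappa\in\mathbb{R}$, $u_0\in H^3(\mathbb{S})$ and $\mu_0=\int_{\mathbb{S}}u_0\,dx$. If $$\|\partial_x^3u_0\|_{L^2(\mathbb{S})}\le2\sqrt3\,|\mu_0+\kappa|,$$ then the strong solution of the generalized periodic Camassa-Holm ($\mu$-CH) initial-value problem with initial data $u_0$ is global in time (its maximal existence time is $+\infty$).
   Context: $\mathbb{S}=\mathbb{R}/\mathbb{Z}$, $\mu(f)=\int_{\mathbb{S}}f\,dx$. The $\mu$-CH initial-value problem (with parameter $\kappa\in\mathbb{R}$) is, for functions $u(t,x)$ that are $1$-periodic in $x$, $$u_t+uu_x+\partial_xP=0,\qquad (\mu-\partial_x^2)P=2\mu(u)u+\tfrac12u_x^2+2\kappa u,\qquad u(0,x)=u_0(x),$$ equivalently $\mu(u_t)-u_{xxt}+2\mu(u)u_x+2\kappa u_x=2u_xu_{xx}+uu_{xxx}$, $u(0,x)=u_0(x)$. Here $(\mu-\partial_x^2)P:=\mu(P)-P_{xx}$, which is an isomorphism $H^{s}(\mathbb{S})\to H^{s-2}(\mathbb{S})$. A strong solution on $[0,T)$ is $u\in C([0,T),H^s(\mathbb{S}))\cap C^1([0,T),H^{s-1}(\mathbb{S}))$, $s>3/2$, satisfying the problem. For every $u_0\in H^s(\mathbb{S})$, $s>3/2$, there is a unique strong solution with a maximal existence time $T=T(u_0)\in(0,\infty]$ (independent of $s$). *)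

(* Defs.v *)
From HB Require Import structures.
From mathcomp Require Import all_boot all_order all_algebra.
From mathcomp Require Import all_classical all_reals all_analysis.
Import Order.TTheory GRing.Theory Num.Theory.
Import numFieldNormedType.Exports.

Set Implicit Arguments.
Unset Strict Implicit.
Unset Printing Implicit Defensive.

Local Open Scope classical_set_scope.
Local Open Scope ring_scope.

(* A function on the circle R/Z is represented by a 1-periodic function on R,
   up to almost everywhere equality; integrals over the circle are integrals
   over [0, 1]. *)
Definition periodic1 (R : realType) (f : R -> R) : Prop :=
  forall x, f (x + 1) = f x.

Definition circle_int (R : realType) (f : R -> R) : R :=
  Rintegral (@lebesgue_measure R) `[0%R, 1%R] f.

Definition L2_circle (R : realType) (f : R -> R) : Prop :=
  [/\ periodic1 f, measurable_fun [set: R] f &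
      (\int[@lebesgue_measure R]_(x in `[0%R, 1%R]) (f x ^+ 2)%:E < +oo)%E].

Definition L2_norm (R : realType) (f : R -> R) : R :=
  Num.sqrt (circle_int (fun x => f x ^+ 2)).

Definition test_fun (R : realType) (phi : R -> R) : Prop :=
  periodic1 phi /\ forall (n : nat) (x : R), derivable (derive1n n phi) x 1.

(* [g] is the [k]-th distributional derivative of [f] on the circle. *)
Definition weak_deriv (R : realType) (k : nat) (f g : R -> R) : Prop :=
  forall phi : R -> R, test_fun phi ->
    circle_int (fun x => f x * derive1n k phi x) =
    (-1) ^+ k * circle_int (fun x => g x * phi x).

(* For a real-valued [f], this is the squared modulus of
   int_0^1 f(x) exp(- 2 i pi n x) dx. *)
Definition fourier_sqr (R : realType) (f : R -> R) (n : int) : R :=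
  circle_int (fun x => f x * cos (2 * pi * n%:~R * x)) ^+ 2 +
  circle_int (fun x => f x * sin (2 * pi * n%:~R * x)) ^+ 2.

Definition Hs_norm (R : realType) (s : R) (f : R -> R) : \bar R :=
  poweR (\esum_(n in [set: int])
           (((1 + n%:~R ^+ 2) `^ s) * fourier_sqr f n)%:E) 2^-1.

(* Only used for [s >= 0], where H^s is contained in L^2. *)
Definition Hs (R : realType) (s : R) (f : R -> R) : Prop :=
  L2_circle f /\ (Hs_norm s f < +oo)%E.

Definition time_interval (R : realType) (T : \bar R) : set R :=
  [set t | 0 <= t /\ (t%:E < T)%E].

Definition C0_Hs (R : realType) (s : R) (T : \bar R) (u : R -> R -> R) : Prop :=
  forall t0, time_interval T t0 ->
    Hs s (u t0) /\
    Hs_norm s (fun x => u t x - u t0 x)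
      @[t --> within (time_interval T) (nbhs t0)] --> 0%E.

(* [ut] is the time derivative of [u] in the norm of H^s (one-sided at 0). *)
Definition time_deriv_Hs (R : realType) (s : R) (T : \bar R)
    (u ut : R -> R -> R) : Prop :=
  forall t0, time_interval T t0 ->
    Hs_norm s (fun x => (u t x - u t0 x) / (t - t0) - ut t0 x)
      @[t --> within (time_interval T) (dnbhs t0)] --> 0%E.

(* At a fixed time, with [v] and [vt] the values of u and u_t:
   u_t + u u_x + P_x = 0 and mu(P) - P_xx = 2 mu(u) u + u_x^2 / 2 + 2 kappa u,
   almost everywhere. The second equation determines P in H^2. *)
Definition muCH_eq (R : realType) (kappa : R) (v vt : R -> R) : Prop :=
  exists vx P Px Pxx : R -> R,
  [/\ [/\ L2_circle vx, L2_circle P, L2_circle Px & L2_circle Pxx],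
      [/\ weak_deriv 1 v vx, weak_deriv 1 P Px & weak_deriv 2 P Pxx],
      {ae @lebesgue_measure R, forall x, vt x + v x * vx x + Px x = 0} &
      {ae @lebesgue_measure R, forall x,
         circle_int P - Pxx x =
         2 * circle_int v * v x + 2^-1 * vx x ^+ 2 + 2 * kappa * v x}].

(* Strong solution on [0, T) in the class
   C([0, T), H^s) /\ C^1([0, T), H^(s-1)), for s > 3/2. *)
Definition strong_solution (R : realType) (s kappa : R) (u0 : R -> R)
    (T : \bar R) (u : R -> R -> R) : Prop :=
  [/\ (0 < T)%E,
      C0_Hs s T u,
      {ae @lebesgue_measure R, forall x, u 0 x = u0 x} &
      exists ut : R -> R -> R,
        [/\ C0_Hs (s - 1) T ut,
            time_deriv_Hs (s - 1) T u ut &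
            forall t, time_interval T t -> muCH_eq kappa (u t) (ut t)]].

Definition maximal_existence_time (R : realType) (s kappa : R) (u0 : R -> R)
    (T : \bar R) : Prop :=
  (exists u, strong_solution s kappa u0 T u) /\
  (forall T' u', strong_solution s kappa u0 T' u' -> (T' <= T)%E).

(* Main.v *)
(* In Lagrangian coordinates the equation is an ordinary differential equation
   with a locally Lipschitz right-hand side. Write [c = mu_0 + kappa] and
   [m = c - u_xx]. The mean of [u] is conserved and [m (t, q) q_x^2 = m_0] along
   the flow [q_t = u (t, q)], so [phi = ln q_x] satisfies [phi_t = V] with
   [V = u_x (t, q)], [V_x = c e^phi - m_0 e^(- phi)] and [int V e^phi = 0].

   The bound on the third derivative, together with the sharp inequality
   [|f| <= ||f'||_2 / (2 sqrt 3)] for periodic [f] of mean zero, gives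
   [|m_0 - c| <= |c|], so [m_0] has constant sign. Then [V] oscillates by at most
   [|c|], hence [|V| <= |c|] and [phi] cannot blow up. To get a global solution
   at once, [V] is truncated at level [|c|] in the equation (and normalised so
   that [int m_0 e^(- phi)] times [int e^phi] stays equal to [c]); the bound
   above then shows that the truncation is never active.

   Regularity in H^3 only requires Bessel's inequality, applied to the C^1
   momenta obtained by transporting the Fourier partial sums of [m_0] along the
   flow of the true solution. Differentiability in time in H^2 follows from the
   differentiability of each Fourier coefficient and the continuity of [u_t] in
   H^2. *)
Require Import Defs.
From HB Require Import structures.
From mathcomp Require Import all_boot all_order all_algebra.
From mathcomp Require Import all_classical all_reals all_analysis.
From mathcomp Require Import measurable_realfun ring lra zify.
Import Order.TTheory GRing.Theory Num.Theory.
Import numFieldNormedType.Exports.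
Local Open Scope classical_set_scope.
Local Open Scope ring_scope.

Set Implicit Arguments.
Unset Strict Implicit.
Unset Printing Implicit Defensive.

(** * Calculus on the line *)

Section calculus.
Context {R : realType}.
Implicit Types f g : R -> R.
Local Notation der f x a := (is_derive (x : R) (1 : R) (f : R -> R) (a : R)).

(** The factor [2 sqrt 3] is the square root of [12], and [1/12] is the integral of [(y - 1/2)^2]
    over a period.

    The obstacle is the regularity of the data: [u_0] in H^3 makes [m_0] continuous but gives it a
    derivative in L^2 only, so the momentum cannot be differentiated pointwise along the flow. The
    construction of the flow uses [m_0] merely as a continuous function. The H^1 information on the
    momentum is carried by C^1 approximations with uniform bounds, and the equation for [u_t] is
    reached by pairing the momentum with trigonometric functions, where every derivative falls on
    the test function or on the flow.

    The weights [N = int m_0 e^(- phi)] and [W = int e^phi] enter the truncated equation so that the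
    slope of [V] has mean zero, and [V] is therefore periodic, for every [phi] and not only along a
    solution.

    Since [u_0] is given up to null sets and only through weak derivatives, [m_0] is rebuilt from
    Fourier coefficients, and the solution at time 0 is matched with [u_0] by comparing
    coefficients; this is where completeness of the trigonometric system enters. *)

Lemma der_eq {f} {x a b : R} : der f x a -> a = b -> der f x b.
Proof. by move=> h <-. Qed.

Lemma derC (k x : R) : der (fun=> k) x 0.
Proof. exact: is_derive_cst. Qed.

Lemma der_id (x : R) : der id x 1.
Proof. exact: is_derive_id. Qed.

Lemma derD {f g} {x a b : R} : der f x a -> der g x b ->
  der (fun y => f y + g y) x (a + b).
Proof. exact: is_deriveD. Qed.

Lemma derN {f} {x a : R} : der f x a -> der (fun y => - f y) x (- a).
Proof. exact: is_deriveN. Qed.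

Lemma derB {f g} {x a b : R} : der f x a -> der g x b ->
  der (fun y => f y - g y) x (a - b).
Proof. exact: is_deriveB. Qed.

Lemma derM {f g} {x a b : R} : der f x a -> der g x b ->
  der (fun y => f y * g y) x (a * g x + f x * b).
Proof.
move=> fa gb; apply: (der_eq (is_deriveM fa gb)).
by change (f x * b + g x * a = a * g x + f x * b); ring.
Qed.

Lemma derZ {f} (k : R) {x a : R} : der f x a ->
  der (fun y => k * f y) x (k * a).
Proof.
by move=> fa; apply: (der_eq (derM (derC k x) fa)); rewrite mul0r add0r.
Qed.

Lemma der_comp {f g} {x a b : R} : der g x b -> der f (g x) a ->
  der (fun y => f (g y)) x (a * b).
Proof. by move=> gb fa; exact: is_derive1_comp. Qed.

Lemma der_sqr {f} {x a : R} : der f x a ->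
  der (fun y => f y ^+ 2) x (2 * f x * a).
Proof.
move=> fa; apply: (der_eq (derM fa fa)).
by rewrite mulrC -mulrDl -mulr2n mulr_natl.
Qed.

Lemma der_exp {f} {x a : R} : der f x a ->
  der (fun y => expR (f y)) x (expR (f x) * a).
Proof. by move=> fa; exact: der_comp fa _. Qed.

Lemma der_cont {f} {x a : R} : der f x a -> {for x, continuous f}.
Proof. by move=> [h _]; apply/differentiable_continuous/derivable1_diffP. Qed.

Lemma ders_cont {f g} : (forall x, der f x (g x)) -> continuous f.
Proof. by move=> h x; exact: der_cont (h x). Qed.

Lemma der_unique {f} {x a b : R} : der f x a -> der f x b -> a = b.
Proof. by move=> h1 h2; rewrite -(@derive_val _ _ _ _ _ _ _ h1) (@derive_val _ _ _ _ _ _ _ h2). Qed.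

Lemma der_ext {f g} {x a : R} : (f =1 g) -> der f x a -> der g x a.
Proof. by move=> /funext ->. Qed.

(** The end points come in either order, and the intermediate point is located by its distance to
    [a]: this is the form in which estimates near a fixed time consume it. *)
Lemma mvt f f' (a b : R) : (forall x, der f x (f' x)) ->
  exists2 c, `|c - a| <= `|b - a| & f b - f a = f' c * (b - a).
Proof.
move=> h; wlog ab : a b / a <= b.
  move=> H; have [/H//|/ltW ba] := leP a b.
  have [] := MVT_segment ba (fun x _ => h x).
    by apply/continuous_subspaceT; exact: ders_cont h.
  move=> d; rewrite in_itv/= => /andP[d1 d2] d3; exists d.
    by rewrite distrC [leRHS]distrC !ger0_norm ?subr_ge0// lerB.
  by rewrite -[LHS]opprB d3 -mulrN opprB.
have [] := MVT_segment ab (fun x _ => h x).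
  by apply/continuous_subspaceT; exact: ders_cont h.
move=> d; rewrite in_itv/= => /andP[d1 d2] d3; exists d => //.
by rewrite !ger0_norm ?subr_ge0// lerB.
Qed.

Lemma der_mono f f' (a b : R) : (forall x, der f x (f' x)) ->
  (forall x, a <= x <= b -> 0 <= f' x) -> a <= b -> f a <= f b.
Proof.
move=> h h0 ab; have [] := MVT_segment ab (fun x _ => h x).
  by apply/continuous_subspaceT; exact: ders_cont h.
move=> c; rewrite in_itv/= => cab e.
by rewrite -subr_ge0 e mulr_ge0 ?h0// subr_ge0.
Qed.

Lemma der_eq_fun f g h : (forall x, der f x (h x)) ->
  (forall x, der g x (h x)) -> forall a x, f x - f a = g x - g a.
Proof.
move=> hf hg a x; have e : f x - g x = f a - g a.
  apply: (@is_derive_0_is_cst _ (fun y => f y - g y)) => y.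
  by apply: (der_eq (derB (hf y) (hg y))); rewrite subrr.
by move: e; lra.
Qed.

Section continuity.
Context {T : topologicalType}.
Implicit Types F G : T -> R.

Lemma contC (k : R) : continuous (fun _ : T => k).
Proof. by move=> x; exact: cvg_cst. Qed.

Lemma contD F G : continuous F -> continuous G ->
  continuous (fun x => F x + G x).
Proof. by move=> h1 h2 x; apply: cvgD; [exact: h1|exact: h2]. Qed.

Lemma contN F : continuous F -> continuous (fun x => - F x).
Proof. by move=> h1 x; apply: cvgN; exact: h1. Qed.

Lemma contB F G : continuous F -> continuous G ->
  continuous (fun x => F x - G x).
Proof. by move=> h1 h2; apply: contD => //; exact: contN. Qed.

Lemma contM F G : continuous F -> continuous G ->
  continuous (fun x => F x * G x).
Proof. by move=> h1 h2 x; apply: cvgM; [exact: h1|exact: h2]. Qed.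

Lemma contZ (k : R) F : continuous F -> continuous (fun x => k * F x).
Proof. by move=> cF; apply: contM => //; exact: contC. Qed.

Lemma cont_comp F g : continuous F -> continuous g ->
  continuous (fun x => g (F x)).
Proof. by move=> h1 h2 x; apply: continuous_comp; [exact: h1|exact: h2]. Qed.

Lemma cont_sqr F : continuous F -> continuous (fun x => F x ^+ 2).
Proof. by move=> h1; apply: contM. Qed.

Lemma contV F : (forall x, F x != 0) -> continuous F ->
  continuous (fun x => (F x)^-1).
Proof. by move=> h0 h1 x; apply: continuousV => //; exact: h1. Qed.

End continuity.

Lemma cont_id : continuous (fun x : R => x).
Proof. by move=> x; exact: cvg_id. Qed.

Local Notation mu := (@lebesgue_measure R).

Lemma cont_integrable f (a b : R) : continuous f ->
  mu.-integrable `[a, b] (EFin \o f).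
Proof.
move=> cf; apply: continuous_compact_integrable; first exact: segment_compact.
exact: continuous_subspaceT.
Qed.

(** The oriented integral from 0 to [x]: according to the sign of [x], one of the two intervals is
    empty or a point and its integral vanishes. *)
Definition prim f (x : R) : R :=
  \int[mu]_(y in `[0, x]) f y - \int[mu]_(y in `[x, 0]) f y.

(** Rewrites the oriented integral with a fixed left end point, the form to which the fundamental
    theorem of calculus applies on both sides of 0. *)
Lemma prim_shift f (a x : R) : continuous f -> a <= 0 -> a <= x ->
  prim f x = \int[mu]_(y in `[a, x]) f y - \int[mu]_(y in `[a, 0]) f y.
Proof.
move=> cf a0 ax.
have key (u v : R) : a <= u -> u <= v ->
    \int[mu]_(y in `[a, v]) f y - \int[mu]_(y in `[a, u]) f y =
    \int[mu]_(y in `[u, v]) f y.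
  move=> au uv; rewrite Rintegral_itvB ?bnd_simp//; last exact: cont_integrable.
  rewrite Rintegral_itv_obnd_cbnd//.
  apply: integrableS (cont_integrable u v cf) => //.
  exact: subset_itv_oc_cc.
have deg (u v : R) : v <= u -> \int[mu]_(y in `[u, v]) f y = 0.
  rewrite le_eqVlt => /predU1P[->|vu]; first by rewrite set_itv1 Rintegral_set1.
  by rewrite set_itv_ge ?Rintegral_set0// bnd_simp -ltNge.
rewrite /prim; have [x0|/ltW x0] := leP 0 x.
  by rewrite -(key 0 x)// (deg x 0)// subr0.
by rewrite -(key x 0)// (deg 0 x)// sub0r opprB.
Qed.

Lemma prim0 f : prim f 0 = 0.
Proof. by rewrite /prim subrr. Qed.

Lemma der_prim f (x : R) : continuous f -> der (prim f) x (f x).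
Proof.
(* Any base point strictly to the left of [x] and not to the right of 0 will do. *)
move=> cf; pose a := Num.min x 0 - 1.
have mx : Num.min x 0 <= x by rewrite ge_min lexx.
have m0 : Num.min x 0 <= 0 by rewrite ge_min lexx orbT.
have ax : a < x by rewrite /a; lra.
have a0 : a <= 0 by rewrite /a; lra.
have xx1 : x < x + 1 by lra.
have [||d1 d2] := @continuous_FTC1 R f (BLeft a) x (x + 1) xx1
  (cont_integrable a (x + 1) cf).
- by rewrite lte_fin.
- exact: cf.
set F := (X in derivable X _ _) in d1; rewrite -/F in d2.
have dF : der F x (f x).
  by split; [exact: d1|rewrite -d2 derive1E].
have : der (fun y => F y - F 0) x (f x).
  by apply: (der_eq (derB dF (derC _ _))); rewrite subr0.
apply: near_eq_is_derive; near=> y.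
rewrite (@prim_shift f a y)//; apply/ltW; near: y.
exact: lt_nbhsr.
Unshelve. all: by end_near. Qed.

Lemma prim_cont f : continuous f -> continuous (prim f).
Proof. by move=> cf; apply: ders_cont => x; exact: der_prim. Qed.

Lemma prim_der f f' (x : R) : continuous f' -> (forall x, der f x (f' x)) ->
  prim f' x = f x - f 0.
Proof.
move=> cf h; have := der_eq_fun (fun y => der_prim y cf) h 0 x.
by rewrite prim0 subr0.
Qed.

Lemma circle_int_prim f : circle_int f = prim f 1.
Proof.
rewrite /prim /circle_int (_ : `[1, 0]%classic = set0) ?Rintegral_set0 ?subr0//.
by rewrite set_itv_ge// bnd_simp -ltNge.
Qed.

Lemma primD f g (x : R) : continuous f -> continuous g ->
  prim (fun y => f y + g y) x = prim f x + prim g x.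
Proof.
move=> cf cg.
have := prim_der x (contD cf cg)
  (fun y => derD (der_prim y cf) (der_prim y cg)).
by rewrite !prim0 addr0 subr0.
Qed.

Lemma primZ (k : R) f (x : R) : continuous f ->
  prim (fun y => k * f y) x = k * prim f x.
Proof.
move=> cf; have := prim_der x (contM (@contC _ k) cf)
  (fun y => derZ k (der_prim y cf)).
by rewrite !prim0 mulr0 subr0.
Qed.

Lemma primN f (x : R) : continuous f -> prim (fun y => - f y) x = - prim f x.
Proof.
move=> cf; have := prim_der x (contN cf) (fun y => derN (der_prim y cf)).
by rewrite !prim0 oppr0 subr0.
Qed.

Lemma primB f g (x : R) : continuous f -> continuous g ->
  prim (fun y => f y - g y) x = prim f x - prim g x.
Proof. by move=> cf cg; rewrite primD// ?primN//; exact: contN. Qed.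

Lemma primC (k x : R) : prim (fun=> k) x = k * x.
Proof.
have := prim_der x (@contC _ (k * 1)) (fun y => derZ k (der_id y)).
by rewrite mulr1 mulr0 subr0.
Qed.

Lemma ge0_prim f (x : R) : continuous f -> 0 <= x ->
  (forall y, 0 <= y <= x -> 0 <= f y) -> 0 <= prim f x.
Proof.
move=> cf x0 h; rewrite -(prim0 f).
by apply: (@der_mono _ f) => // y; exact: der_prim.
Qed.

Lemma le_prim f g (x : R) : continuous f -> continuous g -> 0 <= x ->
  (forall y, 0 <= y <= x -> f y <= g y) -> prim f x <= prim g x.
Proof.
move=> cf cg x0 h; rewrite -subr_ge0 -primB//.
apply: ge0_prim => //; first exact: contB.
by move=> y /h; rewrite subr_ge0.
Qed.

Lemma prim_bound f (x M : R) : continuous f ->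
  (forall y, `|y| <= `|x| -> `|f y| <= M) -> `|prim f x| <= M * `|x|.
Proof.
move=> cf h; have [c] := mvt 0 x (fun z => der_prim z cf).
by rewrite prim0 !subr0 => cx ->; rewrite normrM ler_wpM2r// h.
Qed.

End calculus.

(** * Joint continuity and integrals depending on a parameter *)

Section joint_continuity.
Context {R : realType}.
Implicit Types (f g : R -> R) (F G : R -> R -> R).
Local Notation der f x a := (is_derive (x : R) (1 : R) (f : R -> R) (a : R)).

Definition jc F := continuous (fun z : R * R => F z.1 z.2).

Lemma jc_comp {T : topologicalType} F (P Q : T -> R) : jc F ->
  continuous P -> continuous Q -> continuous (fun z => F (P z) (Q z)).
Proof.
move=> cF cP cQ z.
apply: (@continuous_comp _ _ _ (fun z => (P z, Q z)) (fun z => F z.1 z.2)).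
  exact: (cvg_pair (cP z) (cQ z)).
exact: (cF (P z, Q z)).
Qed.

Lemma jc_cst F x : jc F -> continuous (F^~ x).
Proof. by move=> h; exact: (jc_comp h cont_id (@contC _ _ x)). Qed.

Lemma jc_fun F t : jc F -> continuous (F t).
Proof. by move=> h; exact: (jc_comp h (@contC _ _ t) cont_id). Qed.

Lemma cont_fst : continuous (fun z : R * R => z.1).
Proof. by move=> z; exact: cvg_fst. Qed.

Lemma cont_snd : continuous (fun z : R * R => z.2).
Proof. by move=> z; exact: cvg_snd. Qed.

Lemma jc_swap F : jc F -> jc (fun x t => F t x).
Proof. by move=> h; exact: (jc_comp h cont_snd cont_fst). Qed.

(** Tube lemma: the compactness of [[-M, M]] makes the neighbourhood of [t0] independent of [x]. *)
Lemma jc_uniform F t0 (M e : R) : jc F -> 0 < e ->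
  \forall t \near t0, forall x, `|x| <= M -> `|F t x - F t0 x| <= e.
Proof.
move=> cF e0; have /compact_near_coveringP h := @segment_compact R (- M) M.
have : \forall t \near t0, `[- M, M]%classic `<=` (fun x => `|F t x - F t0 x| <= e).
  apply: (h R (nbhs t0) (fun t x => `|F t x - F t0 x| <= e)) => x _.
  have : \forall z \near ((t0, x) : R * R), `|F z.1 z.2 - F t0 z.2| <= e.
    have : (fun z : R * R => F z.1 z.2 - F t0 z.2) z @[z --> (t0, x)] --> (0 : R).
      rewrite -[X in _ --> X](subrr (F t0 x)).
      apply: cvgB; first exact: (cF (t0, x)).
      have := @jc_comp (R * R)%type F _ _ cF (@contC _ _ t0) cont_snd (t0, x).
      exact.
    move=> /cvgrPdist_le /(_ _ e0); apply: filterS => z.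
    by rewrite sub0r normrN.
  case=> -[A B] /= [hA hB] AB; exists (B, A) => //= -[y t] /= [hy ht].
  exact: (AB (t, y)).
apply: filterS => t ht x xM; apply: ht => /=.
by rewrite in_itv/= -ler_norml.
Unshelve. all: by end_near. Qed.

(** The increment splits into a change of end point for the fixed integrand [F t0] and a change of
    integrand, which is uniformly small on the bounded interval by [jc_uniform]. *)
Lemma jc_prim F : jc F -> jc (fun t x => prim (F t) x).
Proof.
move=> cF [t0 x0]; apply/cvgrPdist_le => /= e e0.
pose M := `|x0| + 1.
have M0 : 0 < M by rewrite /M ltr_wpDl.
have e2 : 0 < e / 2 by rewrite divr_gt0.
have eM : 0 < e / 2 / M by rewrite divr_gt0.
have cF0 : continuous (prim (F t0)) by apply: prim_cont; exact: jc_fun.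
have h1 : \forall t \near t0, forall x, `|x| <= M -> `|F t x - F t0 x| <= e / 2 / M.
  exact: jc_uniform.
have h2 : \forall x \near x0, `|x| <= M /\ `|prim (F t0) x0 - prim (F t0) x| <= e / 2.
  near=> x; split; near: x.
    have /cvgrPdist_le/(_ _ ltr01) : x @[x --> x0] --> x0 by exact: cvg_id.
    apply: filterS => x hx; rewrite /M -[x](subrK x0) addrC (le_trans (ler_normD _ _))//.
    by rewrite distrC lerD2l.
  by move/cvgrPdist_le : (cF0 x0) => /(_ _ e2).
have h1' := (@cont_fst (t0, x0)) _ h1.
have h2' := (@cont_snd (t0, x0)) _ h2.
near=> z => /=.
have [tz [xM xe]] : (forall x, `|x| <= M -> `|F z.1 x - F t0 x| <= e / 2 / M) /\
    (`|z.2| <= M /\ `|prim (F t0) x0 - prim (F t0) z.2| <= e / 2).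
  split; near: z; [exact: h1'|exact: h2'].
have -> : prim (F t0) x0 - prim (F z.1) z.2 =
   (prim (F t0) x0 - prim (F t0) z.2) - (prim (F z.1) z.2 - prim (F t0) z.2) by ring.
rewrite (le_trans (ler_normB _ _))// [leRHS]splitr lerD//.
rewrite -primB; try exact: jc_fun.
apply: (@le_trans _ _ (e / 2 / M * `|z.2|)).
  apply: prim_bound; first by apply: contB; exact: jc_fun.
  by move=> y yz; apply: tz; exact: le_trans xM.
by rewrite mulrAC ler_pdivrMr// ler_wpM2l// ltW.
Unshelve. all: by end_near. Qed.

Lemma jc_primT F : jc F -> jc (fun t x => prim (F^~ x) t).
Proof. by move=> /jc_swap/jc_prim/jc_swap. Qed.

Lemma cont_prim_param F x : jc F -> continuous (fun t => prim (F t) x).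
Proof. by move=> /jc_prim h; exact: (jc_cst h). Qed.

Lemma der_eps f (x a : R) : (forall e, 0 < e ->
    \forall y \near x, `|f y - f x - a * (y - x)| <= e * `|y - x|) ->
  der f x a.
Proof.
move=> h.
have H : h^-1 *: (f (h *: 1 + x) - f x) @[h --> 0^'] --> a.
  apply/cvgrPdist_le => e e0; have := h e e0.
  move=> /nbhs_ballP[d /= d0 hd].
  near=> k; have k0 : k != 0 by near: k; exact: nbhs_dnbhs_neq.
  have kd : ball x d (k + x).
    rewrite /ball/= opprD addrCA subrr addr0 normrN.
    by near: k; apply: dnbhs0_lt.
  have := hd _ kd; rewrite addrK /GRing.scale/= mulr1 => hk.
  have -> : a - k^-1 * (f (k + x) - f x) = - (k^-1 * (f (k + x) - f x - a * k)).
    by field.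
  by rewrite normrN normrM normfV mulrC ler_pdivrMr ?normr_gt0.
split; first by apply/cvg_ex; exists a.
exact: (@cvg_lim R^o).
Unshelve. all: by end_near. Qed.

(* The mean value theorem in [t], with [F'] uniformly close to [F' t0], bounds
   the remainder of the difference quotients uniformly in [x]. *)
Lemma der_prim_param F F' t x : (forall t x, der (F^~ x) t (F' t x)) ->
  (forall t, continuous (F t)) -> jc F' ->
  der (fun s => prim (F s) x) t (prim (F' t) x).
Proof.
move=> dF cF cF'; apply: der_eps => e e0.
pose M := `|x| + 1.
have M0 : 0 < M by rewrite /M ltr_wpDl.
have eM : 0 < e / M by rewrite divr_gt0.
have /nbhs_ballP[d /= d0 hd] := jc_uniform t M cF' eM.
apply/nbhs_ballP; exists d => //= s; rewrite /ball/= => st.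
have cF't : continuous (F' t) by exact: jc_fun.
rewrite -primB// mulrC -primZ// -primB; first last.
- by apply: contM => //; exact: contC.
- exact: contB.
apply: (@le_trans _ _ (e / M * `|s - t| * `|x|)).
  apply: prim_bound.
    by apply: contB; [exact: contB|apply: contM => //; exact: contC].
  move=> y yx; have [c ct ->] := mvt t s (dF^~ y).
  rewrite mulrC -mulrBr normrM mulrC ler_wpM2r//; apply: hd.
    by rewrite /ball/= distrC (le_lt_trans ct)// distrC.
  by rewrite /M (le_trans yx)// lerDl.
rewrite mulrAC ler_wpM2r// mulrAC ler_pdivrMr// ler_wpM2l ?(ltW e0)//.
by rewrite /M lerDl.
Qed.

End joint_continuity.

(** * Integrals of periodic functions *)

Section periodic_calculus.
Context {R : realType}.
Implicit Types (f g : R -> R) (F G : R -> R -> R).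
Local Notation der f x a := (is_derive (x : R) (1 : R) (f : R -> R) (a : R)).

Lemma eq_cint f g : f =1 g -> circle_int f = circle_int g.
Proof. by move=> /funext ->. Qed.

Lemma cintD f g : continuous f -> continuous g ->
  circle_int (fun x => f x + g x) = circle_int f + circle_int g.
Proof. by move=> cf cg; rewrite !circle_int_prim primD. Qed.

Lemma cintB f g : continuous f -> continuous g ->
  circle_int (fun x => f x - g x) = circle_int f - circle_int g.
Proof. by move=> cf cg; rewrite !circle_int_prim primB. Qed.

Lemma cintN f : continuous f -> circle_int (fun x => - f x) = - circle_int f.
Proof. by move=> cf; rewrite !circle_int_prim primN. Qed.

Lemma cintZ k f : continuous f ->
  circle_int (fun x => k * f x) = k * circle_int f.
Proof. by move=> cf; rewrite !circle_int_prim primZ. Qed.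

Lemma cintC (k : R) : circle_int (fun=> k) = k.
Proof. by rewrite circle_int_prim primC mulr1. Qed.

Lemma le_cint f g : continuous f -> continuous g ->
  (forall x, 0 <= x <= 1 -> f x <= g x) -> circle_int f <= circle_int g.
Proof. by move=> cf cg h; rewrite !circle_int_prim; exact: le_prim. Qed.

Lemma ge0_cint f : continuous f -> (forall x, 0 <= x <= 1 -> 0 <= f x) ->
  0 <= circle_int f.
Proof. by move=> cf h; rewrite !circle_int_prim; exact: ge0_prim. Qed.

Lemma cint_bound f M : continuous f -> (forall x, 0 <= x <= 1 -> `|f x| <= M) ->
  `|circle_int f| <= M.
Proof.
move=> cf h; rewrite ler_norml; apply/andP; split.
  rewrite lerNl -cintN// -[leRHS]cintC; apply: le_cint; [exact: contN|exact: contC|].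
  by move=> x /h; rewrite ler_norml lerNl => /andP[].
rewrite -[leRHS]cintC; apply: le_cint => //; first exact: contC.
by move=> x /h; rewrite ler_norml => /andP[].
Qed.

Lemma periodicD f (n : int) x : periodic1 f -> f (x + n%:~R) = f x.
Proof.
move=> pf; have key (m : nat) y : f (y + m%:R) = f y.
  elim: m y => [|m IH] y; first by rewrite addr0.
  by rewrite -natr1 addrA pf IH.
case: n => m; first exact: key.
by rewrite NegzE mulrNz -pmulrn -[in RHS](subrK m.+1%:R x) key.
Qed.

(** Every value is taken on [[0, 1]], so pointwise bounds need only be proved on the interval where
    [circle_int] lives. *)
Lemma periodic_ind f (P : R -> Prop) : periodic1 f ->
  (forall x, 0 <= x <= 1 -> P (f x)) -> forall x, P (f x).
Proof.
move=> pf h x; rewrite -(subrK (Num.floor x)%:~R x) periodicD//; apply: h.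
have /andP[h1 h2] := mem_rg1_floor x.
by rewrite subr_ge0 h1/= lerBlDl ltW// -intrD1.
Qed.

Lemma periodic_bounded f : continuous f -> periodic1 f ->
  exists2 M, 0 <= M & forall x, `|f x| <= M.
Proof.
move=> cf pf.
have [|c _ hc] := @EVT_max R (fun x => `|f x|) 0 1 ler01.
  by apply: continuous_subspaceT; apply: cont_comp cf _; exact: norm_continuous.
exists `|f c| => //; apply: (periodic_ind (P := fun y => `|y| <= `|f c|)) => //.
Qed.

Lemma prim_periodic f a : continuous f -> periodic1 f ->
  prim f (a + 1) = prim f a + circle_int f.
Proof.
move=> cf pf; rewrite circle_int_prim.
have d y : der (fun y => prim f (y + 1)) y (f y).
  rewrite -[f y]pf; apply: (der_eq (der_comp (derD (der_id y) (derC 1 y))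
    (der_prim _ cf))); ring.
have := der_eq_fun d (fun y => der_prim y cf) 0 a.
by rewrite prim0 add0r subr0 => <-; ring.
Qed.

Lemma prim_mean0_periodic g : continuous g -> periodic1 g ->
  circle_int g = 0 -> periodic1 (prim g).
Proof. by move=> cg pg g0 z; rewrite prim_periodic// g0 addr0. Qed.

Lemma cint_der f f' : periodic1 f -> continuous f' ->
  (forall x, der f x (f' x)) -> circle_int f' = 0.
Proof.
move=> pf cf h; rewrite circle_int_prim (prim_der 1 cf h).
by rewrite -[1]add0r pf subrr.
Qed.

Lemma cint_subst f q w : continuous f -> periodic1 f -> continuous w ->
  (forall x, der q x (w x)) -> (forall x, q (x + 1) = q x + 1) ->
  circle_int f = circle_int (fun x => f (q x) * w x).
Proof.
move=> cf pf cw dq q1; have cq : continuous q := ders_cont dq.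
have d x : der (fun x => prim f (q x)) x (f (q x) * w x).
  exact: der_comp (dq x) (der_prim _ cf).
have c : continuous (fun x => f (q x) * w x).
  by apply: contM => //; exact: cont_comp.
rewrite [RHS]circle_int_prim (prim_der 1 c d) -[X in q X]add0r q1.
by rewrite prim_periodic//; ring.
Qed.

Lemma cint_shift f a : continuous f -> periodic1 f ->
  circle_int (fun x => f (a + x)) = circle_int f.
Proof.
move=> cf pf.
have d y : der (fun x => a + x) y 1.
  by apply: (der_eq (derD (derC a y) (der_id y))); rewrite add0r.
rewrite (cint_subst cf pf (@contC _ _ 1) d); last by move=> x; rewrite addrA.
by apply: eq_cint => x; rewrite mulr1.
Qed.

Lemma periodic_der f f' : periodic1 f -> (forall x, der f x (f' x)) -> periodic1 f'.
Proof.
move=> pf df x; apply: der_unique _ (df x).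
apply: (@der_ext _ (fun z => f (z + 1))); first by move=> z; exact: pf.
by apply: (der_eq (der_comp (derD (der_id x) (derC 1 x)) (df (x + 1)))); ring.
Qed.

(* Integrating by parts, [f x] is the integral of [(y - 1/2) f' (x + y)]; then
   Cauchy-Schwarz, with [1/12] the integral of [(y - 1/2)^2]. *)
Lemma sobolev_sup f f' x : periodic1 f -> continuous f' ->
  (forall x, der f x (f' x)) -> circle_int f = 0 ->
  12 * f x ^+ 2 <= circle_int (fun y => f' y ^+ 2).
Proof.
move=> pf cf' h f0; have cf := ders_cont h.
have pf' := periodic_der pf h.
have ch : continuous (fun y : R => y - 2^-1).
  by apply: contB; [exact: cont_id|exact: contC].
have cs : continuous (fun y : R => x + y).
  by apply: contD; [exact: contC|exact: cont_id].
have csf' : continuous (fun y => f' (x + y)) by exact: cont_comp.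
have csf : continuous (fun y => f (x + y)) by exact: cont_comp.
have dsf y : der (fun y => f (x + y)) y (f' (x + y)).
  by apply: (der_eq (der_comp (derD (derC x y) (der_id y)) (h (x + y)))); ring.
have e1 : circle_int (fun y => (y - 2^-1) * f' (x + y)) = f x.
  have d y : der (fun y => (y - 2^-1) * f (x + y)) y
      (f (x + y) + (y - 2^-1) * f' (x + y)).
    apply: (der_eq (derM (derB (der_id y) (derC 2^-1 y)) (dsf y))); ring.
  have cc : continuous (fun y : R => (y - 2^-1) * f' (x + y)) by exact: contM.
  have cd : continuous (fun y : R => f (x + y) + (y - 2^-1) * f' (x + y)) by exact: contD.
  have := prim_der 1 cd d.
  rewrite -circle_int_prim cintD// cint_shift// f0 add0r => ->.
  by rewrite pf addr0; field.
have e2 : circle_int (fun y : R => (y - 2^-1) ^+ 2) = 12^-1.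
  have d y : der (fun y => 3^-1 * (y - 2^-1) * (y - 2^-1) ^+ 2) y ((y - 2^-1) ^+ 2).
    apply: (der_eq (derM (derZ 3^-1 (derB (der_id y) (derC 2^-1 y)))
      (der_sqr (derB (der_id y) (derC 2^-1 y))))).
    by field.
  by rewrite circle_int_prim (prim_der 1 (cont_sqr ch) d); field.
(* The integral of [(f' - l (y - 1/2))^2] is that of [f'^2] minus [2 l f x] plus [l^2 / 12]; it is
   smallest at [l = 12 f x]. *)
have : 0 <= circle_int (fun y => (f' (x + y) - (12 * f x) * (y - 2^-1)) ^+ 2).
  apply: ge0_cint => [|y _]; last exact: sqr_ge0.
  by apply: cont_sqr; apply: contB => //; apply: contM => //; exact: contC.
have -> : (fun y => (f' (x + y) - (12 * f x) * (y - 2^-1)) ^+ 2) =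
    (fun y => (f' (x + y) ^+ 2 - (24 * f x) * ((y - 2^-1) * f' (x + y))) +
       (12 * f x) ^+ 2 * (y - 2^-1) ^+ 2).
  by apply/funext => y; ring.
have c1 : continuous (fun y => f' (x + y) ^+ 2) by exact: cont_sqr.
have c2 : continuous (fun y : R => (y - 2^-1) * f' (x + y)) by exact: contM.
have c3 : continuous (fun y : R => (y - 2^-1) ^+ 2) by exact: cont_sqr.
rewrite cintD; first last.
- by apply: contM => //; exact: contC.
- by apply: contB => //; apply: contM => //; exact: contC.
rewrite cintB//; last by apply: contM => //; exact: contC.
rewrite !cintZ// e1 e2 (@cint_shift (fun y => f' y ^+ 2)); last first.
- by move=> y; rewrite pf'.
- exact: cont_sqr.
by nra.
Qed.

Lemma jc_periodic_uniform F t0 (e : R) : jc F -> (forall t, periodic1 (F t)) ->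
  0 < e -> \forall t \near t0, forall x, `|F t x - F t0 x| <= e.
Proof.
move=> cF pF e0; have := jc_uniform t0 1 cF e0; apply: filterS => t h x.
apply: (periodic_ind (f := fun x => F t x - F t0 x) (P := fun y => `|y| <= e)).
  by move=> y; rewrite !pF.
by move=> y /andP[y0 y1]; apply: h; rewrite ger0_norm.
Qed.

Lemma jc_cint (G : R -> R -> R) : jc G -> jc (fun t _ => circle_int (G t)).
Proof.
move=> jG; have cG := cont_prim_param (x := 1) jG.
have -> : (fun t (_ : R) => circle_int (G t)) = (fun t _ => prim (G t) 1).
  by apply/funext => t; apply/funext => x; rewrite circle_int_prim.
exact: cont_comp cont_fst cG.
Qed.

End periodic_calculus.

(** * Fourier coefficients *)

Section fourier.
Context {R : realType}.
Implicit Types (f g : R -> R) (n m : int).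
Local Notation der f x a := (is_derive (x : R) (1 : R) (f : R -> R) (a : R)).
Local Notation mu := (@lebesgue_measure R).

Definition freq n : R := 2 * pi * n%:~R.
(** The argument of the cosine is spelled exactly as in [fourier_sqr], which makes [fourier_sqrE]
    hold by conversion. *)
Definition cosn n (x : R) := cos (2 * pi * n%:~R * x).
Definition sinn n (x : R) := sin (2 * pi * n%:~R * x).

Lemma der_cosn n x : der (cosn n) x (- freq n * sinn n x).
Proof.
apply: (der_eq (der_comp (derZ (2 * pi * n%:~R) (der_id x)) (is_derive_cos _))).
by rewrite /freq /sinn; ring.
Qed.

Lemma der_sinn n x : der (sinn n) x (freq n * cosn n x).
Proof.
apply: (der_eq (der_comp (derZ (2 * pi * n%:~R) (der_id x)) (is_derive_sin _))).
by rewrite /freq /cosn; ring.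
Qed.

Lemma cosn_cont n : continuous (cosn n).
Proof. exact: ders_cont (der_cosn n). Qed.

Lemma sinn_cont n : continuous (sinn n).
Proof. exact: ders_cont (der_sinn n). Qed.

Lemma cosn_periodic n : periodic1 (cosn n).
Proof.
have pc : periodic1 (fun x : R => cos (2 * pi * x)).
  move=> x; rewrite mulrDr mulr1 (_ : 2 * pi = pi *+ 2); last by rewrite mulr_natl.
  exact: cosD2pi.
move=> x; have := periodicD n (n%:~R * x) pc.
rewrite /cosn => e; rewrite mulrDr mulr1 -[in RHS]mulrA -e; congr cos; ring.
Qed.

Lemma sinn_periodic n : periodic1 (sinn n).
Proof.
have pc : periodic1 (fun x : R => sin (2 * pi * x)).
  move=> x; rewrite mulrDr mulr1 (_ : 2 * pi = pi *+ 2); last by rewrite mulr_natl.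
  exact: sinD2pi.
move=> x; have := periodicD n (n%:~R * x) pc.
rewrite /sinn => e; rewrite mulrDr mulr1 -[in RHS]mulrA -e; congr sin; ring.
Qed.

Lemma normr_cosn n x : `|cosn n x| <= 1.
Proof. by rewrite ler_norml cos_geN1 cos_le1. Qed.

Lemma normr_sinn n x : `|sinn n x| <= 1.
Proof. by rewrite ler_norml sin_geN1 sin_le1. Qed.

Lemma freq_eq0 n : (freq n == 0) = (n == 0).
Proof. by rewrite /freq !mulf_eq0 intr_eq0 pnatr_eq0/= gt_eqF ?pi_gt0. Qed.

Lemma freqD n m x : 2 * pi * (n + m)%:~R * x =
  2 * pi * n%:~R * x + 2 * pi * m%:~R * x :> R.
Proof. by rewrite intrD; ring. Qed.

Lemma freqN n x : 2 * pi * (- n)%:~R * x = - (2 * pi * n%:~R * x) :> R.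
Proof. by rewrite mulrNz; ring. Qed.

Lemma cosnM n m x : cosn n x * cosn m x = 2^-1 * (cosn (n - m) x + cosn (n + m) x).
Proof. by rewrite /cosn !freqD freqN !cosD cosN sinN; field. Qed.

Lemma sinnM n m x : sinn n x * sinn m x = 2^-1 * (cosn (n - m) x - cosn (n + m) x).
Proof. by rewrite /sinn /cosn !freqD freqN !cosD cosN sinN; field. Qed.

Lemma sincosnM n m x : sinn n x * cosn m x = 2^-1 * (sinn (n - m) x + sinn (n + m) x).
Proof. by rewrite /sinn /cosn !freqD freqN !sinD sinN cosN; field. Qed.

Lemma cosn0 x : cosn 0 x = 1.
Proof. by rewrite /cosn mulr0 mul0r cos0. Qed.

Lemma sinn0 x : sinn 0 x = 0.
Proof. by rewrite /sinn mulr0 mul0r sin0. Qed.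

Lemma cint_cosn n : circle_int (cosn n) = (n == 0)%:R.
Proof.
have [->|n0] := eqVneq n 0.
  by rewrite -[RHS]cintC; apply: eq_cint => x; exact: cosn0.
have : circle_int (fun x => freq n * cosn n x) = 0.
  apply: cint_der (der_sinn n); first exact: sinn_periodic.
  by apply: contM; [exact: contC|exact: cosn_cont].
rewrite cintZ; last exact: cosn_cont.
by move=> /eqP; rewrite mulf_eq0 freq_eq0 (negbTE n0)/= => /eqP.
Qed.

Lemma cint_sinn n : circle_int (sinn n) = 0.
Proof.
have [->|n0] := eqVneq n 0.
  by rewrite -[RHS]cintC; apply: eq_cint => x; exact: sinn0.
have : circle_int (fun x => - freq n * sinn n x) = 0.
  apply: cint_der (der_cosn n); first exact: cosn_periodic.
  by apply: contM; [exact: contC|exact: sinn_cont].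
rewrite cintZ; last exact: sinn_cont.
by move=> /eqP; rewrite mulf_eq0 oppr_eq0 freq_eq0 (negbTE n0)/= => /eqP.
Qed.

Lemma cint_cosnM n m : circle_int (fun x => cosn n x * cosn m x) =
  2^-1 * ((m == n)%:R + (m == - n)%:R).
Proof.
rewrite (eq_cint (cosnM n m)) cintZ ?cintD; try exact: cosn_cont.
  by rewrite !cint_cosn subr_eq0 addr_eq0 -eqr_oppLR [n == m]eq_sym [- n == _]eq_sym.
by apply: contD; exact: cosn_cont.
Qed.

Lemma cint_sinnM n m : circle_int (fun x => sinn n x * sinn m x) =
  2^-1 * ((m == n)%:R - (m == - n)%:R).
Proof.
rewrite (eq_cint (sinnM n m)) cintZ ?cintB; try exact: cosn_cont.
  by rewrite !cint_cosn subr_eq0 addr_eq0 -eqr_oppLR [n == m]eq_sym [- n == _]eq_sym.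
by apply: contB; exact: cosn_cont.
Qed.

Lemma cint_sincosnM n m : circle_int (fun x => sinn n x * cosn m x) = 0.
Proof.
rewrite (eq_cint (sincosnM n m)) cintZ ?cintD; try exact: sinn_cont.
  by rewrite !cint_sinn addr0 mulr0.
by apply: contD; exact: sinn_cont.
Qed.

(** * Integrable functions on the circle and Bessel's inequality *)

Definition cintegrable f := mu.-integrable `[0, 1]%classic (EFin \o f).

Lemma cint_integrableD f g : cintegrable f -> cintegrable g ->
  circle_int (fun x => f x + g x) = circle_int f + circle_int g.
Proof. by move=> hf hg; rewrite /circle_int RintegralD. Qed.

Lemma cint_integrableB f g : cintegrable f -> cintegrable g ->
  circle_int (fun x => f x - g x) = circle_int f - circle_int g.
Proof. by move=> hf hg; rewrite /circle_int RintegralB. Qed.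

Lemma cint_integrableZ k f : cintegrable f ->
  circle_int (fun x => k * f x) = k * circle_int f.
Proof. by move=> hf; rewrite /circle_int RintegralZl. Qed.

Lemma cont_cintegrable f : continuous f -> cintegrable f.
Proof. exact: cont_integrable. Qed.

Lemma cintegrableD f g : cintegrable f -> cintegrable g ->
  cintegrable (fun x => f x + g x).
Proof. by move=> hf hg; exact: (@integrableD _ _ _ mu _ _ (EFin \o f) (EFin \o g)). Qed.

Lemma cintegrableZ k f : cintegrable f -> cintegrable (fun x => k * f x).
Proof. by move=> hf; exact: (@integrableZl _ _ _ mu _ _ k (EFin \o f)). Qed.

Lemma cintegrableB f g : cintegrable f -> cintegrable g ->
  cintegrable (fun x => f x - g x).
Proof. by move=> hf hg; exact: (@integrableB _ _ _ mu _ _ (EFin \o f) (EFin \o g)). Qed.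

Lemma cintegrableM f g : cintegrable f -> continuous g ->
  cintegrable (fun x => f x * g x).
Proof.
move=> hf cg; have [|c _ hc] := @EVT_max R (fun x => `|g x|) 0 1 ler01.
  by apply: continuous_subspaceT; apply: cont_comp cg _; exact: norm_continuous.
apply: (@integrableMl _ _ _ mu _ _ (EFin \o f) g) => //.
  exact: measurable_funTS (continuous_measurable_fun cg).
exists `|g c|; split; first exact: num_real.
by move=> M hM x /= h; rewrite (le_trans (hc x h))// ltW.
Qed.

Lemma L2_sqr_integrable f : L2_circle f -> cintegrable (fun x => f x ^+ 2).
Proof.
case=> _ mf f2; apply/integrableP; split.
  apply/measurable_EFinP; apply: measurable_funX; exact: measurable_funTS.
apply: le_lt_trans f2; rewrite le_eqVlt; apply/orP; left; apply/eqP.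
by apply: eq_integral => x _ /=; rewrite ger0_norm// sqr_ge0.
Qed.

Lemma L2_integrable f : L2_circle f -> cintegrable f.
Proof.
move=> h; have [_ mf _] := h.
have h1 : cintegrable (fun x => 1 + f x ^+ 2).
  apply: cintegrableD; last exact: L2_sqr_integrable.
  by apply: cont_cintegrable; exact: contC.
apply: le_integrable h1 => //.
  by apply/measurable_EFinP; exact: measurable_funTS.
move=> x _; rewrite /= lee_fin.
rewrite [leRHS]ger0_norm; last by rewrite addr_ge0// sqr_ge0.
by rewrite -[f x ^+ 2]real_normK ?num_real//; nra.
Qed.

Lemma cont_L2 f : continuous f -> periodic1 f -> L2_circle f.
Proof.
move=> cf pf; split => //; first exact: continuous_measurable_fun.
have /integrableP[_] := cont_cintegrable (cont_sqr cf).
apply: le_lt_trans; rewrite le_eqVlt; apply/orP; left; apply/eqP.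
by apply: eq_integral => x _ /=; rewrite ger0_norm// sqr_ge0.
Qed.

Lemma cint_sum (I : Type) (s : seq I) (F : I -> R -> R) :
  (forall i, cintegrable (F i)) ->
  cintegrable (fun x => \sum_(i <- s) F i x) /\
  circle_int (fun x => \sum_(i <- s) F i x) = \sum_(i <- s) circle_int (F i).
Proof.
move=> h; elim: s => [|i s [IH1 IH2]].
  rewrite big_nil -[RHS](cintC 0); split.
    under [fun x => _]funext do rewrite big_nil.
    by apply: cont_cintegrable; exact: contC.
  by apply: eq_cint => x; rewrite big_nil.
under [fun x => _]funext do rewrite big_cons.
by rewrite big_cons cint_integrableD// IH2; split => //; exact: cintegrableD.
Qed.

Lemma cont_sum (I : Type) (s : seq I) (F : I -> R -> R) :
  (forall i, continuous (F i)) -> continuous (fun x => \sum_(i <- s) F i x).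
Proof.
move=> h; elim: s => [|i s IH].
  by under [fun x => _]funext do rewrite big_nil; exact: contC.
by under [fun x => _]funext do rewrite big_cons; exact: contD.
Qed.

Lemma sum_delta (s : seq int) (k : int) (c : R) : uniq s -> 0 <= c ->
  \sum_(m <- s) (m == k)%:R * c <= c.
Proof.
move=> + c0; elim: s => [|m s IH]; first by rewrite big_nil.
rewrite big_cons /= => /andP[ms us]; have [mk|mk] := eqVneq m k; last first.
  by rewrite mul0r add0r IH.
rewrite mul1r big1_seq ?addr0// => j /andP[_ js].
by case: eqVneq => [jk|]; [rewrite mk -jk js in ms|rewrite mul0r].
Qed.

Local Notation fcos f n := (circle_int (fun x => f x * cosn n x)).
Local Notation fsin f n := (circle_int (fun x => f x * sinn n x)).

Lemma fourier_sqrE f n : fourier_sqr f n = fcos f n ^+ 2 + fsin f n ^+ 2.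
Proof. by []. Qed.

Lemma fourier_sqr_ge0 f n : 0 <= fourier_sqr f n.
Proof. by rewrite addr_ge0 ?sqr_ge0. Qed.

Lemma fcos0 f : fcos f 0 = circle_int f.
Proof. by apply: eq_cint => x; rewrite cosn0 mulr1. Qed.

Lemma fsin0 f : fsin f 0 = 0.
Proof. by rewrite -[RHS]cintC; apply: eq_cint => x; rewrite sinn0 mulr0. Qed.

Lemma fcosN f n : fcos f (- n) = fcos f n.
Proof. by apply: eq_cint => x; rewrite /cosn freqN cosN. Qed.

Lemma fsinN f n : cintegrable f -> fsin f (- n) = - fsin f n.
Proof.
move=> hf; transitivity (circle_int (fun x => -1 * (f x * sinn n x))).
  by apply: eq_cint => x; rewrite /sinn freqN sinN; ring.
by rewrite cint_integrableZ ?mulN1r//; exact: cintegrableM (@sinn_cont n).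
Qed.

(** The real form of the Fourier sum. No factor 2 appears because [n] and [- n] give the same real
    function and both are meant to occur in [s]. *)
Definition trig_sum f (s : seq int) (x : R) :=
  \sum_(n <- s) (fcos f n * cosn n x + fsin f n * sinn n x).

Lemma trig_term_cont f n :
  continuous (fun x => fcos f n * cosn n x + fsin f n * sinn n x).
Proof.
by apply: contD; apply: contM; (try exact: contC); [exact: cosn_cont|exact: sinn_cont].
Qed.

Lemma trig_sum_cont f s : continuous (trig_sum f s).
Proof. by apply: cont_sum => n; exact: trig_term_cont. Qed.

Lemma cint_trig_sum f s : cintegrable f ->
  circle_int (fun x => f x * trig_sum f s x) = \sum_(n <- s) fourier_sqr f n.
Proof.
move=> hf; have hc n := cintegrableM hf (@cosn_cont n).
have hs n := cintegrableM hf (@sinn_cont n).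
pose F n x := fcos f n * (f x * cosn n x) + fsin f n * (f x * sinn n x).
have hF n : cintegrable (F n) by apply: cintegrableD; exact: cintegrableZ.
have [_] := cint_sum s hF => e.
transitivity (circle_int (fun x => \sum_(n <- s) F n x)).
  apply: eq_cint => x; rewrite mulr_sumr; apply: eq_bigr => n _.
  by rewrite /F; ring.
rewrite e; apply: eq_bigr => n _; rewrite /F.
by rewrite cint_integrableD ?cint_integrableZ//; exact: cintegrableZ.
Qed.

(** The terms [n] and [m] of the square interact only for [m = n] and [m = - n], each time for half
    of [fourier_sqr f n]. The inequality is strict when [s] contains some [n] with a nonzero
    coefficient but not [- n]. *)
Lemma cint_trig_sum_sqr f s : cintegrable f -> uniq s ->
  circle_int (fun x => trig_sum f s x ^+ 2) <= \sum_(n <- s) fourier_sqr f n.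
Proof.
move=> hf us.
pose X n x := fcos f n * cosn n x + fsin f n * sinn n x.
have cX n : continuous (X n) by exact: trig_term_cont.
have e1 : circle_int (fun x => trig_sum f s x ^+ 2) =
    \sum_(n <- s) \sum_(m <- s) circle_int (fun x => X n x * X m x).
  transitivity (circle_int (fun x => \sum_(n <- s) \sum_(m <- s) X n x * X m x)).
    apply: eq_cint => x; rewrite expr2 mulr_suml; apply: eq_bigr => n _.
    by rewrite mulr_sumr.
  have [|_ ->] := @cint_sum _ s (fun n x => \sum_(m <- s) X n x * X m x).
    by move=> n; apply: cont_cintegrable; apply: cont_sum => m; exact: contM.
  apply: eq_bigr => n _.
  have [|_ ->//] := @cint_sum _ s (fun m x => X n x * X m x).
  by move=> m; apply: cont_cintegrable; exact: contM.
rewrite e1; apply: ler_sum => n _.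
have e2 m : circle_int (fun x => X n x * X m x) =
    (m == n)%:R * (2^-1 * fourier_sqr f n) + (m == - n)%:R * (2^-1 * fourier_sqr f n).
  have -> : (fun x => X n x * X m x) = (fun x =>
      ((fcos f n * fcos f m) * (cosn n x * cosn m x) +
       (fsin f n * fsin f m) * (sinn n x * sinn m x)) +
      ((fcos f n * fsin f m) * (sinn m x * cosn n x) +
       (fsin f n * fcos f m) * (sinn n x * cosn m x))).
    by apply/funext => x; rewrite /X; ring.
  have ccc : continuous (fun x => cosn n x * cosn m x).
    by apply: contM; exact: cosn_cont.
  have css : continuous (fun x => sinn n x * sinn m x).
    by apply: contM; exact: sinn_cont.
  have csc k l : continuous (fun x => sinn k x * cosn l x).
    by apply: contM; [exact: sinn_cont|exact: cosn_cont].
  rewrite cintD; [|exact: (contD (contZ ccc) (contZ css))|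
                   exact: (contD (contZ (csc m n)) (contZ (csc n m)))].
  rewrite cintD; [|exact: contZ ccc|exact: contZ css].
  rewrite cintD; [|exact: contZ (csc m n)|exact: contZ (csc n m)].
  rewrite !cintZ//.
  rewrite cint_cosnM cint_sinnM !cint_sincosnM !mulr0 !addr0 fourier_sqrE.
  have [->|mn] := eqVneq m n.
    (* At [n = 0] the two Kronecker symbols coincide and their halves add up. *)
    have [e|_] := eqVneq n (- n); last by rewrite /=; field.
    have -> : n = 0 by lia.
    rewrite (_ : fsin f 0 = 0) /=; first by field.
    exact: fsin0.
  have [->|_] := eqVneq m (- n); last by rewrite /=; ring.
  by rewrite fcosN fsinN//=; field.
under eq_bigr do rewrite e2.
rewrite big_split/=.
have h0 : 0 <= 2^-1 * fourier_sqr f n by rewrite mulr_ge0// fourier_sqr_ge0.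
rewrite (le_trans (lerD (sum_delta n us h0) (sum_delta (- n) us h0)))//.
by rewrite -mulrDl -[2^-1]mul1r -splitr mul1r.
Qed.

(** Expand the integral of [(f - S)^2 >= 0] with [S] the trigonometric sum: the cross term is
    exactly twice the sum of the coefficients, and the integral of [S^2] is at most that sum. *)
Lemma bessel f s : L2_circle f -> uniq s ->
  \sum_(n <- s) fourier_sqr f n <= circle_int (fun x => f x ^+ 2).
Proof.
move=> hf us; have h1 := L2_integrable hf; have h2 := L2_sqr_integrable hf.
have ct := @trig_sum_cont f s.
have c1 := cintegrableM h1 ct.
have c2 := cont_cintegrable (cont_sqr ct).
have : 0 <= circle_int (fun x => (f x - trig_sum f s x) ^+ 2).
  by apply: Rintegral_ge0 => x _; exact: sqr_ge0.
have -> : (fun x => (f x - trig_sum f s x) ^+ 2) =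
    (fun x => (f x ^+ 2 - 2 * (f x * trig_sum f s x)) + trig_sum f s x ^+ 2).
  by apply/funext => x; ring.
rewrite cint_integrableD//; last by apply: cintegrableB => //; exact: cintegrableZ.
rewrite cint_integrableB//; last exact: cintegrableZ.
rewrite cint_integrableZ// cint_trig_sum//.
by have := cint_trig_sum_sqr h1 us; lra.
Qed.

Lemma fcos_der f f' n : periodic1 f -> continuous f' ->
  (forall x, der f x (f' x)) -> fcos f' n = freq n * fsin f n.
Proof.
move=> pf cf' h; have cf := ders_cont h.
have c1 : continuous (fun x => f' x * cosn n x).
  by apply: contM => //; exact: cosn_cont.
have c2 : continuous (fun x => f x * sinn n x).
  by apply: contM => //; exact: sinn_cont.
have : circle_int (fun x => f' x * cosn n x - freq n * (f x * sinn n x)) = 0.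
  apply: (@cint_der _ (fun x => f x * cosn n x)).
  - by move=> x; rewrite pf cosn_periodic.
  - by apply: contB => //; apply: contM => //; exact: contC.
  - by move=> x; apply: (der_eq (derM (h x) (der_cosn n x))); ring.
rewrite cintB ?cintZ//; first by move=> /eqP; rewrite subr_eq0 => /eqP.
by apply: contM => //; exact: contC.
Qed.

Lemma fsin_der f f' n : periodic1 f -> continuous f' ->
  (forall x, der f x (f' x)) -> fsin f' n = - freq n * fcos f n.
Proof.
move=> pf cf' h; have cf := ders_cont h.
have c1 : continuous (fun x => f' x * sinn n x).
  by apply: contM => //; exact: sinn_cont.
have c2 : continuous (fun x => f x * cosn n x).
  by apply: contM => //; exact: cosn_cont.
have : circle_int (fun x => f' x * sinn n x + freq n * (f x * cosn n x)) = 0.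
  apply: (@cint_der _ (fun x => f x * sinn n x)).
  - by move=> x; rewrite pf sinn_periodic.
  - by apply: contD => //; apply: contM => //; exact: contC.
  - by move=> x; apply: (der_eq (derM (h x) (der_sinn n x))); ring.
rewrite cintD ?cintZ//; first by lra.
by apply: contM => //; exact: contC.
Qed.

Lemma fourier_sqr_der f f' n : periodic1 f -> continuous f' ->
  (forall x, der f x (f' x)) ->
  fourier_sqr f' n = freq n ^+ 2 * fourier_sqr f n.
Proof.
by move=> pf cf' h; rewrite !fourier_sqrE (fcos_der n pf cf' h) (fsin_der n pf cf' h); ring.
Qed.

End fourier.

(** * Completeness of the trigonometric system *)

Section completeness.
Context {R : realType}.
Implicit Types (f g p : R -> R) (n m : int).
Local Notation mu := (@lebesgue_measure R).

(** The image of Lebesgue measure under the translation has the same values on half-open intervals,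
    and these determine the measure. *)
Lemma lebesgue_measure_shift (t : R) (A : set R) : measurable A ->
  mu ((fun x => x + t) @^-1` A) = mu A.
Proof.
move=> mA.
pose sh (x : measurableTypeR R) : measurableTypeR R := x + t.
have mt : measurable_fun [set: measurableTypeR R] sh.
  by apply: continuous_measurable_fun; apply: contD; [exact: cont_id|exact: contC].
apply/esym; apply: (lebesgue_measure_unique
  (mu := measure_function_pushforward__canonical__measure_function_Measure mu mt)) => //.
move=> X /ocitvP[->|[[a b] /= ab ->]].
  by rewrite !measure0.
rewrite -[RHS]/(mu (sh @^-1` _)) (_ : sh @^-1` _ = `]a - t, b - t]%classic); last first.
  by apply/seteqP; split => x /=; rewrite !in_itv/= ltrBlDr lerBrDr.
rewrite !lebesgue_measure_itv/= !lte_fin ab ltrD2r ab -!EFinB.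
by congr EFin; ring.
Qed.

Lemma negligible_shift (t : R) (A : set R) : mu.-negligible A ->
  mu.-negligible ((fun x => x + t) @^-1` A).
Proof.
move=> [B [mB B0 AB]]; exists ((fun x => x + t) @^-1` B); split.
- rewrite -[X in measurable X]setTI.
  have mt : measurable_fun [set: R] (fun x : R => x + t).
    by apply: continuous_measurable_fun; apply: contD; [exact: cont_id|exact: contC].
  exact: mt.
- by rewrite lebesgue_measure_shift.
- by move=> x; exact: AB.
Qed.

(** The line is covered by countably many integer translates of []0, 1[] and of the point 0;
    translations preserve null sets. *)
Lemma periodic_negligible f : periodic1 f ->
  mu.-negligible [set x | 0 < x < 1 /\ f x != 0] ->
  {ae mu, forall x, f x = 0}.
Proof.
move=> pf h; rewrite /almost_everywhere.
have hN : mu.-negligible ([set x | 0 < x < 1 /\ f x != 0] `|` [set 0]).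
  apply: negligibleU => //; apply/negligibleP; first exact: measurable_set1.
  exact: lebesgue_measure_set1.
set N := (_ `|` _) in hN.
have h1 : mu.-negligible (\bigcup_k (fun x : R => x + k%:R) @^-1` N).
  by apply: negligible_bigcup => k; exact: negligible_shift.
have h2 : mu.-negligible (\bigcup_k (fun x : R => x + - k%:R) @^-1` N).
  by apply: negligible_bigcup => k; exact: negligible_shift.
apply: (negligibleS _ (negligibleU h1 h2)) => x /= /eqP fx.
pose z := Num.floor x.
have /andP[z1 z2] := mem_rg1_floor x; rewrite -/z in z1 z2.
have xz : N (x + (- z)%:~R).
  have [x0|x0] := eqVneq (x + (- z)%:~R) 0; first by right.
  left; rewrite /= periodicD//; split => //.
  by move: x0 z1 z2; rewrite intrN => x0 z1 z2; rewrite lt_neqAle eq_sym x0; lra.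
case: z xz {z1 z2} => k xk.
  by right; exists k => //=; move: xk; rewrite intrN.
by left; exists k.+1 => //=; move: xk; rewrite NegzE opprK.
Qed.

Lemma bernoulli_ge (x : R) (k : nat) : -1 <= x -> 1 + k%:R * x <= (1 + x) ^+ k.
Proof.
move=> x1; elim: k => [|k IH]; first by rewrite mul0r addr0 expr0.
have x10 : 0 <= 1 + x by lra.
rewrite exprS (le_trans _ (ler_wpM2l x10 IH))// -natr1.
by have : 0 <= k%:R * x ^+ 2 by [rewrite mulr_ge0// sqr_ge0]; nra.
Qed.

(** The polynomials of the Brosowski-Deutsch proof of the Stone-Weierstrass theorem. By Bernoulli's
    inequality they tend to 1 for [0 <= y < 1/2] and to 0 for [1/2 < y <= 1]. *)
Definition step_poly (k : nat) (y : R) := (1 - y ^+ k) ^+ (2 ^ k)%N.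

Lemma step_poly_itv k (y : R) : 0 <= y <= 1 -> 0 <= step_poly k y <= 1.
Proof.
move=> /andP[y0 y1]; have h : 0 <= y ^+ k <= 1 by rewrite exprn_ge0// exprn_ile1.
by rewrite /step_poly exprn_ge0 ?exprn_ile1//; lra.
Qed.

Lemma step_poly_small k (y : R) : 0 <= y <= 1 -> 1 - (2 * y) ^+ k <= step_poly k y.
Proof.
move=> /andP[y0 y1]; have h : 0 <= y ^+ k <= 1 by rewrite exprn_ge0// exprn_ile1.
rewrite /step_poly (le_trans _ (bernoulli_ge _ _)) ?lerN2//; last by lra.
by rewrite exprMn natrX mulrN.
Qed.

(** The product with [(1 + y^k)^(2^k)] is [(1 - y^(2k))^(2^k) <= 1], and by Bernoulli that factor is
    at least [(2 y)^k]. *)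
Lemma step_poly_large k (y : R) : 0 < y <= 1 -> step_poly k y <= ((2 * y)^-1) ^+ k.
Proof.
move=> /andP[y0 y1]; have h : 0 <= y ^+ k <= 1 by rewrite exprn_ge0 ?exprn_ile1// ltW.
have yk : 0 < (2 * y) ^+ k by rewrite exprn_gt0// mulr_gt0.
rewrite exprVn -[leRHS]div1r ler_pdivlMr//.
have s0 : 0 <= step_poly k y by rewrite /step_poly exprn_ge0//; lra.
apply: (@le_trans _ _ (step_poly k y * (1 + y ^+ k) ^+ (2 ^ k)%N)).
  rewrite ler_wpM2l// (le_trans _ (bernoulli_ge _ _))//; last by lra.
  by rewrite exprMn natrX lerDr.
rewrite /step_poly -exprMn exprn_ile1//; nra.
Qed.

Lemma step_poly_cvg (y : R) : 0 <= y <= 1 -> y != 2^-1 ->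
  step_poly k y @[k --> \oo] --> ((y < 2^-1)%R%:R : R).
Proof.
move=> y01 y2; have [yl|yl] := boolP (y < 2^-1).
  have z0 : (2 * y) ^+ k @[k --> \oo] --> (0 : R).
    by apply: cvg_expr; rewrite ger0_norm; lra.
  apply: (squeeze_cvgr (f := fun k => 1 - (2 * y) ^+ k) (h := fun=> 1)).
  - apply: nearW => k; rewrite step_poly_small//.
    by have /andP[_ ->] := step_poly_itv k y01.
  - by rewrite -[X in _ --> X]subr0; apply: cvgB z0; exact: cvg_cst.
  - exact: cvg_cst.
have yg : 2^-1 < y by rewrite lt_neqAle eq_sym y2 leNgt.
have z1 : 1 < 2 * y by lra.
have z0 : ((2 * y)^-1) ^+ k @[k --> \oo] --> (0 : R).
  apply: cvg_expr; rewrite ger0_norm ?invr_ge0 ?invf_lt1//; lra.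
apply: (squeeze_cvgr (f := fun=> 0) (h := fun k => ((2 * y)^-1) ^+ k)) => //.
- apply: nearW => k; rewrite step_poly_large ?andbT; last by lra.
  by have /andP[->] := step_poly_itv k y01.
- exact: cvg_cst.
Qed.

Section orthogonal.
Variable f : R -> R.
Hypothesis fi : cintegrable f.
Hypothesis fc : forall n, circle_int (fun x => f x * cosn n x) = 0.
Hypothesis fs : forall n, circle_int (fun x => f x * sinn n x) = 0.

(** Multipliers [p] for which [f p] stays orthogonal to all sines and cosines. The product formulas
    make this space stable under multiplication by [cosn 1] and [sinn 1], so it contains every
    polynomial in these two functions. *)
Definition trig_orth p := [/\ continuous p,
  (forall n, circle_int (fun x => f x * p x * cosn n x) = 0) &
  (forall n, circle_int (fun x => f x * p x * sinn n x) = 0)].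

Let int3 p q : continuous p -> continuous q -> cintegrable (fun x => f x * p x * q x).
Proof. by move=> cp cq; apply: cintegrableM => //; exact: cintegrableM. Qed.

Lemma trig_orth1 : trig_orth (fun=> 1).
Proof.
split; first exact: contC.
- by move=> n; rewrite -(fc n); apply: eq_cint => x; rewrite mulr1.
- by move=> n; rewrite -(fs n); apply: eq_cint => x; rewrite mulr1.
Qed.

Lemma trig_orthD (a b : R) p q : trig_orth p -> trig_orth q ->
  trig_orth (fun x => a * p x + b * q x).
Proof.
move=> [cp p1 p2] [cq q1 q2].
have H r : continuous r -> circle_int (fun x => f x * p x * r x) = 0 ->
   circle_int (fun x => f x * q x * r x) = 0 ->
   circle_int (fun x => f x * (a * p x + b * q x) * r x) = 0.
  move=> cr h1 h2.
  transitivity (circle_int (fun x => a * (f x * p x * r x) + b * (f x * q x * r x))).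
    by apply: eq_cint => x; ring.
  rewrite cint_integrableD ?cint_integrableZ ?h1 ?h2 ?mulr0 ?addr0//;
    try apply: cintegrableZ; exact: int3.
split => [|n|n]; [|exact/H/q1/p1/cosn_cont|exact/H/q2/p2/sinn_cont].
by apply: contD; apply: contM => //; exact: contC.
Qed.

Let half p r s : continuous p -> continuous r -> continuous s ->
  circle_int (fun x => f x * p x * r x) = 0 ->
  circle_int (fun x => f x * p x * s x) = 0 -> forall e : R,
  circle_int (fun x => f x * p x * (2^-1 * (r x + e * s x))) = 0.
Proof.
move=> cp cr cs h1 h2 e.
transitivity (circle_int (fun x =>
    2^-1 * (f x * p x * r x) + (2^-1 * e) * (f x * p x * s x))).
  by apply: eq_cint => x; ring.
rewrite cint_integrableD ?cint_integrableZ ?h1 ?h2 ?mulr0 ?addr0//;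
  try apply: cintegrableZ; exact: int3.
Qed.

Lemma trig_orth_cos p : trig_orth p -> trig_orth (fun x => p x * cosn 1 x).
Proof.
move=> [cp p1 p2]; split => [|n|n].
- by apply: contM => //; exact: cosn_cont.
- rewrite -(half cp (@cosn_cont _ (1 - n)) (@cosn_cont _ (1 + n)) (p1 _) (p1 _) 1).
  by apply: eq_cint => x; rewrite mul1r -cosnM; ring.
- rewrite -(half cp (@sinn_cont _ (n - 1)) (@sinn_cont _ (n + 1)) (p2 _) (p2 _) 1).
  by apply: eq_cint => x; rewrite mul1r -sincosnM; ring.
Qed.

Lemma trig_orth_sin p : trig_orth p -> trig_orth (fun x => p x * sinn 1 x).
Proof.
move=> [cp p1 p2]; split => [|n|n].
- by apply: contM => //; exact: sinn_cont.
- rewrite -(half cp (@sinn_cont _ (1 - n)) (@sinn_cont _ (1 + n)) (p2 _) (p2 _) 1).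
  by apply: eq_cint => x; rewrite mul1r -sincosnM; ring.
- rewrite -(half cp (@cosn_cont _ (1 - n)) (@cosn_cont _ (1 + n)) (p1 _) (p1 _) (-1)).
  by apply: eq_cint => x; rewrite mulN1r -sinnM; ring.
Qed.

Variables (a b : R).
Hypotheses (a0 : 0 < a) (ab : a < b) (b1 : b < 1).
Let mid := (a + b) / 2.
Let y0 : R := cos (pi * (b - a)).
(** An affine function of a cosine centred at the midpoint of [[a, b]]. As [y0] is the value of that
    cosine at [a] and [b], [y] crosses [1/2] there; the factor [1/4] keeps the values in
    [[0, 1]]. *)
Let y x : R := 2^-1 + (y0 - cos (2 * pi * (x - mid))) / 4.

Let yE x : y x = (2^-1 + y0 / 4) * 1 +
  (- (cos (2 * pi * mid) / 4) * cosn 1 x + - (sin (2 * pi * mid) / 4) * sinn 1 x).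
Proof.
by rewrite /y /cosn /sinn !mulr1z !mulr1 mulrBr cosB; field.
Qed.

Let orth_y p : trig_orth p -> trig_orth (fun x => p x * y x).
Proof.
move=> hp; have := trig_orthD (2^-1 + y0 / 4) 1 hp (trig_orthD
  (- (cos (2 * pi * mid) / 4)) (- (sin (2 * pi * mid) / 4))
  (trig_orth_cos hp) (trig_orth_sin hp)).
by congr trig_orth; apply/funext => x; rewrite yE; ring.
Qed.

Let orth_step k : trig_orth (fun x => step_poly k (y x)).
Proof.
have hk p : trig_orth p -> trig_orth (fun x => p x * y x ^+ k).
  move=> hp; elim: k => [|j IH].
    by move: hp; congr trig_orth; apply/funext => x; rewrite mulr1.
  by move: (orth_y IH); congr trig_orth; apply/funext => x; rewrite exprSr mulrA.
have h1 p : trig_orth p -> trig_orth (fun x => p x * (1 - y x ^+ k)).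
  move=> hp; move: (trig_orthD 1 (-1) hp (hk _ hp)).
  by congr trig_orth; apply/funext => x; ring.
rewrite /step_poly; elim: (2 ^ k)%N => [|j IH].
  by move: trig_orth1; congr trig_orth; apply/funext => x; rewrite expr0.
by move: (h1 _ IH); congr trig_orth; apply/funext => x; rewrite exprSr.
Qed.

Let y01 x : 0 <= y x <= 1.
Proof.
have := cos_geN1 (pi * (b - a)); have := cos_le1 (pi * (b - a)).
have := cos_geN1 (2 * pi * (x - mid)); have := cos_le1 (2 * pi * (x - mid)).
by rewrite /y -/y0; lra.
Qed.

Let y_lt x : 0 <= x <= 1 -> x != a -> x != b ->
  y x != 2^-1 /\ (y x < 2^-1) = (a <= x <= b).
Proof.
move=> x01 xa xb; have pi0 : 0 < pi :> R := pi_gt0 R.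
have [[ha0 hab] hb1] := (a0, ab, b1).
have ec : cos (2 * pi * (x - mid)) = cos (2 * pi * `|x - mid|).
  by have [h|h] := leP 0 (x - mid); [rewrite ger0_norm|rewrite ltr0_norm// mulrN cosN].
have [inab|outab] := boolP (a <= x <= b).
  have ax : a < x by rewrite lt_neqAle eq_sym xa; case/andP: inab.
  have xb' : x < b by rewrite lt_neqAle xb; case/andP: inab.
  have d : `|x - mid| < (b - a) / 2 by rewrite ltr_norml /mid; lra.
  have : y0 < cos (2 * pi * (x - mid)).
    have d0 : 0 <= pi * `|x - mid| by rewrite mulr_ge0// ltW.
    have dba : 0 < pi * (b - a) by rewrite mulr_gt0// subr_gt0.
    have d1b : 0 < pi * (1 - (b - a)) by rewrite mulr_gt0//; lra.
    have d1 : 0 < pi * ((b - a) / 2 - `|x - mid|) by rewrite mulr_gt0// subr_gt0.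
    by rewrite ec ltr_cos ?in_itv/=; [lra|apply/andP; split; lra|apply/andP; split; lra].
  by rewrite /y; split; [apply/negP => /eqP|]; lra.
have /andP[dl dr] : (b - a) / 2 < `|x - mid| < 1 - (b - a) / 2.
  move: outab; rewrite negb_and -!ltNge /mid => /orP[h|h].
    by rewrite ltr0_norm; lra.
  by rewrite gtr0_norm; lra.
have : cos (2 * pi * (x - mid)) < y0.
  have d0 : 0 <= pi * `|x - mid| by rewrite mulr_ge0// ltW.
  have dba : 0 < pi * (b - a) by rewrite mulr_gt0// subr_gt0.
  have d1b : 0 < pi * (1 - (b - a)) by rewrite mulr_gt0//; lra.
  have d1 : 0 < pi * (`|x - mid| - (b - a) / 2) by rewrite mulr_gt0// subr_gt0.
  have d2 : 0 < pi * (1 - (b - a) / 2 - `|x - mid|) by rewrite mulr_gt0// subr_gt0.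
  rewrite ec; have [h|h] := leP `|x - mid| 2^-1.
    have d3 : 0 <= pi * (2^-1 - `|x - mid|) by rewrite mulr_ge0 ?subr_ge0// ltW.
    by rewrite ltr_cos ?in_itv/=; [lra|apply/andP; split; lra|apply/andP; split; lra].
  have d3 : 0 < pi * (`|x - mid| - 2^-1) by rewrite mulr_gt0 ?subr_gt0.
  (* Past half a turn the cosine increases; reflecting the angle brings it back to [[0, pi]], where
     the cosine is decreasing. *)
  have -> : 2 * pi * `|x - mid| = - (2 * pi * (1 - `|x - mid|)) + pi *+ 2.
    by rewrite mulr2n; ring.
  rewrite cosD2pi cosN.
  by rewrite ltr_cos ?in_itv/=; [lra|apply/andP; split; lra|apply/andP; split; lra].
by rewrite /y; split; [apply/negP => /eqP|apply/negbTE; rewrite -leNgt]; lra.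
Qed.

(** Dominated convergence: [f] times [step_poly k (y x)] tends to [f] times the indicator of
    [[a, b]], and each approximating integral vanishes, by orthogonality at frequency 0. *)
Lemma orth_int0 : \int[mu]_(x in `[a, b]) f x = 0.
Proof.
have cstep k : continuous (fun x => step_poly k (y x)) by case: (orth_step k).
have mf : measurable_fun (`[0, 1]%classic : set R) f.
  by apply/measurable_EFinP; case/integrableP: fi.
have fk k : cintegrable (fun x => f x * step_poly k (y x)) by exact: cintegrableM.
have [[ha0 hab] hb1] := (a0, ab, b1).
have sub : (`[a, b] : set R) `<=` `[0, 1].
  by move=> x /=; rewrite !in_itv/= => /andP[h1 h2]; apply/andP; split; lra.
have [] := @dominated_convergence _ _ R mu (`[0, 1]%classic : set R) (measurable_itv _)
  (fun k x => (f x * step_poly k (y x))%:E) (fun x => ((f \_ `[a, b]) x)%:E)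
  (fun x => `|f x|%:E).
- by move=> k; case/integrableP: (fk k).
- apply/measurable_EFinP; apply/measurable_restrict => //.
  by apply: measurable_funS mf => //; move=> x [].
(* At [a] and [b] the value of [y] is [1/2], which [step_poly_cvg] excludes. *)
- exists ([set a] `|` [set b]); split => //.
  + exact: measurableU.
  + apply: measure_negligible; first exact: measurableU.
    by apply: negligibleU; apply/negligibleP => //; exact: lebesgue_measure_set1.
  move=> x /= /not_implyP[x01 ncv]; apply: contrapT => /not_orP[/eqP xa /eqP xb].
  apply: ncv; move: x01; rewrite in_itv/= => x01.
  have [yh ye] := y_lt x01 xa xb.
  apply: cvg_EFin; first exact: nearW.
  have -> : (f \_ `[a, b]) x = f x * (y x < 2^-1)%R%:R.
    rewrite patchE ye; case: ifPn => [|].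
      by rewrite inE/= in_itv/= => ->; rewrite mulr1.
    by rewrite notin_setE/= in_itv/= => /negP/negbTE ->; rewrite mulr0.
  by apply: cvgM; [exact: cvg_cst|exact: step_poly_cvg].
- exact: integrable_norm fi.
- apply/aeW => x k _; rewrite lee_fin normrM ler_piMr// ger0_norm;
    by have /andP[] := step_poly_itv k (y01 x).
move=> fab _ lim.
have : (\int[mu]_(x in `[0%R, 1%R]) ((f \_ `[a, b]) x)%:E = 0)%E.
  apply: cvg_unique lim _ => //.
  have -> : (fun k => \int[mu]_(x in `[0%R, 1%R]) (f x * step_poly k (y x))%:E)%E = cst 0%E.
    apply/funext => k /=.
    rewrite -[LHS]fineK; last exact: integrable_fin_num (fk k).
    have [_ /(_ 0) + _] := orth_step k.
    rewrite /circle_int /Rintegral => h; congr EFin; rewrite -[RHS]h.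
    congr fine; apply: eq_integral => x _ /=.
    by rewrite cosn0 mulr1.
  exact: cvg_cst.
by move=> h; rewrite -(setIidr sub) Rintegral_mkcondr /Rintegral h.
Qed.

End orthogonal.

(** The integral of [f] over every closed interval inside []0, 1[] vanishes, so its primitive is
    locally constant there; Lebesgue's differentiation theorem then gives [f = 0] almost
    everywhere. *)
Theorem trig_complete f : periodic1 f -> cintegrable f ->
  (forall n, circle_int (fun x => f x * cosn n x) = 0) ->
  (forall n, circle_int (fun x => f x * sinn n x) = 0) ->
  {ae mu, forall x, f x = 0}.
Proof.
move=> pf fi fc fs; apply: periodic_negligible => //.
(* Extension by zero, integrable on the whole line, so that a primitive starting at minus infinity
   exists. *)
pose g := f \_ `[0, 1].
have gi : mu.-integrable [set: R] (EFin \o g).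
  by rewrite /g -restrict_EFin; apply/(integrable_mkcond _ _).1.
have giy (x : R) : mu.-integrable `]-oo, x] (EFin \o g).
  by apply: integrableS gi.
have gloc : locally_integrable [set: R] g.
  by apply: open_integrable_locally => //; exact: openT.
have [N [mN N0 hN]] := FTC1Ny giy gloc.
exists N; split => // x [x01 fx]; apply: hN => /= -[_].
set F := (X in derive1 X x = _) => Fx.
have gx : g x = f x.
  rewrite /g patchE mem_set//= in_itv/=.
  by case/andP: x01 => h1 h2; apply/andP; split; exact: ltW.
have FE u v : 0 < u -> u < v -> v < 1 -> F v = F u.
  move=> u0 uv v1; apply/eqP; rewrite -subr_eq0; apply/eqP.
  rewrite /F Rintegral_itvB//; last by rewrite bnd_simp ltW.
  transitivity (\int[mu]_(z in `]u, v]) f z).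
    apply: eq_Rintegral => z; rewrite inE/= in_itv/= => /andP[h1 h2].
    rewrite /g patchE mem_set//= in_itv/=; apply/andP; split; lra.
  have fuv : mu.-integrable `[u, v] (EFin \o f).
    apply: integrableS fi => // z /=; rewrite !in_itv/= => /andP[h1 h2].
    by apply/andP; split; lra.
  rewrite Rintegral_itv_obnd_cbnd; first exact: orth_int0.
  by apply: integrableS fuv => //; exact: subset_itv_oc_cc.
have dF : is_derive x (1:R) F 0.
  have : is_derive x (1:R) (fun=> F x) 0 by exact: is_derive_cst.
  apply: near_eq_is_derive; case/andP: x01 => x0 x1.
  near=> z.
  have z0 : 0 < z by near: z; exact: lt_nbhsr.
  have z1 : z < 1 by near: z; exact: lt_nbhsl.
    by have [h|h|->//] := ltgtP x z; [rewrite -(FE x z)|rewrite -(FE z x)].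
move: Fx; rewrite derive1E (@derive_val _ _ _ _ _ _ _ dF) gx => /esym/eqP.
exact/negP.
Unshelve. all: by end_near. Qed.

End completeness.

(** * Sobolev norms *)

Section sobolev_bounds.
Context {R : realType}.
Implicit Types (f g h : R -> R) (s : R) (n m : int) (w : seq int).
Local Notation der f x a := (is_derive (x : R) (1 : R) (f : R -> R) (a : R)).
Local Notation fcos f n := (circle_int (fun x => f x * cosn n x)).
Local Notation fsin f n := (circle_int (fun x => f x * sinn n x)).

Definition sobolev_weight s n : R := (1 + n%:~R ^+ 2) `^ s.

(** A bound of the H^s norm by [C], tested on finite sets of frequencies: estimates stay among real
    numbers, and [Hs_norm_le] makes the passage to the extended norm. *)
Definition Hs_le s f (C : R) := forall w, uniq w ->
  \sum_(n <- w) sobolev_weight s n * fourier_sqr f n <= C ^+ 2.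

Lemma sobolev_weight_ge0 s n : 0 <= sobolev_weight s n.
Proof. exact: powR_ge0. Qed.

Lemma Hs_norm_ge0 s f : (0 <= Hs_norm s f)%E.
Proof. exact: poweR_ge0. Qed.

Lemma Hs_norm_le s f C : 0 <= C -> Hs_le s f C -> (Hs_norm s f <= C%:E)%E.
Proof.
move=> C0 h; rewrite /Hs_norm.
have sum_le : (\esum_(n in [set: int])
    (((1 + n%:~R ^+ 2) `^ s) * fourier_sqr f n)%:E <= (C ^+ 2)%:E)%E.
  apply: ge_ereal_sup => _ [A [finA _] <-].
  rewrite fsbig_finite//= sumEFin lee_fin; apply: h; exact: finmap.fset_uniq.
have sum_ge : (0 <= \esum_(n in [set: int])
    (((1 + n%:~R ^+ 2) `^ s) * fourier_sqr f n)%:E)%E.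
  apply: esum_ge0 => n _; rewrite lee_fin mulr_ge0 ?powR_ge0//.
  exact: fourier_sqr_ge0.
have -> : C%:E = poweR (C ^+ 2)%:E 2^-1.
  by rewrite poweR_EFin powR12_sqrt ?sqr_ge0// sqrtr_sqr ger0_norm.
by apply: gt0_ler_poweR => //; rewrite in_itv/= ?leey ?andbT// lee_fin sqr_ge0.
Qed.

Lemma Hs_le_finite s f C : 0 <= C -> Hs_le s f C -> (Hs_norm s f < +oo)%E.
Proof. by move=> C0 h; apply: (le_lt_trans (Hs_norm_le C0 h)); exact: ltry. Qed.

Lemma Hs_norm_cvg0 s (F : R -> R -> R) (G : set_system R) :
  Filter G ->
  (forall e, 0 < e -> \forall t \near G, Hs_le s (F t) e) ->
  (fun t => Hs_norm s (F t)) @ G --> 0%E.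
Proof.
move=> FG h; apply/fine_cvgP; split.
  have := h 1 ltr01; apply: filterS => t ht.
  rewrite ge0_fin_numE ?Hs_norm_ge0//.
  by apply: (le_lt_trans (Hs_norm_le ler01 ht)); exact: ltry.
apply/cvgrPdist_le => e e0; have := h e e0; apply: filterS => t /= ht.
have le := Hs_norm_le (ltW e0) ht; have ge := Hs_norm_ge0 s (F t).
rewrite sub0r normrN ger0_norm ?fine_ge0// -lee_fin fineK//.
rewrite ge0_fin_numE//; apply: (le_lt_trans le); exact: ltry.
Qed.

Lemma freq_ge n : n != 0 -> 1 + n%:~R ^+ 2 <= freq n ^+ 2 :> R.
Proof.
move=> n0; have n1 : 1 <= n%:~R ^+ 2 :> R.
  rewrite -rmorphXn/= -[1]/(1%:~R) ler_int.
  by have : (0 < n ^+ 2)%R by [rewrite exprn_even_gt0]; lia.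
have p4 : 4 <= (2 * pi) ^+ 2 :> R by have := pi_ge2 R; nra.
by rewrite /freq exprMn; nra.
Qed.

Lemma fourier_sqr0 f : fourier_sqr f 0 = circle_int f ^+ 2.
Proof. by rewrite fourier_sqrE fsin0 fcos0 expr0n/= addr0. Qed.

(** The zero frequency is counted apart because [freq 0 = 0]; elsewhere [freq_ge] compares the
    weight with a power of the frequency. *)
Lemma sobolev_weight_le s (k : nat) n : s <= k%:R ->
  sobolev_weight s n <= (n == 0)%:R + freq n ^+ (2 * k).
Proof.
move=> sk; have b1 : 1 <= 1 + n%:~R ^+ 2 :> R by rewrite lerDl sqr_ge0.
have [->|n0] := eqVneq n 0.
  rewrite /sobolev_weight (_ : 0%:~R = 0)// expr0n/= addr0 powR1 lerDl.
  by rewrite exprM exprn_ge0// sqr_ge0.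
rewrite add0r (le_trans (ler_powR b1 sk))// powR_mulrn; last by rewrite (le_trans ler01).
by rewrite exprM lerXn2r ?nnegrE ?sqr_ge0 ?freq_ge// (le_trans ler01).
Qed.

Lemma Hs_le_bound s (k : nat) f (M C : R) : s <= k%:R ->
  (forall w, uniq w -> \sum_(n <- w) freq n ^+ (2 * k) * fourier_sqr f n <= M ^+ 2) ->
  circle_int f ^+ 2 + M ^+ 2 <= C ^+ 2 -> Hs_le s f C.
Proof.
move=> sk h MC w uw; apply: (le_trans _ MC).
apply: (@le_trans _ _ (\sum_(n <- w) ((n == 0)%:R * circle_int f ^+ 2 +
    freq n ^+ (2 * k) * fourier_sqr f n))).
  apply: ler_sum => n _; have f0 := fourier_sqr_ge0 f n.
  apply: (le_trans (ler_wpM2r f0 (sobolev_weight_le n sk))).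
  rewrite mulrDl lerD2r; have [->|_] := eqVneq n 0; last by rewrite !mul0r.
  by rewrite fourier_sqr0.
by rewrite big_split/= lerD ?h// sum_delta// sqr_ge0.
Qed.

(* A lower semicontinuous form of the C^0 and H^1 bounds: uniform limits of
   C^1 functions [h] with [|h| <= M] and [||h'||_2 <= M]. *)
Definition H1b g (M : R) := forall e, 0 < e -> exists h h' : R -> R,
  [/\ [/\ periodic1 h, continuous h' & forall x, der h x (h' x)],
      forall x, `|g x - h x| <= e, forall x, `|h x| <= M &
      circle_int (fun x => h' x ^+ 2) <= M ^+ 2].

Lemma H1b_ge0 g M : H1b g M -> 0 <= M.
Proof. by move=> /(_ 1 ltr01)[h [h' [_ _ /(_ 0) + _]]]; exact: le_trans. Qed.

Lemma H1b_le g M N : M <= N -> H1b g M -> H1b g N.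
Proof.
move=> MN H; have M0 := H1b_ge0 H => e e0; have [h [h' [h1 h2 h3 h4]]] := H e e0.
exists h, h'; split => //; first by move=> x; exact: le_trans (h3 x) MN.
by rewrite (le_trans h4)// lerXn2r ?nnegrE// (le_trans M0).
Qed.

Lemma H1b_ext f g M : f =1 g -> H1b f M -> H1b g M.
Proof. by move=> /funext ->. Qed.

Lemma H1b_C1 g g' M : periodic1 g -> continuous g' -> (forall x, der g x (g' x)) ->
  (forall x, `|g x| <= M) -> (forall x, `|g' x| <= M) -> H1b g M.
Proof.
move=> pg cg dg gM g'M e e0; exists g, g'; split => //.
  by move=> x; rewrite subrr normr0 ltW.
rewrite -[leRHS]cintC; apply: le_cint; [exact: cont_sqr|exact: contC|].
move=> x _; rewrite -[leLHS]real_normK ?num_real// lerXn2r ?nnegrE//.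
exact: le_trans (normr_ge0 _) (g'M x).
Qed.

Lemma H1b_bounded g g' : periodic1 g -> continuous g' ->
  (forall x, der g x (g' x)) -> exists M, H1b g M.
Proof.
move=> pg cg' dg; have [a a0 ha] := periodic_bounded (ders_cont dg) pg.
have [b b0 hb] := periodic_bounded cg' (periodic_der pg dg).
exists (a + b); apply: (H1b_C1 pg cg' dg) => x; [have := ha x|have := hb x]; lra.
Qed.

Lemma le_cint_sqrD f g M N : continuous f -> continuous g ->
  circle_int (fun x => f x ^+ 2) <= M -> circle_int (fun x => g x ^+ 2) <= N ->
  circle_int (fun x => (f x + g x) ^+ 2) <= 2 * M + 2 * N.
Proof.
move=> cf cg fM gN; have cf2 := cont_sqr cf; have cg2 := cont_sqr cg.
apply: (@le_trans _ _ (circle_int (fun x => 2 * f x ^+ 2 + 2 * g x ^+ 2))).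
  apply: le_cint; first exact/cont_sqr/contD.
    by apply: contD; apply: contM => //; exact: contC.
  by move=> x _; have := sqr_ge0 (f x - g x); nra.
rewrite cintD ?cintZ//; try by apply: contM => //; exact: contC.
by lra.
Qed.

Lemma H1bD f g M N : H1b f M -> H1b g N -> H1b (fun x => f x + g x) (2 * (M + N)).
Proof.
move=> hf hg e e0; have M0 := H1b_ge0 hf; have N0 := H1b_ge0 hg.
have e2 : 0 < e / 2 by rewrite divr_gt0.
have [h [h' [[ph ch dh] h2 h3 h4]]] := hf _ e2.
have [k [k' [[pk ck dk] k2 k3 k4]]] := hg _ e2.
exists (fun x => h x + k x), (fun x => h' x + k' x); split.
- split; [by move=> x; rewrite ph pk|exact: contD|by move=> x; exact: derD].
- move=> x; have -> : f x + g x - (h x + k x) = (f x - h x) + (g x - k x) by ring.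
  by rewrite (le_trans (ler_normD _ _))// [leRHS]splitr lerD.
- move=> x; rewrite (le_trans (ler_normD _ _))//.
  by have := h3 x; have := k3 x; lra.
- by rewrite (le_trans (le_cint_sqrD ch ck h4 k4))//; nra.
Qed.

Lemma H1bM F F' g (a M : R) : periodic1 F -> continuous F' ->
  (forall x, der F x (F' x)) -> (forall x, `|F x| <= a) -> (forall x, `|F' x| <= a) ->
  H1b g M -> H1b (fun x => F x * g x) (2 * (a * M)).
Proof.
move=> pF cF' dF Fa F'a hg e e0; have cF := ders_cont dF.
have M0 := H1b_ge0 hg; have a0 : 0 <= a by exact: le_trans (Fa 0).
(* The shift by 1 covers the case [a = 0]. *)
have e2 : 0 < e / (a + 1) by rewrite divr_gt0// ltr_wpDl.
have [h [h' [[ph ch' dh] h2 h3 h4]]] := hg _ e2; have ch := ders_cont dh.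
exists (fun x => F x * h x), (fun x => F' x * h x + F x * h' x); split.
- split; [by move=> x; rewrite pF ph|by apply: contD; exact: contM|].
  by move=> x; apply: (der_eq (derM (dF x) (dh x))).
- move=> x; rewrite -mulrBr normrM (le_trans (ler_pM _ _ (Fa x) (h2 x)))//.
  by rewrite mulrCA ler_piMr ?(ltW e0)// ler_pdivrMr ?mul1r ?lerDl// ltr_wpDl.
- move=> x; rewrite normrM (le_trans (ler_pM _ _ (Fa x) (h3 x)))//.
  by rewrite ler_peMl ?ler1n// mulr_ge0.
- have b1 : circle_int (fun x => (F' x * h x) ^+ 2) <= (a * M) ^+ 2.
    rewrite -[leRHS]cintC; apply: le_cint; [exact/cont_sqr/contM|exact: contC|].
    move=> x _; rewrite -[leLHS]real_normK ?num_real// lerXn2r ?nnegrE ?mulr_ge0//.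
    by rewrite normrM ler_pM.
  have b2 : circle_int (fun x => (F x * h' x) ^+ 2) <= (a * M) ^+ 2.
    rewrite exprMn; apply: (@le_trans _ _ (a ^+ 2 * circle_int (fun x => h' x ^+ 2))).
      rewrite -cintZ; last exact: cont_sqr.
      apply: le_cint; [exact/cont_sqr/contM| |].
        by apply: contM; [exact: contC|exact: cont_sqr].
      move=> x _; rewrite exprMn ler_wpM2r ?sqr_ge0//.
      by rewrite -[leLHS]real_normK ?num_real// lerXn2r ?nnegrE.
    by rewrite ler_wpM2l ?sqr_ge0.
  have cl : continuous (fun x => F' x * h x) by exact: contM.
  have cr : continuous (fun x => F x * h' x) by exact: contM.
  apply: (le_trans (le_cint_sqrD cl cr b1 b2)).
  by rewrite le_eqVlt; apply/orP; left; apply/eqP; ring.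
Qed.

(** On a fixed finite set of frequencies the coefficients of the C^1 approximations converge to
    those of [g], while Bessel's inequality for their derivatives is uniform. *)
Lemma H1b_fourier g M w : continuous g -> H1b g M -> uniq w ->
  \sum_(n <- w) freq n ^+ 2 * fourier_sqr g n <= M ^+ 2.
Proof.
move=> cg H uw; have M0 := H1b_ge0 H.
pose C := \sum_(n <- w) freq n ^+ 2 : R.
have C0 : 0 <= C by apply: sumr_ge0 => n _; exact: sqr_ge0.
have key e : 0 < e <= 1 -> \sum_(n <- w) freq n ^+ 2 * fourier_sqr g n <=
    M ^+ 2 + e * (C * (4 * M + 2)).
  move=> /andP[e0 e1]; have [h [h' [[ph ch' dh] gh hM hM2]]] := H e e0.
  have ch := ders_cont dh.
  (* With [A] and [B] the two coefficients, [A^2 - B^2 = (A - B)^2 + 2 (A - B) B <= e^2 + 2 e M],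
     and [e <= 1]. *)
  have close (k : R -> R) : continuous k -> (forall x, `|k x| <= 1) ->
      circle_int (fun x => g x * k x) ^+ 2 <=
      circle_int (fun x => h x * k x) ^+ 2 + e * (2 * M + 1).
    move=> ck k1.
    have cgk : continuous (fun x => g x * k x) by exact: contM.
    have chk : continuous (fun x => h x * k x) by exact: contM.
    have : `|circle_int (fun x => g x * k x) - circle_int (fun x => h x * k x)| <= e.
      rewrite -cintB//; apply: cint_bound; first exact: contB.
      by move=> x _; rewrite -mulrBl normrM -[leRHS]mulr1 ler_pM.
    have : `|circle_int (fun x => h x * k x)| <= M.
      by apply: cint_bound => // x _; rewrite normrM -[leRHS]mulr1 ler_pM.
    set B := circle_int _; set A := circle_int _.
    move=> hB hA.
    have : (A - B) * B <= e * M.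
      by rewrite (le_trans (ler_norm _))// normrM ler_pM.
    have : (A - B) ^+ 2 <= e ^+ 2.
      by rewrite -[leLHS]real_normK ?num_real// lerXn2r ?nnegrE// ltW.
    have : A ^+ 2 - B ^+ 2 = (A - B) ^+ 2 + 2 * (A - B) * B by ring.
    by have : e ^+ 2 <= e by [nra]; lra.
  apply: (@le_trans _ _ (\sum_(n <- w)
     (freq n ^+ 2 * fourier_sqr h n + freq n ^+ 2 * (e * (4 * M + 2))))).
    apply: ler_sum => n _; rewrite -mulrDr ler_wpM2l ?sqr_ge0//.
    have := close _ (@cosn_cont _ n) (normr_cosn n).
    have := close _ (@sinn_cont _ n) (normr_sinn n).
    by rewrite !fourier_sqrE; lra.
  rewrite big_split/= -mulr_suml -/C lerD//; last by rewrite mulrCA.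
  under eq_bigr do rewrite -(fourier_sqr_der _ ph ch' dh).
  apply: le_trans hM2; apply: bessel => //.
  by apply: cont_L2 => //; exact: periodic_der dh.
apply/ler_addgt0Pr => e e0.
pose K := C * (4 * M + 2).
have K0 : 0 <= K by rewrite mulr_ge0//; lra.
pose d := Num.min 1 (e / (K + 1)).
have d0 : 0 < d by rewrite lt_min ltr01 divr_gt0// ltr_wpDl.
have d1 : d <= 1 by rewrite ge_min lexx.
apply: (le_trans (key d _)); first by rewrite d0.
rewrite lerD2l -/K; apply: (@le_trans _ _ (e / (K + 1) * K)).
  by rewrite ler_wpM2r// ge_min lexx orbT.
by rewrite mulrAC ler_pdivrMr ?ltr_wpDl// ler_wpM2l ?(ltW e0)// lerDl.
Qed.

Lemma Hs_le_H2 s f f1 M C : s <= 2 -> periodic1 f -> (forall x, der f x (f1 x)) ->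
  continuous f1 -> H1b f1 M -> circle_int f ^+ 2 + M ^+ 2 <= C ^+ 2 ->
  Hs_le s f C.
Proof.
move=> s2 pf df cf1 H; apply: Hs_le_bound s2 _ => w uw.
under eq_bigr => n _.
  rewrite (_ : _ * _ = freq n ^+ 2 * fourier_sqr f1 n); last first.
    by rewrite (fourier_sqr_der _ pf cf1 df) mulrA -exprD.
  over.
exact: H1b_fourier.
Qed.

Lemma Hs_le_H3 s f f1 f2 M C : s <= 3 -> periodic1 f -> (forall x, der f x (f1 x)) ->
  (forall x, der f1 x (f2 x)) ->
  continuous f2 -> H1b f2 M -> circle_int f ^+ 2 + M ^+ 2 <= C ^+ 2 ->
  Hs_le s f C.
Proof.
move=> s3 pf df df1 cf2 H; apply: Hs_le_bound s3 _ => w uw.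
have pf1 := periodic_der pf df; have cf1 := ders_cont df1.
under eq_bigr => n _.
  rewrite (_ : _ * _ = freq n ^+ 2 * fourier_sqr f2 n); last first.
    rewrite (fourier_sqr_der _ pf1 cf2 df1) (fourier_sqr_der _ pf cf1 df).
    by rewrite -[(2 * 3)%N]/6%N; ring.
  over.
exact: H1b_fourier.
Qed.

Lemma der_sum (I : Type) (v : seq I) (F : I -> R -> R) x (d : I -> R) :
  (forall i, der (F i) x (d i)) ->
  der (fun y => \sum_(i <- v) F i y) x (\sum_(i <- v) d i).
Proof.
move=> h; elim: v => [|i v IH].
  rewrite big_nil; apply: der_ext (derC 0 x) => y; by rewrite big_nil.
rewrite big_cons; apply: der_ext (derD (h i) IH) => y; by rewrite big_cons.
Qed.

(* Mean value theorem applied to the scalar product of the curve of Fourier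
   coefficients with the remainder at the fixed time [t]. *)
Lemma Hs_le_difference_quotient s (u ut : R -> R -> R) t0 t e :
  (forall t, continuous (u t)) -> (forall t, continuous (ut t)) ->
  (forall t n, der (fun t => fcos (u t) n) t (fcos (ut t) n)) ->
  (forall t n, der (fun t => fsin (u t) n) t (fsin (ut t) n)) -> t != t0 ->
  (forall r, `|r - t0| <= `|t - t0| -> Hs_le s (fun x => ut r x - ut t0 x) e) ->
  Hs_le s (fun x => (u t x - u t0 x) / (t - t0) - ut t0 x) e.
Proof.
move=> cu cut dcos dsin tt0 hut w uw.
have tn : t - t0 != 0 by rewrite subr_eq0.
have cosE n : fcos (fun x => (u t x - u t0 x) / (t - t0) - ut t0 x) n =
    (fcos (u t) n - fcos (u t0) n) / (t - t0) - fcos (ut t0) n.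
  have c r : continuous (fun x => u r x * cosn n x) by apply: contM => //; exact: cosn_cont.
  have c' r : continuous (fun x => ut r x * cosn n x) by apply: contM => //; exact: cosn_cont.
  rewrite [X in _ = X - _]mulrC -cintB// -cintZ; last exact: contB.
  rewrite -cintB//; last by apply: contM; [exact: contC|exact: contB].
  by apply: eq_cint => x; ring.
have sinE n : fsin (fun x => (u t x - u t0 x) / (t - t0) - ut t0 x) n =
    (fsin (u t) n - fsin (u t0) n) / (t - t0) - fsin (ut t0) n.
  have c r : continuous (fun x => u r x * sinn n x) by apply: contM => //; exact: sinn_cont.
  have c' r : continuous (fun x => ut r x * sinn n x) by apply: contM => //; exact: sinn_cont.
  rewrite [X in _ = X - _]mulrC -cintB// -cintZ; last exact: contB.
  rewrite -cintB//; last by apply: contM; [exact: contC|exact: contB].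
  by apply: eq_cint => x; ring.
pose dc n : R := (fcos (u t) n - fcos (u t0) n) / (t - t0) - fcos (ut t0) n.
pose ds n : R := (fsin (u t) n - fsin (u t0) n) / (t - t0) - fsin (ut t0) n.
pose lam n := sobolev_weight s n.
pose G r := \sum_(n <- w) lam n * (dc n * (fcos (u r) n - r * fcos (ut t0) n) +
   ds n * (fsin (u r) n - r * fsin (ut t0) n)).
pose G' r := \sum_(n <- w) lam n * (dc n * (fcos (ut r) n - fcos (ut t0) n) +
   ds n * (fsin (ut r) n - fsin (ut t0) n)).
have dX n r : der (fun r => fcos (u r) n - r * fcos (ut t0) n) r
    (fcos (ut r) n - fcos (ut t0) n).
  apply: (der_eq (derB (dcos r n) (derM (der_id r) (derC (fcos (ut t0) n) r)))).
  by rewrite mul1r mulr0 addr0.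
have dY n r : der (fun r => fsin (u r) n - r * fsin (ut t0) n) r
    (fsin (ut r) n - fsin (ut t0) n).
  apply: (der_eq (derB (dsin r n) (derM (der_id r) (derC (fsin (ut t0) n) r)))).
  by rewrite mul1r mulr0 addr0.
have dT n r := derZ (lam n) (derD (derZ (dc n) (dX n r)) (derZ (ds n) (dY n r))).
have dG r : der G r (G' r) by exact: (der_sum w (fun n => dT n r)).
have [r rt eG] := mvt t0 t dG.
have GE : G t - G t0 = (\sum_(n <- w) lam n * (dc n ^+ 2 + ds n ^+ 2)) * (t - t0).
  rewrite /G -sumrB mulr_suml; apply: eq_bigr => n _.
  by rewrite /dc /ds; field.
have e1 : \sum_(n <- w) lam n * (dc n ^+ 2 + ds n ^+ 2) = G' r.
  by apply: (mulIf tn); rewrite -GE.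
have e2 : \sum_(n <- w) lam n * fourier_sqr (fun x => ut r x - ut t0 x) n <= e ^+ 2.
  exact: hut.
under eq_bigr => n _ do rewrite fourier_sqrE cosE sinE -/(dc n) -/(ds n) -/(lam n).
(* By Young's inequality; as [G' r] equals the sum being estimated, half of it is absorbed on the
   left. *)
have e3 : G' r <= 2^-1 * (\sum_(n <- w) lam n * (dc n ^+ 2 + ds n ^+ 2)) +
    2^-1 * \sum_(n <- w) lam n * fourier_sqr (fun x => ut r x - ut t0 x) n.
  rewrite !mulr_sumr -big_split/=; apply: ler_sum => n _.
  have c1 q : continuous (fun x => ut q x * cosn n x) by apply: contM => //; exact: cosn_cont.
  have c2 q : continuous (fun x => ut q x * sinn n x) by apply: contM => //; exact: sinn_cont.
  have -> : fourier_sqr (fun x => ut r x - ut t0 x) n =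
      (fcos (ut r) n - fcos (ut t0) n) ^+ 2 + (fsin (ut r) n - fsin (ut t0) n) ^+ 2.
    rewrite fourier_sqrE -!cintB//.
    by congr (_ ^+ 2 + _ ^+ 2); apply: eq_cint => x; ring.
  set X := _ - _; set Y := _ - _.
  rewrite mulrCA [2^-1 * (lam n * _)]mulrCA -mulrDr ler_wpM2l ?sobolev_weight_ge0//.
  by have := sqr_ge0 (dc n - X); have := sqr_ge0 (ds n - Y); nra.
by move: e1 e2 e3; lra.
Qed.

(** * Continuity in time with values in H^1 *)

Definition H1cont (G : R -> R -> R) := forall t0 e, 0 < e ->
  \forall t \near t0, H1b (fun x => G t x - G t0 x) e.

Lemma H1contC1 (F F' : R -> R -> R) : (forall t, periodic1 (F t)) -> jc F -> jc F' ->
  (forall t x, der (F t) x (F' t x)) -> H1cont F.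
Proof.
move=> pF jF jF' dF t0 e e0.
have pF' t : periodic1 (F' t) := periodic_der (pF t) (dF t).
have h1 := jc_periodic_uniform t0 jF pF e0.
have h2 := jc_periodic_uniform t0 jF' pF' e0.
near=> t; apply: (@H1b_C1 _ (fun x => F' t x - F' t0 x)).
- by move=> x; rewrite !pF.
- by apply: contB; exact: jc_fun.
- by near: t.
- by near: t.
Unshelve. all: by end_near. Qed.

Lemma H1contD (F G : R -> R -> R) : H1cont F -> H1cont G ->
  H1cont (fun t x => F t x + G t x).
Proof.
move=> hF hG t0 e e0; have e4 : 0 < e / 4 by rewrite divr_gt0.
have := hF t0 _ e4; have := hG t0 _ e4; apply: filterS2 => t h1 h2.
have := H1bD h2 h1; rewrite (_ : 2 * _ = e); last by field.
by apply: H1b_ext => x; ring.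
Qed.

Lemma H1contZ (k : R) (F : R -> R -> R) : H1cont F -> H1cont (fun t x => k * F t x).
Proof.
move=> hF t0 e e0; pose a := `|k| + 1; have a0 : 0 < a by rewrite ltr_wpDl.
have e2 : 0 < e / 2 / a by rewrite !divr_gt0.
have := hF t0 _ e2; apply: filterS => t h.
have pk : periodic1 (fun _ : R => k) by [].
have ka (x : R) : `|k| <= a by rewrite lerDl.
have k0 (x : R) : `|0 : R| <= a by rewrite normr0 ltW.
have := H1bM pk (@contC _ _ 0) (derC k) ka k0 h.
rewrite (_ : 2 * _ = e); last by field; rewrite gt_eqF.
by apply: H1b_ext => x; ring.
Qed.

Lemma H1contM (F F' G : R -> R -> R) : (forall t, periodic1 (F t)) -> jc F -> jc F' ->
  (forall t x, der (F t) x (F' t x)) -> (forall t, exists M, H1b (G t) M) ->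
  H1cont G -> H1cont (fun t x => F t x * G t x).
Proof.
move=> pF jF jF' dF bG hG t0 e e0.
have pF' t : periodic1 (F' t) := periodic_der (pF t) (dF t).
have [M hM] := bG t0; have M0 := H1b_ge0 hM.
have cF' t : continuous (F' t) by exact: jc_fun.
have [a1 a10 ha1] := periodic_bounded (jc_fun (t := t0) jF) (pF t0).
have [a2 a20 ha2] := periodic_bounded (cF' t0) (pF' t0).
pose a := a1 + a2 + 1; pose d := Num.min 1 (e / (16 * (M + a))).
have a0 : 0 < a by rewrite /a ltr_wpDl// addr_ge0.
(* [F G - F0 G0] is [(F - F0) (G - G0) + (F - F0) G0 + F0 (G - G0)]. The constants of [H1bM] and
   [H1bD] give [8 d^2 + 8 d M + 4 a d], at most [16 (M + a) d] because [d <= 1 <= a]. *)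
have Ma : 0 < 16 * (M + a) by rewrite mulr_gt0// ltr_wpDl.
have d0 : 0 < d by rewrite lt_min ltr01 divr_gt0.
have d1 : d <= 1 by rewrite ge_min lexx.
have dM : 16 * (M + a) * d <= e.
  by rewrite mulrC -ler_pdivlMr// ge_min lexx orbT.
have h1 := jc_periodic_uniform t0 jF pF d0.
have h2 := jc_periodic_uniform t0 jF' pF' d0.
have h3 := hG t0 _ d0.
near=> t.
have k1 : forall x, `|F t x - F t0 x| <= d by near: t.
have k2 : forall x, `|F' t x - F' t0 x| <= d by near: t.
have k3 : H1b (fun x => G t x - G t0 x) d by near: t.
have pD : periodic1 (fun x => F t x - F t0 x) by move=> x; rewrite !pF.
have cD : continuous (fun x => F' t x - F' t0 x) by exact: contB.
have dD x : der (fun x => F t x - F t0 x) x (F' t x - F' t0 x)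
  by exact: derB (dF t x) (dF t0 x).
have b1 := H1bM pD cD dD k1 k2 k3.
have b2 := H1bM pD cD dD k1 k2 hM.
have Fa x : `|F t0 x| <= a by rewrite (le_trans (ha1 x))// /a; lra.
have F'a x : `|F' t0 x| <= a by rewrite (le_trans (ha2 x))// /a; lra.
have b3 := H1bM (pF t0) (cF' t0) (dF t0) Fa F'a k3.
have b := H1bD (H1bD b1 b2) b3.
apply: (H1b_ext _ (H1b_le _ b)) => [x|]; first by ring.
apply: le_trans dM.
have a1' : 1 <= a by rewrite /a; lra.
have dd : d * d <= a * d by rewrite ler_wpM2r ?(ltW d0)// (le_trans d1).
have Md : 0 <= M * d by rewrite mulr_ge0// ltW.
have ad : 0 <= a * d by rewrite mulr_ge0// ltW.
by lra.
Unshelve. all: by end_near. Qed.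

Lemma near_within (A : set R) (t0 : R) (Q : R -> Prop) :
  (\forall t \near t0, Q t) -> within A (nbhs t0) Q.
Proof. by move=> h; apply: (filterS _ h) => t ht _. Qed.

Lemma sqr_eq0_addl_le (x a : R) : x = 0 -> x ^+ 2 + a <= a.
Proof. by move=> ->; rewrite expr0n add0r. Qed.

Lemma sub_eq0 (x y a : R) : x = a -> y = a -> x - y = 0.
Proof. by move=> -> ->; rewrite subrr. Qed.

End sobolev_bounds.

(** * The initial momentum *)

Section limits.
Context {R : realType}.

Lemma cauchy_limit (u r : nat -> R) :
  (forall N M, (N <= M)%N -> `|u M - u N| <= r N) -> r @ \oo --> (0 : R) ->
  forall N, `|lim (u @ \oo) - u N| <= r N.
Proof.
move=> h r0.
have cu : cvgn u.
  apply/cauchy_cvgP/cauchyP => e e0; have e2 : 0 < e / 2 by rewrite divr_gt0.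
  have [N _ hN] := (cvgr0Pnorm_lt _).1 r0 _ e2.
  exists (u N); exists N => // M /= NM; rewrite /ball/= distrC.
  have h1 := h _ _ NM; have h2 := ler_norm (r N); have /= h3 := hN N (leqnn N).
  by lra.
move=> N.
have c2 : (fun M => `|u M - u N|) @ \oo --> `|lim (u @ \oo) - u N|.
  by apply: cvg_norm; apply: cvgB; [exact: cu|exact: cvg_cst].
rewrite -(cvg_lim (@Rhausdorff R) c2); apply: limr_le.
  by apply/cvg_ex; exists `|lim (u @ \oo) - u N|.
by exists N => // M /= NM; exact: h.
Qed.

(** The approximation is required only near the given point, so that limits uniform on bounded time
    intervals are covered as well. *)
Lemma cont_uniform {T : topologicalType} (f : T -> R) :
  (forall (x : T) (e : R), 0 < e -> exists2 g : T -> R, continuous g &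
     \forall y \near x, `|f y - g y| <= e) ->
  continuous f.
Proof.
move=> h x; apply/cvgrPdist_le => e e0; have e3 : 0 < e / 3 by rewrite divr_gt0.
have [g cg fg] := h x _ e3; have /cvgrPdist_le/(_ _ e3) := cg x.
have fgx := nbhs_singleton fg; apply: filterS2 fg => y fgy gxy.
have -> : f x - f y = (f x - g x) + (g x - g y) - (f y - g y) by ring.
rewrite (le_trans (ler_normB _ _))// (@le_trans _ _ (e / 3 + e / 3 + e / 3))//.
  by rewrite lerD// (le_trans (ler_normD _ _))// lerD.
by lra.
Qed.

End limits.

Section initial_data.
Context {R : realType}.
Implicit Types (n m : int).
Local Notation der f x a := (is_derive (x : R) (1 : R) (f : R -> R) (a : R)).
Local Notation fcos f n := (circle_int (fun x => f x * cosn n x)).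
Local Notation fsin f n := (circle_int (fun x => f x * sinn n x)).

Lemma derive1_der (f f' : R -> R) : (forall x, der f x (f' x)) -> derive1 f = f'.
Proof. by move=> h; apply/funext => x; rewrite derive1E (@derive_val _ _ _ _ _ _ _ (h x)). Qed.

Lemma weak_deriv1 (f f' : R -> R) : periodic1 f -> (forall x, der f x (f' x)) ->
  continuous f' -> weak_deriv 1 f f'.
Proof.
move=> pf df cf' phi [pphi dphi]; have cf := ders_cont df.
have dp x : der phi x (derive1 phi x) by split; [exact: (dphi 0%N x)|rewrite derive1E].
have cp' : continuous (derive1 phi).
  move=> x; apply: differentiable_continuous; apply/derivable1_diffP.
  exact: (dphi 1%N x).
have cp := ders_cont dp.
have c1 : continuous (fun x => f x * derive1 phi x) by exact: contM.
have c2 : continuous (fun x => f' x * phi x) by exact: contM.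
rewrite derive1n1 expr1 mulN1r; apply/eqP; rewrite -addr_eq0 -cintD//; apply/eqP.
apply: (cint_der (f := fun x => f x * phi x)).
- by move=> x; rewrite pf pphi.
- exact: contD.
- by move=> x; apply: (der_eq (derM (df x) (dp x))); rewrite addrC.
Qed.

Lemma test_fun_derive1 (phi : R -> R) : test_fun phi -> test_fun (derive1 phi).
Proof.
move=> [pphi dphi]; split; last by move=> n x; rewrite -derive1Sn.
have dp x : der phi x (derive1 phi x) by split; [exact: (dphi 0%N x)|rewrite derive1E].
exact: periodic_der dp.
Qed.

Lemma weak_deriv2 (f f' f'' : R -> R) : periodic1 f -> (forall x, der f x (f' x)) ->
  (forall x, der f' x (f'' x)) -> continuous f'' -> weak_deriv 2 f f''.
Proof.
move=> pf df df' cf'' phi tphi; have cf' := ders_cont df'.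
have := weak_deriv1 pf df cf' (test_fun_derive1 tphi).
have := weak_deriv1 (periodic_der pf df) df' cf'' tphi.
by rewrite !derive1n1 derive1nS derive1n1 => -> ->; ring.
Qed.

Definition trig1 n (a b : R) x := a * cosn n x + b * sinn n x.

Lemma der_trig1 n a b x : der (trig1 n a b) x (trig1 n (b * freq n) (- a * freq n) x).
Proof.
apply: (der_eq (derD (derZ a (der_cosn n x)) (derZ b (der_sinn n x)))).
by rewrite /trig1; ring.
Qed.

(** Combinations of one sine and one cosine are stable under differentiation. Testing the weak
    derivative on them gives the coefficients of [d] in terms of those of [u0]. *)
Lemma trig1_test n a b : test_fun (trig1 n a b).
Proof.
split; first by move=> x; rewrite /trig1 cosn_periodic sinn_periodic.
move=> k x; have [a' [b' ->]] : exists a' b', derive1n k (trig1 n a b) = trig1 n a' b'.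
  elim: k => [|k [a' [b' IH]]]; first by exists a, b.
  exists (b' * freq n), (- a' * freq n); rewrite derive1nS IH.
  exact: derive1_der (der_trig1 n a' b').
by have [] := der_trig1 n a' b' x.
Qed.

Lemma trig1_deriv3 n a b : derive1n 3 (trig1 n a b) =
  trig1 n (- b * freq n ^+ 3) (a * freq n ^+ 3).
Proof.
rewrite derive1nS derive1nS derive1n1 (derive1_der (der_trig1 n a b)).
rewrite (derive1_der (der_trig1 n _ _)) (derive1_der (der_trig1 n _ _)).
by congr (trig1 n); ring.
Qed.

Variables (u0 d : R -> R).
Hypothesis (u0L2 : L2_circle u0) (dL2 : L2_circle d).
Hypothesis (u0d : weak_deriv 3 u0 d).

Lemma fcos_d n : fcos d n = - freq n ^+ 3 * fsin u0 n.
Proof.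
have := u0d (trig1_test n 1 0); rewrite trig1_deriv3.
have -> : (fun x => u0 x * trig1 n (- 0 * freq n ^+ 3) (1 * freq n ^+ 3) x) =
  (fun x => freq n ^+ 3 * (u0 x * sinn n x)).
  by apply/funext => x; rewrite /trig1; ring.
have -> : (fun x => d x * trig1 n 1 0 x) = (fun x => d x * cosn n x).
  by apply/funext => x; rewrite /trig1; ring.
rewrite cint_integrableZ; first by have -> : (-1) ^+ 3 = -1 :> R by [ring]; lra.
exact: cintegrableM (L2_integrable u0L2) (@sinn_cont _ n).
Qed.

Lemma fsin_d n : fsin d n = freq n ^+ 3 * fcos u0 n.
Proof.
have := u0d (trig1_test n 0 1); rewrite trig1_deriv3.
have -> : (fun x => u0 x * trig1 n (- 1 * freq n ^+ 3) (0 * freq n ^+ 3) x) =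
  (fun x => - freq n ^+ 3 * (u0 x * cosn n x)).
  by apply/funext => x; rewrite /trig1; ring.
have -> : (fun x => d x * trig1 n 0 1 x) = (fun x => d x * sinn n x).
  by apply/funext => x; rewrite /trig1; ring.
rewrite cint_integrableZ; first by have -> : (-1) ^+ 3 = -1 :> R by [ring]; lra.
exact: cintegrableM (L2_integrable u0L2) (@cosn_cont _ n).
Qed.

(** The integers from [- N] to [N - 1]: [- N] is present but [N] is not, so both [n] and [- n] are
    sure to occur only for [|n| < N]. *)
Definition freqs N : seq int := map Posz (iota 0 N) ++ map Negz (iota 0 N).
Definition freqs_between N M : seq int :=
  map Posz (iota N (M - N)) ++ map Negz (iota N (M - N)).

Lemma freqs_between_uniq N M : uniq (freqs_between N M).
Proof.
rewrite cat_uniq !map_inj_uniq ?iota_uniq//=; try by move=> ? ? [].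
by rewrite andbT; apply/hasPn => _ /mapP[k _ ->]; apply/mapP => -[].
Qed.

Lemma freqsE N : freqs N = freqs_between 0 N.
Proof. by rewrite /freqs_between subn0. Qed.

Lemma freqs_uniq N : uniq (freqs N).
Proof. by rewrite freqsE; exact: freqs_between_uniq. Qed.

Lemma sum_freqs (F : int -> R) N M : (N <= M)%N ->
  \sum_(n <- freqs M) F n = \sum_(n <- freqs N) F n + \sum_(n <- freqs_between N M) F n.
Proof.
move=> NM; rewrite /freqs /freqs_between !big_cat/= !big_map.
rewrite -{1 2}(subnKC NM) !iotaD !big_cat/=; ring.
Qed.

Lemma mem_freqs n N : (`|n| < N)%N -> n \in freqs N.
Proof.
move=> h; rewrite mem_cat; case: n h => k /= h; apply/orP; [left|right];
  rewrite mem_map ?mem_iota//; try by move=> ? ? [].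
by rewrite /= add0n; lia.
Qed.

Lemma sum_pick (F : int -> R) k s : uniq s -> k \in s ->
  \sum_(m <- s) (k == m)%:R * F m = F k.
Proof.
elim: s => // m s IH /= /andP[ms us]; rewrite inE big_cons.
have [km _|km /= ks] := eqVneq k m; last by rewrite mul0r add0r IH.
rewrite mul1r big1_seq ?addr0 ?km// => j /andP[_ js].
by case: eqVneq => [mj|]; [rewrite -mj (negbTE ms) in js|rewrite mul0r].
Qed.

Let energy N := \sum_(n <- freqs N) fourier_sqr d n.

Let energy_le N : energy N <= circle_int (fun x => d x ^+ 2).
Proof. exact: bessel (freqs_uniq N). Qed.

Let energy_mono N M : (N <= M)%N -> energy N <= energy M.
Proof.
move=> NM; rewrite /energy (sum_freqs _ NM) lerDl.
by apply: sumr_ge0 => n _; exact: fourier_sqr_ge0.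
Qed.

(** The limit of the Bessel sums. The tail [total - energy N] measures, in the square of the L^2
    norm, the error of all the approximations below. *)
Let total := lim (energy @ \oo).

Let energy_cvg : energy @ \oo --> total.
Proof.
apply: nondecreasing_is_cvgn => //.
exists (circle_int (fun x => d x ^+ 2)) => _ [N _ <-]; exact: energy_le.
Qed.

Let energy_total N : energy N <= total.
Proof.
apply: limr_ge; first by apply/cvg_ex; exists total; exact: energy_cvg.
by exists N => // M /= NM; exact: energy_mono.
Qed.

Definition third_sum N := trig_sum d (freqs N).

Let third_sub N M : (N <= M)%N ->
  circle_int (fun x => (third_sum M x - third_sum N x) ^+ 2) <= total - energy N.
Proof.
move=> NM; apply: (@le_trans _ _ (energy M - energy N)); last by rewrite lerD2r.
rewrite /energy (sum_freqs _ NM) addrC addKr.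
rewrite -(eq_cint (f := fun x => trig_sum d (freqs_between N M) x ^+ 2)).
  by apply: cint_trig_sum_sqr; [exact: L2_integrable|exact: freqs_between_uniq].
by move=> x; rewrite /third_sum /trig_sum (sum_freqs _ NM) addrC addKr.
Qed.

Variable c : R.

(** Partial Fourier sums of [c - u0'']: two derivatives multiply the terms of frequency [n] by
    [- freq n ^+ 2]. The zero frequency contributes nothing, so the mean is [c]. *)
Definition momentum_sum N (x : R) := c + \sum_(n <- freqs N)
  freq n ^+ 2 * (fcos u0 n * cosn n x + fsin u0 n * sinn n x).

Lemma der_momentum_sum N x : der (momentum_sum N) x (- third_sum N x).
Proof.
have dn n : der (fun x => freq n ^+ 2 * (fcos u0 n * cosn n x + fsin u0 n * sinn n x)) x
    (- (fcos d n * cosn n x + fsin d n * sinn n x)).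
  apply: (der_eq (derZ _ (derD (derZ _ (der_cosn n x)) (derZ _ (der_sinn n x))))).
  by rewrite fcos_d fsin_d; ring.
apply: (der_eq (derD (derC c x) (der_sum (freqs N) dn))).
by rewrite add0r /third_sum /trig_sum sumrN.
Qed.

Lemma momentum_sum_periodic N : periodic1 (momentum_sum N).
Proof.
move=> x; congr (_ + _); apply: eq_bigr => n _.
by rewrite cosn_periodic sinn_periodic.
Qed.

Let term_cont n : continuous (fun x =>
  freq n ^+ 2 * (fcos u0 n * cosn n x + fsin u0 n * sinn n x)).
Proof.
apply: contM; first exact: contC.
by apply: contD; apply: contM; (try exact: contC); [exact: cosn_cont|exact: sinn_cont].
Qed.

Lemma momentum_sum_cont N : continuous (momentum_sum N).
Proof. by apply: contD; [exact: contC|apply: cont_sum]. Qed.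

Let third_cont N : continuous (third_sum N).
Proof. exact: trig_sum_cont. Qed.

(** The indices [n] and [- n] each contribute half of the coefficient, and [|n| < N] guarantees that
    both are in [freqs N]. *)
Lemma fcos_momentum_sum N n : n != 0 -> (`|n| < N)%N ->
  fcos (momentum_sum N) n = freq n ^+ 2 * fcos u0 n.
Proof.
move=> n0 nN.
have cc m k : continuous (fun x => cosn m x * cosn k x) by apply: contM; exact: cosn_cont.
have cs m k : continuous (fun x => sinn m x * cosn k x).
  by apply: contM; [exact: sinn_cont|exact: cosn_cont].
have ck (k : R) (f : R -> R) : continuous f -> continuous (fun x => k * f x).
  by move=> cf; apply: contM => //; exact: contC.
pose X m x := (freq m ^+ 2 * fcos u0 m) * (cosn m x * cosn n x) +
  (freq m ^+ 2 * fsin u0 m) * (sinn m x * cosn n x).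
have cX m : continuous (X m) by apply: contD; exact: ck.
transitivity (circle_int (fun x => c * cosn n x + \sum_(m <- freqs N) X m x)).
  apply: eq_cint => x; rewrite /momentum_sum mulrDl; congr (_ + _).
  by rewrite mulr_suml; apply: eq_bigr => m _; rewrite /X; ring.
rewrite cintD; [|exact: ck (@cosn_cont _ n)|exact: cont_sum].
rewrite cintZ ?cint_cosn ?(negbTE n0) ?mulr0 ?add0r; last exact: cosn_cont.
have [_ ->] := cint_sum (freqs N) (fun m => cont_cintegrable (cX m)).
have XE m : circle_int (X m) = (n == m)%:R * (2^-1 * (freq m ^+ 2 * fcos u0 m)) +
    (- n == m)%:R * (2^-1 * (freq m ^+ 2 * fcos u0 m)).
  rewrite /X cintD ?cintZ//; try exact: ck.
  rewrite cint_cosnM cint_sincosnM mulr0 addr0 -[n == - m]eqr_oppLR.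
  by ring.
under eq_bigr do rewrite XE.
rewrite big_split/= !sum_pick ?freqs_uniq ?mem_freqs ?abszN//.
rewrite fcosN (_ : freq (- n) = - freq n); first by field.
by rewrite /freq mulrNz mulrN.
Qed.

Lemma fsin_momentum_sum N n : n != 0 -> (`|n| < N)%N ->
  fsin (momentum_sum N) n = freq n ^+ 2 * fsin u0 n.
Proof.
move=> n0 nN.
have ss m k : continuous (fun x => sinn m x * sinn k x) by apply: contM; exact: sinn_cont.
have cs m k : continuous (fun x => sinn m x * cosn k x).
  by apply: contM; [exact: sinn_cont|exact: cosn_cont].
have ck (k : R) (f : R -> R) : continuous f -> continuous (fun x => k * f x).
  by move=> cf; apply: contM => //; exact: contC.
pose X m x := (freq m ^+ 2 * fcos u0 m) * (sinn n x * cosn m x) +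
  (freq m ^+ 2 * fsin u0 m) * (sinn m x * sinn n x).
have cX m : continuous (X m) by apply: contD; exact: ck.
transitivity (circle_int (fun x => c * sinn n x + \sum_(m <- freqs N) X m x)).
  apply: eq_cint => x; rewrite /momentum_sum mulrDl; congr (_ + _).
  by rewrite mulr_suml; apply: eq_bigr => m _; rewrite /X; ring.
rewrite cintD; [|exact: ck (@sinn_cont _ n)|exact: cont_sum].
rewrite cintZ ?cint_sinn ?mulr0 ?add0r; last exact: sinn_cont.
have [_ ->] := cint_sum (freqs N) (fun m => cont_cintegrable (cX m)).
have XE m : circle_int (X m) = (n == m)%:R * (2^-1 * (freq m ^+ 2 * fsin u0 m)) +
    (- n == m)%:R * (- 2^-1 * (freq m ^+ 2 * fsin u0 m)).
  rewrite /X cintD ?cintZ//; try exact: ck.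
  rewrite cint_sinnM cint_sincosnM mulr0 add0r -[n == - m]eqr_oppLR.
  by ring.
under eq_bigr do rewrite XE.
rewrite big_split/= !sum_pick ?freqs_uniq ?mem_freqs ?abszN//.
rewrite fsinN; last exact: L2_integrable.
rewrite (_ : freq (- n) = - freq n); first by field.
by rewrite /freq mulrNz mulrN.
Qed.

Lemma cint_momentum_sum N : circle_int (momentum_sum N) = c.
Proof.
rewrite /momentum_sum cintD; [|exact: contC|exact: cont_sum].
have [_ ->] := cint_sum (freqs N) (fun m => cont_cintegrable (@term_cont m)).
rewrite cintC big1 ?addr0// => n _.
rewrite cintZ; last first.
  by apply: contD; apply: contZ; [exact: cosn_cont|exact: sinn_cont].
rewrite cintD; [|exact/contZ/cosn_cont|exact/contZ/sinn_cont].
rewrite !cintZ ?cint_cosn ?cint_sinn ?mulr0 ?addr0; try exact: cosn_cont; try exact: sinn_cont.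
have [->|_] := eqVneq n 0; last by rewrite !mulr0.
by rewrite /freq (_ : 0%:~R = 0)// mulr0 expr0n/= mul0r.
Qed.

(** The sup bound that [sobolev_sup] draws from the tail of the Bessel sums; hence the division by
    12. *)
Let rate N := Num.sqrt ((total - energy N) / 12).

Let rate_cvg : rate @ \oo --> (0 : R).
Proof.
rewrite -[X in _ --> X](@sqrtr0 R).
have h : (fun N => (total - energy N) / 12) @ \oo --> (0 : R).
  have -> : (0 : R) = (total - total) * 12^-1 by rewrite subrr mul0r.
  by apply: cvgM; [apply: cvgB; [exact: cvg_cst|exact: energy_cvg]|exact: cvg_cst].
exact: (cvg_comp _ _ h (@sqrt_continuous R 0)).
Qed.

Let momentum_sub N M x : (N <= M)%N ->
  `|momentum_sum M x - momentum_sum N x| <= rate N.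
Proof.
move=> NM; rewrite -sqrtr_sqr ler_sqrt; last first.
  by rewrite divr_ge0// subr_ge0.
rewrite ler_pdivlMr// mulrC.
have := @sobolev_sup _ (fun x => momentum_sum M x - momentum_sum N x)
  (fun x => third_sum N x - third_sum M x) x.
move=> h; apply: (le_trans (h _ _ _ _)).
- by move=> y; rewrite !momentum_sum_periodic.
- exact: contB.
- move=> y; apply: (der_eq (derB (der_momentum_sum M y) (der_momentum_sum N y))).
  by ring.
- by rewrite cintB ?cint_momentum_sum ?subrr//; exact: momentum_sum_cont.
apply: le_trans (third_sub NM); rewrite le_eqVlt; apply/orP; left; apply/eqP.
by apply: eq_cint => y; ring.
Qed.

(** The continuous representative of [c - u0'']. The pointwise limit is uniform, with error at most
    [rate N]. *)
Definition momentum0 (x : R) := lim ((momentum_sum ^~ x) @ \oo).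

Let momentum0_close N x : `|momentum0 x - momentum_sum N x| <= rate N.
Proof.
apply: (@cauchy_limit _ (momentum_sum ^~ x)) => //.
by move=> N' M NM; exact: momentum_sub.
Qed.

Let rate_small e : 0 < e -> exists N0, forall N, (N0 <= N)%N -> rate N <= e.
Proof.
move=> e0; have [N _ hN] := (cvgr0Pnorm_lt _).1 rate_cvg _ e0.
exists N => M NM; apply: (le_trans (ler_norm _)); exact/ltW/hN.
Qed.

Lemma momentum0_cont : continuous momentum0.
Proof.
apply: cont_uniform => x e e0; have [N /(_ N (leqnn _)) hN] := rate_small e0.
exists (momentum_sum N); first exact: momentum_sum_cont.
by apply: filterE => y; rewrite (le_trans (momentum0_close N y)).
Qed.

Lemma momentum0_periodic : periodic1 momentum0.
Proof.
move=> x; rewrite /momentum0; congr (lim (_ @ \oo)).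
by apply/funext => N; exact: momentum_sum_periodic.
Qed.

Let limit_int (k : R -> R) (l : R) : continuous k -> (forall x, `|k x| <= 1) ->
  (exists N0, forall N, (N0 <= N)%N -> circle_int (fun x => momentum_sum N x * k x) = l) ->
  circle_int (fun x => momentum0 x * k x) = l.
Proof.
move=> ck k1 [N0 hN0]; apply/eqP; rewrite -subr_eq0 -normr_le0.
apply/ler_addgt0Pr => e e0; rewrite add0r; have [N1 hN1] := rate_small e0.
have cm N : continuous (fun x => momentum_sum N x * k x).
  by apply: contM => //; exact: momentum_sum_cont.
have c0 : continuous (fun x => momentum0 x * k x).
  by apply: contM => //; exact: momentum0_cont.
rewrite -(hN0 (maxn N0 N1)) ?leq_maxl// -cintB//.
apply: cint_bound; first exact: contB.
move=> x _; rewrite -mulrBl normrM -[leRHS]mulr1 ler_pM//.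
by rewrite (le_trans (momentum0_close _ x))// hN1// leq_maxr.
Qed.

Lemma cint_momentum0 : circle_int momentum0 = c.
Proof.
rewrite -(@limit_int (fun=> 1) c).
- by apply: eq_cint => x; rewrite mulr1.
- exact: contC.
- by move=> x; rewrite normr1.
- exists 0%N => N _; rewrite -[RHS](cint_momentum_sum N).
  by apply: eq_cint => x; rewrite mulr1.
Qed.

Lemma fcos_momentum0 n : n != 0 -> fcos momentum0 n = freq n ^+ 2 * fcos u0 n.
Proof.
move=> n0; apply: limit_int; [exact: cosn_cont|exact: normr_cosn|].
by exists `|n|%N.+1 => N nN; exact: fcos_momentum_sum.
Qed.

Lemma fsin_momentum0 n : n != 0 -> fsin momentum0 n = freq n ^+ 2 * fsin u0 n.
Proof.
move=> n0; apply: limit_int; [exact: sinn_cont|exact: normr_sinn|].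
by exists `|n|%N.+1 => N nN; exact: fsin_momentum_sum.
Qed.

Lemma momentum0_approx e : 0 < e -> exists h h' : R -> R,
  [/\ periodic1 h, continuous h', forall x, der h x (h' x) &
      H1b (fun x => momentum0 x - h x) e].
Proof.
move=> e0; have e4 : 0 < e / 4 by rewrite divr_gt0.
(* [rate N <= e / 4] bounds the tail by [12 e^2 / 16 <= e^2], so the same [N] serves the sup bound
   and the L^2 bound. *)
have [N /(_ N (leqnn _)) hN] := rate_small e4.
exists (momentum_sum N), (fun x => - third_sum N x); split.
- exact: momentum_sum_periodic.
- exact: contN.
- exact: der_momentum_sum.
move=> e' e'0; have [M1 hM1] := rate_small e'0; pose M := maxn N M1.
have NM : (N <= M)%N by exact: leq_maxl.
exists (fun x => momentum_sum M x - momentum_sum N x),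
  (fun x => third_sum N x - third_sum M x); split.
- split.
  + by move=> x; rewrite !momentum_sum_periodic.
  + exact: contB.
  + move=> x; apply: (der_eq (derB (der_momentum_sum M x) (der_momentum_sum N x))).
    by ring.
- move=> x; have -> : momentum0 x - momentum_sum N x -
    (momentum_sum M x - momentum_sum N x) = momentum0 x - momentum_sum M x by ring.
  by rewrite (le_trans (momentum0_close M x))// hM1// leq_maxr.
- move=> x; rewrite (le_trans (momentum_sub x NM))// (le_trans hN)//.
  by move: e0; lra.
- rewrite (eq_cint (g := fun x => (third_sum M x - third_sum N x) ^+ 2)); last first.
    by move=> x; ring.
  apply: (le_trans (third_sub NM)).
  have r0 : 0 <= total - energy N by rewrite subr_ge0.
  have : rate N ^+ 2 <= (e / 4) ^+ 2.
    by rewrite lerXn2r ?nnegrE ?sqrtr_ge0// ltW.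
  by rewrite /rate sqr_sqrtr ?divr_ge0//; nra.
Qed.

(** For each partial sum, [sobolev_sup] and Bessel's inequality give [12 (m - c)^2 <= 12 b^2]; the
    bound passes to the limit. The constant of the theorem is used here. *)
Lemma momentum0_bound (b : R) : circle_int (fun x => d x ^+ 2) <= 12 * b ^+ 2 ->
  forall x, `|momentum0 x - c| <= `|b|.
Proof.
move=> db x; apply/ler_addgt0Pr => e e0; have [N /(_ N (leqnn _)) hN] := rate_small e0.
rewrite -[momentum0 x - c](subrK (momentum_sum N x - c)) addrC.
rewrite (le_trans (ler_normD _ _))// lerD//; last first.
  rewrite (_ : _ - _ - _ = momentum0 x - momentum_sum N x); last by ring.
  exact: le_trans (momentum0_close N x) hN.
rewrite -ler_sqr ?nnegrE// !real_normK ?num_real//.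
have := @sobolev_sup _ (fun x => momentum_sum N x - c) (fun x => - third_sum N x) x.
move=> h; rewrite -(ler_pM2l (_ : 0 < 12))//; apply: (le_trans (h _ _ _ _)).
- by move=> y; rewrite momentum_sum_periodic.
- exact: contN.
- by move=> y; apply: (der_eq (derB (der_momentum_sum N y) (derC c y))); rewrite subr0.
- by rewrite cintB ?cint_momentum_sum ?cintC ?subrr//; [exact: momentum_sum_cont|exact: contC].
apply: le_trans db; apply: le_trans (energy_le N).
rewrite (eq_cint (g := fun x => third_sum N x ^+ 2)); last by move=> y; rewrite sqrrN.
by apply: cint_trig_sum_sqr; [exact: L2_integrable|exact: freqs_uniq].
Qed.

End initial_data.

(** * The equation for the logarithm of the Jacobian *)

Section picard.
Context {R : realType}.
Local Notation der f x a := (is_derive (x : R) (1 : R) (f : R -> R) (a : R)).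
Implicit Types (phi psi : R -> R) (F G : (R -> R) -> R -> R).

Definition admissible (rho : R) phi :=
  [/\ continuous phi, periodic1 phi & forall x, `|phi x| <= rho].

(** Bounded and Lipschitz on a ball, with any pointwise bound [d] in place of a sup norm. Estimates
    are restricted to [0 <= x <= 1] because primitives such as [prim (F phi)] may grow outside a
    period. *)
Definition bounded_lip (rho : R) F := (forall phi, admissible rho phi -> continuous (F phi)) /\
  exists B L : R, [/\ 0 <= B, 0 <= L,
    forall phi x, admissible rho phi -> 0 <= x <= 1 -> `|F phi x| <= B &
    forall phi psi d x, admissible rho phi -> admissible rho psi ->
      (forall y, `|phi y - psi y| <= d) -> 0 <= x <= 1 ->
      `|F phi x - F psi x| <= L * d].

Lemma bounded_lip_cst rho (g : R -> R) : continuous g -> periodic1 g -> bounded_lip rho (fun=> g).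
Proof.
move=> cg pg; split => //; have [M M0 hM] := periodic_bounded cg pg.
exists M, 0; split => // phi psi d x _ _ _ _.
by rewrite subrr normr0 mul0r.
Qed.

Lemma bounded_lip_expR rho (e : R) : bounded_lip rho (fun phi x => expR (e * phi x)).
Proof.
split.
  by move=> phi [cphi _ _]; exact: (cont_comp (contZ (k := e) cphi) (@continuous_expR R)).
have eb phi x : admissible rho phi -> `|e * phi x| <= `|e| * rho.
  by move=> [_ _ h]; rewrite normrM ler_wpM2l.
exists (expR (`|e| * rho)), (expR (`|e| * rho) * `|e|); split.
- exact: expR_ge0.
- by rewrite mulr_ge0// expR_ge0.
- move=> phi x hphi _; rewrite ger0_norm ?expR_ge0// ler_expR.
  exact: le_trans (ler_norm _) (eb _ _ hphi).
move=> phi psi d x hphi hpsi hd _.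
have expR_lip (a b C : R) : `|a| <= C -> `|b| <= C ->
    `|expR a - expR b| <= expR C * `|a - b|.
  move=> ha hb; wlog ab : a b ha hb / b <= a.
    move=> H; have [/H|/ltW/H] := leP b a; first exact.
    by rewrite distrC [`|a - b|]distrC; exact.
  have [] := MVT_segment ab (fun x _ => is_derive_expR x).
    by apply: continuous_subspaceT; exact: continuous_expR.
  move=> c; rewrite in_itv/= => /andP[_ ca] ->.
  rewrite normrM ler_wpM2r// ger0_norm ?expR_ge0// ler_expR.
  exact: le_trans ca (le_trans (ler_norm _) ha).
rewrite (le_trans (expR_lip _ _ _ (eb _ x hphi) (eb _ x hpsi)))//.
by rewrite -mulrA ler_wpM2l ?expR_ge0// -mulrBr normrM ler_wpM2l.
Qed.

Lemma bounded_lipB rho F G : bounded_lip rho F -> bounded_lip rho G -> bounded_lip rho (fun phi x => F phi x - G phi x).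
Proof.
move=> [cF [B [L [B0 L0 FB FL]]]] [cG [B' [L' [B0' L0' GB GL]]]]; split.
  by move=> phi h; apply: contB; [exact: cF|exact: cG].
exists (B + B'), (L + L'); split; [exact: addr_ge0|exact: addr_ge0| |].
  by move=> phi x h x01; rewrite (le_trans (ler_normB _ _))// lerD ?FB ?GB.
move=> phi psi d x h1 h2 hd x01.
have -> : F phi x - G phi x - (F psi x - G psi x) =
  (F phi x - F psi x) - (G phi x - G psi x) by ring.
by rewrite (le_trans (ler_normB _ _))// mulrDl lerD ?FL ?GL.
Qed.

Lemma bounded_lipM rho F G : bounded_lip rho F -> bounded_lip rho G -> bounded_lip rho (fun phi x => F phi x * G phi x).
Proof.
move=> [cF [B [L [B0 L0 FB FL]]]] [cG [B' [L' [B0' L0' GB GL]]]]; split.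
  by move=> phi h; apply: contM; [exact: cF|exact: cG].
exists (B * B'), (L * B' + B * L'); split.
- exact: mulr_ge0.
- by apply: addr_ge0; exact: mulr_ge0.
- by move=> phi x h x01; rewrite normrM ler_pM ?FB ?GB.
move=> phi psi d x h1 h2 hd x01.
have -> : F phi x * G phi x - F psi x * G psi x =
  (F phi x - F psi x) * G phi x + F psi x * (G phi x - G psi x) by ring.
rewrite (le_trans (ler_normD _ _))// [leRHS]mulrDl lerD// normrM.
  by rewrite mulrAC ler_pM ?FL ?GB.
by rewrite -mulrA ler_pM ?FB ?GL.
Qed.

Lemma bounded_lip_prim rho F : bounded_lip rho F -> bounded_lip rho (fun phi => prim (F phi)).
Proof.
move=> [cF [B [L [B0 L0 FB FL]]]]; split.
  by move=> phi h; apply: prim_cont; exact: cF.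
have sub (g : R -> R) x C : continuous g -> 0 <= C -> 0 <= x <= 1 ->
    (forall y, 0 <= y <= 1 -> `|g y| <= C) -> `|prim g x| <= C.
  move=> cg C0 /andP[x0 x1] h; have hx y : 0 <= y <= x -> `|g y| <= C.
    by move=> /andP[y0 yx]; apply: h; rewrite y0 (le_trans yx).
  rewrite ler_norml; apply/andP; split.
    rewrite lerNl -primN//; apply: (@le_trans _ _ (prim (fun=> C) x)).
      apply: le_prim => //; [exact: contN|exact: contC|].
      by move=> y /hx; rewrite ler_norml lerNl => /andP[].
    by rewrite primC ler_piMr.
  apply: (@le_trans _ _ (prim (fun=> C) x)).
    apply: le_prim => //; first exact: contC.
    by move=> y /hx; rewrite ler_norml => /andP[].
  by rewrite primC ler_piMr.
exists B, L; split => //.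
  by move=> phi x h x01; apply: sub => //; [exact: cF|move=> y; exact: FB].
move=> phi psi d x h1 h2 hd x01.
have d0 : 0 <= d by exact: le_trans (hd 0).
rewrite -primB; [|exact: cF|exact: cF].
apply: sub => //; [by apply: contB; exact: cF|exact: mulr_ge0|].
by move=> y y01; exact: FL.
Qed.

Lemma bounded_lip_cint rho F : bounded_lip rho F -> bounded_lip rho (fun phi _ => circle_int (F phi)).
Proof.
move=> /bounded_lip_prim [_ [B [L [B0 L0 FB FL]]]]; split.
  by move=> phi _; exact: contC.
have h01 : 0 <= (1 : R) <= 1 by rewrite ler01 lexx.
exists B, L; split => //.
  by move=> phi x h _; rewrite circle_int_prim; exact: FB.
by move=> phi psi d x h1 h2 hd _; rewrite !circle_int_prim; exact: FL.
Qed.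

Lemma bounded_lipV rho F (b : R) : 0 < b -> bounded_lip rho F ->
  (forall phi x, admissible rho phi -> b <= F phi x) ->
  bounded_lip rho (fun phi x => (F phi x)^-1).
Proof.
move=> b0 [cF [B [L [B0 L0 FB FL]]]] Fb.
have Fp phi x : admissible rho phi -> 0 < F phi x.
  by move=> h; exact: lt_le_trans (Fb _ _ h).
split.
  by move=> phi h; apply: contV; [move=> x; rewrite gt_eqF// Fp|exact: cF].
have inv_le phi x : admissible rho phi -> (F phi x)^-1 <= b^-1.
  by move=> h; rewrite lef_pV2 ?posrE ?Fp// Fb.
exists b^-1, (b^-1 * b^-1 * L); split.
- by rewrite invr_ge0 ltW.
- by rewrite !mulr_ge0// invr_ge0 ltW.
- by move=> phi x h _; rewrite ger0_norm ?inv_le// invr_ge0 ltW// Fp.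
move=> phi psi d x h1 h2 hd x01.
have n1 : F phi x != 0 by rewrite gt_eqF// Fp.
have n2 : F psi x != 0 by rewrite gt_eqF// Fp.
have -> : (F phi x)^-1 - (F psi x)^-1 =
  (F phi x)^-1 * (F psi x)^-1 * (F psi x - F phi x) by field; apply/andP.
have p1 : 0 <= (F phi x)^-1 by rewrite invr_ge0 ltW// Fp.
have p2 : 0 <= (F psi x)^-1 by rewrite invr_ge0 ltW// Fp.
have k1 : `|(F phi x)^-1 * (F psi x)^-1| <= b^-1 * b^-1.
  by rewrite normrM !ger0_norm//; apply: ler_pM => //; apply: inv_le.
have k2 : `|F psi x - F phi x| <= L * d by rewrite distrC FL.
by rewrite normrM -[leRHS]mulrA ler_pM.
Qed.

(** * The truncated vector field *)

Definition clip (K y : R) := Num.max (- K) (Num.min K y).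

Lemma clip_bound K y : 0 <= K -> `|clip K y| <= K.
Proof.
by move=> K0; rewrite ler_norml /clip le_max lexx/= ge_max ge_min lexx/= andbT; lra.
Qed.

Lemma clip_id K y : `|y| <= K -> clip K y = y.
Proof.
rewrite ler_norml => /andP[h1 h2]; rewrite /clip.
by rewrite (min_idPr h2) (max_idPr h1).
Qed.

Lemma clip_lip K x y : `|clip K x - clip K y| <= `|x - y|.
Proof.
wlog xy : x y / x <= y.
  move=> H; have [/H//|/ltW/H] := leP x y.
  by rewrite distrC [`|y - x|]distrC.
rewrite distrC [leRHS]distrC [leRHS]ger0_norm ?subr_ge0//.
rewrite /clip; have [h1|h1] := leP K y; have [h2|h2] := leP K x;
 rewrite ?(min_idPl h1) ?(min_idPl h2) ?(min_idPr (ltW h1)) ?(min_idPr (ltW h2));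
 repeat (match goal with |- context[Num.max ?a ?b] =>
   let h := fresh in have [h|h] := leP a b end);
 rewrite ger0_norm; lra.
Qed.

Lemma clip_cont K : continuous (clip K).
Proof.
move=> x; apply/cvgrPdist_le => e e0.
have /cvgrPdist_le/(_ _ e0) : y @[y --> x] --> x by exact: cvg_id.
by apply: filterS => y; apply: le_trans; exact: clip_lip.
Qed.

Variables (m0 : R -> R) (K : R).
Hypotheses (m0c : continuous m0) (m0p : periodic1 m0) (K0 : 0 <= K).

Definition fieldN phi := circle_int (fun y => m0 y * expR (- phi y)).
Definition fieldW phi := circle_int (fun y => expR (phi y)).
(** The weights make the mean vanish for every [phi], so [field phi] is periodic. When the first
    weight is [c] and the second is 1, this is the slope [c e^phi - m_0 e^(- phi)] of the original
    equation. *)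
Definition field_slope phi y :=
  fieldN phi * expR (phi y) - fieldW phi * (m0 y * expR (- phi y)).
Definition field_prim phi := prim (field_slope phi).
Definition field phi x :=
  field_prim phi x - circle_int (fun y => field_prim phi y * expR (phi y)) * (fieldW phi)^-1.
Definition field_clip phi x := clip K (field phi x).

Lemma expR_cont {T : topologicalType} (f : T -> R) : continuous f ->
  continuous (fun x => expR (f x)).
Proof. by move=> cf; exact: cont_comp cf (@continuous_expR R). Qed.

Lemma fieldW_ge rho phi : admissible rho phi -> expR (- rho) <= fieldW phi.
Proof.
move=> [cp _ hp]; rewrite -[leLHS]cintC; apply: le_cint.
- exact: contC.
- exact: expR_cont.
- by move=> x _; rewrite ler_expR; have := hp x; rewrite ler_norml => /andP[].
Qed.

Lemma fieldW_gt0 phi : continuous phi -> periodic1 phi -> 0 < fieldW phi.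
Proof.
move=> cp pp; have [M _ hM] := periodic_bounded cp pp.
by apply: (lt_le_trans (expR_gt0 (- M))); apply: fieldW_ge.
Qed.

Lemma bounded_lip_field rho : bounded_lip rho field.
Proof.
have e1 : bounded_lip rho (fun phi x => expR (phi x)).
  by have := bounded_lip_expR rho 1; congr bounded_lip; apply/funext => p; apply/funext => x; rewrite mul1r.
have e2 : bounded_lip rho (fun phi x => expR (- phi x)).
  by have := bounded_lip_expR rho (-1); congr bounded_lip; apply/funext => p; apply/funext => x; rewrite mulN1r.
have e3 : bounded_lip rho (fun phi x => m0 x * expR (- phi x)).
  by apply: bounded_lipM => //; exact: bounded_lip_cst.
have bW : bounded_lip rho (fun phi _ => fieldW phi) by exact: bounded_lip_cint.
have bA : bounded_lip rho field_prim.
  apply: bounded_lip_prim; apply: bounded_lipB; apply: bounded_lipM => //.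
  exact: bounded_lip_cint.
apply: bounded_lipB => //; apply: bounded_lipM.
  by apply: (bounded_lip_cint (F := fun phi y => field_prim phi y * expR (phi y))); exact: bounded_lipM.
apply: bounded_lipV bW _; first exact: (expR_gt0 (- rho)).
by move=> phi _ h; exact: fieldW_ge.
Qed.

Lemma field_slope_cont phi : continuous phi -> continuous (field_slope phi).
Proof.
move=> cp; apply: contB; apply: contZ; first exact: expR_cont.
by apply: contM => //; apply: expR_cont; exact: contN.
Qed.

Lemma field_slope_mean phi : continuous phi -> circle_int (field_slope phi) = 0.
Proof.
move=> cp; have c1 : continuous (fun y => m0 y * expR (- phi y)).
  by apply: contM => //; apply: expR_cont; exact: contN.
have c2 : continuous (fun y => expR (phi y)) by exact: expR_cont.
rewrite /field_slope cintB ?cintZ//; try exact: contZ.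
by rewrite /fieldN /fieldW mulrC subrr.
Qed.

Lemma der_field phi x : continuous phi -> der (field phi) x (field_slope phi x).
Proof.
move=> cp; have := derB (der_prim x (field_slope_cont cp))
  (derC (circle_int (fun y => field_prim phi y * expR (phi y)) * (fieldW phi)^-1) x).
by rewrite subr0.
Qed.

Lemma field_periodic phi : continuous phi -> periodic1 phi -> periodic1 (field phi).
Proof.
move=> cp pp x; rewrite /field /field_prim prim_periodic.
- by rewrite field_slope_mean// addr0.
- exact: field_slope_cont.
- by move=> y; rewrite /field_slope pp m0p.
Qed.

Lemma field_mean phi : continuous phi -> periodic1 phi ->
  circle_int (fun y => field phi y * expR (phi y)) = 0.
Proof.
move=> cp pp; have W0 := fieldW_gt0 cp pp.
have cA : continuous (field_prim phi) by apply: prim_cont; exact: field_slope_cont.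
have ce : continuous (fun y => expR (phi y)) by exact: expR_cont.
set I := circle_int (fun y => field_prim phi y * expR (phi y)).
transitivity (circle_int (fun y => field_prim phi y * expR (phi y) -
    (I * (fieldW phi)^-1) * expR (phi y))).
  by apply: eq_cint => y; rewrite /field -/I; ring.
rewrite cintB ?cintZ//; [|exact: contM|exact: contZ].
by rewrite -/I -/(fieldW phi) mulfVK ?subrr// gt_eqF.
Qed.

Lemma jc_field (P : R -> R -> R) : jc P -> (forall t, periodic1 (P t)) ->
  jc (fun t => field (P t)).
Proof.
move=> jP pP.
have je : jc (fun t x => expR (P t x)) by exact: expR_cont.
have jm : jc (fun t x => m0 x * expR (- P t x)).
  apply: contM; first exact: cont_comp cont_snd m0c.
  by apply: expR_cont; exact: contN.
have jA : jc (fun t => field_prim (P t)).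
  apply: jc_prim; apply: contB; apply: contM => //.
    exact: (jc_cint (G := fun t x => m0 x * expR (- P t x))).
  exact: (jc_cint (G := fun t x => expR (P t x))).
apply: contB => //; apply: contM.
  by apply: (jc_cint (G := fun t y => field_prim (P t) y * expR (P t y))); exact: contM.
apply: contV; last exact: (jc_cint (G := fun t x => expR (P t x))).
by move=> [t x] /=; rewrite gt_eqF// fieldW_gt0//; exact: jc_fun.
Qed.

Lemma jc_field_clip (P : R -> R -> R) : jc P -> (forall t, periodic1 (P t)) ->
  jc (fun t => field_clip (P t)).
Proof. by move=> jP pP; exact: cont_comp (jc_field jP pP) (@clip_cont K). Qed.

(** * Picard iteration, for all times at once *)

Fixpoint picard (k : nat) : R -> R -> R := match k with
  | 0 => fun _ _ => 0
  | j.+1 => fun t x => prim (fun s => field_clip (picard j s) x) t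
  end.

(** Thanks to the truncation, all iterates stay in one ball of radius [K T] for [|t| <= T], so a
    single Lipschitz constant serves on each bounded time interval. *)
Lemma picard_props k : [/\ jc (picard k), (forall t, periodic1 (picard k t)) &
  forall t x, `|picard k t x| <= K * `|t|].
Proof.
elim: k => [|k [IH1 IH2 IH3]].
  by split => [|//|t x]; [exact: contC|rewrite normr0 mulr_ge0].
have j := jc_field_clip IH1 IH2; split.
- exact: (jc_primT j).
- move=> t x; congr (prim _ t); apply/funext => s; rewrite /field_clip field_periodic//.
  exact: jc_fun.
- move=> t x; apply: prim_bound; first exact: (jc_cst (x := x) j).
  by move=> s _; exact: clip_bound.
Qed.

Lemma picard_admissible k t T : `|t| <= T -> admissible (K * T) (picard k t).
Proof.
move=> tT; have [h1 h2 h3] := picard_props k; split => //; first exact: jc_fun.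
by move=> x; rewrite (le_trans (h3 t x))// ler_wpM2l.
Qed.

Lemma field_clip_lip rho : exists2 L, 0 < L & forall phi psi d x,
  admissible rho phi -> admissible rho psi ->
  (forall y, `|phi y - psi y| <= d) -> `|field_clip phi x - field_clip psi x| <= L * d.
Proof.
have [_ [B [L [_ L0 _ FL]]]] := bounded_lip_field rho.
(* A positive constant is wanted: it will be a divisor through the exponential weight. *)
exists (L + 1) => [|phi psi d x h1 h2 hd]; first by rewrite ltr_wpDl.
have [c1 p1 _] := h1; have [c2 p2 _] := h2.
have d0 : 0 <= d by exact: le_trans (hd 0).
rewrite (le_trans (clip_lip _ _ _))//.
have key := @periodic_ind _ (fun x => field phi x - field psi x)
  (fun z => `|z| <= (L + 1) * d).
apply: key => [y|y y01]; first by rewrite !field_periodic.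
by rewrite (le_trans (FL _ _ _ _ h1 h2 hd y01))// ler_wpM2r// lerDl.
Qed.

(** Integration against the weight [e^(a |t|)] gains the factor [1 / a]: [H / a * e^(a s)] has
    derivative [H * e^(a s)], so adding or subtracting the primitive of [g] leaves it nondecreasing
    for positive times. *)
Lemma prim_exp_bound (g : R -> R) (t H a : R) : continuous g -> 0 < a -> 0 <= H ->
  (forall s, `|s| <= `|t| -> `|g s| <= H * expR (a * `|s|)) ->
  `|prim g t| <= H / a * expR (a * `|t|).
Proof.
move=> cg a0 H0; wlog t0 : g t cg / 0 <= t.
  move=> W hg; have [t0|/ltW t0] := leP 0 t; first exact: W.
  have cgN : continuous (fun s => g (- s)).
    by apply: cont_comp cg; apply: contN; exact: cont_id.
  have dg s : der (fun s => - prim g (- s)) s (g (- s)).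
    apply: (der_eq (derN (der_comp (derN (der_id s)) (der_prim (- s) cg)))).
    by rewrite mulrN1 opprK.
  have := prim_der (- t) cgN dg; rewrite opprK oppr0 prim0 oppr0 subr0 => e.
  rewrite -normrN -e -[`|t|]normrN; apply: W => //; first by rewrite oppr_ge0.
  by move=> s st; rewrite -[`|s|]normrN; apply: hg; move: st; rewrite !normrN.
move=> hg; rewrite (ger0_norm t0).
have Ha : 0 <= H / a by rewrite divr_ge0// ltW.
have dE s : der (fun s => H / a * expR (a * s)) s (H * expR (a * s)).
  apply: (der_eq (derZ (H / a) (der_exp (derZ a (der_id s))))).
  by field; rewrite gt_eqF.
have bnd s : 0 <= s <= t -> `|g s| <= H * expR (a * s).
  by move=> /andP[s0 st]; rewrite -{2}(ger0_norm s0); apply: hg; rewrite !ger0_norm.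
have h0 : 0 <= H / a * expR (a * 0) by rewrite mulr_ge0// expR_ge0.
rewrite ler_norml; apply/andP; split.
  have := der_mono (fun s => derD (dE s) (der_prim s cg)) _ t0.
  rewrite prim0 addr0 => h; have : 0 <= H / a * expR (a * t) + prim g t.
    apply: (le_trans h0); apply: h => s /bnd.
    by rewrite ler_norml => /andP[+ _]; lra.
  by lra.
have := der_mono (fun s => derB (dE s) (der_prim s cg)) _ t0.
rewrite prim0 subr0 => h; have : 0 <= H / a * expR (a * t) - prim g t.
  apply: (le_trans h0); apply: h => s /bnd.
  by rewrite ler_norml => /andP[_ +]; lra.
by lra.
Qed.

(** With the weight [e^(2 L |t|)], where [L] is the Lipschitz constant on the ball of radius [K T],
    each iteration contracts by [1/2] whatever the length of the time interval. *)
Lemma picard_step T : 0 <= T -> exists2 B, 0 <= B & forall k t x, `|t| <= T ->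
  `|picard k.+1 t x - picard k t x| <= B * 2^-1 ^+ k.
Proof.
move=> T0; have [L L0 hL] := field_clip_lip (K * T).
have KT : 0 <= K * T by exact: mulr_ge0.
exists (K * T * expR (2 * L * T)); first by rewrite mulr_ge0// expR_ge0.
have key k t x : `|t| <= T -> `|picard k.+1 t x - picard k t x| <=
    K * T * 2^-1 ^+ k * expR (2 * L * `|t|).
  elim: k t x => [|k IH] t x tT.
    rewrite /= subr0 expr0 mulr1; have [_ _ /(_ t x) h] := picard_props 1.
    rewrite (le_trans h)// (@le_trans _ _ (K * T))//; first by rewrite ler_wpM2l.
    by rewrite ler_peMr// -expR0 ler_expR !mulr_ge0// ltW.
  have j l : continuous (fun s => field_clip (picard l s) x).
    have [h1 h2 _] := picard_props l; exact: (jc_cst (x := x) (jc_field_clip h1 h2)).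
  have -> : picard k.+2 t x - picard k.+1 t x =
      prim (fun s => field_clip (picard k.+1 s) x - field_clip (picard k s) x) t.
    by rewrite [RHS]primB.
  have k0 : 0 <= K * T * 2^-1 ^+ k by rewrite mulr_ge0// exprn_ge0// invr_ge0.
  have L2 : 0 < 2 * L by rewrite mulr_gt0.
  apply: (le_trans (prim_exp_bound (a := 2 * L) (H := L * (K * T * 2^-1 ^+ k)) _ L2 _ _)).
  - exact: contB (j k.+1) (j k).
  - by rewrite mulr_ge0// ltW.
  - move=> s st; have sT := le_trans st tT.
    rewrite -[leRHS]mulrA; apply: hL; try exact: picard_admissible.
    by move=> y; exact: IH.
  rewrite le_eqVlt; apply/orP; left; apply/eqP; rewrite exprSr; field.
  by rewrite gt_eqF.
move=> k t x tT; rewrite (le_trans (key k t x tT))//.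
rewrite mulrAC ler_wpM2r ?exprn_ge0 ?invr_ge0// ler_wpM2l// ler_expR.
by rewrite ler_wpM2l// mulr_ge0// ltW.
Qed.

Lemma picard_cauchy T : 0 <= T -> exists2 B, 0 <= B & forall N M t x, `|t| <= T ->
  (N <= M)%N -> `|picard M t x - picard N t x| <= B * 2^-1 ^+ N.
Proof.
move=> /picard_step[B B0 h]; exists (2 * B); first exact: mulr_ge0.
move=> N M t x tT; elim: M => [|M IH].
  by rewrite leqn0 => /eqP ->; rewrite subrr normr0 !mulr_ge0.
have p0 k : 0 <= 2^-1 ^+ k :> R by rewrite exprn_ge0// invr_ge0.
rewrite leq_eqVlt => /predU1P[->|]; first by rewrite subrr normr0 !mulr_ge0.
rewrite ltnS => NM.
(* The geometric sum of [B / 2^i] for [i] from [N] to [N + j - 1], in closed form. *)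
suff : forall j, `|picard (N + j) t x - picard N t x| <=
    2 * B * (2^-1 ^+ N - 2^-1 ^+ (N + j)).
  move=> /(_ (M.+1 - N)%N); rewrite subnKC ?(leq_trans NM)//.
  move/le_trans; apply; rewrite ler_wpM2l ?mulr_ge0// lerBlDr lerDl//.
elim=> [|j IHj]; first by rewrite addn0 !subrr normr0 mulr0.
rewrite addnS.
have -> : picard (N + j).+1 t x - picard N t x =
  (picard (N + j).+1 t x - picard (N + j) t x) + (picard (N + j) t x - picard N t x) by ring.
rewrite (le_trans (ler_normD _ _))// (le_trans (lerD (h _ t x tT) IHj))//.
by rewrite exprS; have := p0 (N + j)%N; lra.
Qed.

Definition flow_log (t x : R) : R := lim ((fun k => picard k t x) @ \oo).

Lemma half_pow_cvg (B : R) : (fun k => B * 2^-1 ^+ k) @ \oo --> (0 : R).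
Proof.
rewrite -[X in _ --> X](mulr0 B); apply: cvgM; first exact: cvg_cst.
by apply: cvg_expr; rewrite ger0_norm ?invr_ge0// invf_lt1// ltr1n.
Qed.

Lemma flow_log_close T : 0 <= T -> exists2 B, 0 <= B & forall N t x, `|t| <= T ->
  `|flow_log t x - picard N t x| <= B * 2^-1 ^+ N.
Proof.
move=> /picard_cauchy[B B0 h]; exists B => // N t x tT.
apply: (@cauchy_limit _ (fun k => picard k t x) (fun N => B * 2^-1 ^+ N)) => [N' M NM|].
  exact: h.
exact: half_pow_cvg.
Qed.

Lemma half_pow_small (B e : R) : 0 < e -> exists N, B * 2^-1 ^+ N <= e.
Proof.
move=> e0; have [N _ hN] := (cvgr0Pnorm_lt _).1 (@half_pow_cvg B) _ e0.
by exists N; exact: le_trans (ler_norm _) (ltW (hN N (leqnn N))).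
Qed.

Lemma flow_log_jc : jc flow_log.
Proof.
apply: cont_uniform => -[t0 x0] e e0.
have T0 : 0 <= `|t0| + 1 by rewrite addr_ge0.
have [B B0 hB] := flow_log_close T0; have [N hN] := half_pow_small B e0.
exists (fun z => picard N z.1 z.2); first by have [] := picard_props N.
have near_t : \forall t \near t0, `|t| <= `|t0| + 1.
  have /cvgrPdist_le/(_ _ ltr01) : t @[t --> t0] --> t0 by exact: cvg_id.
  apply: filterS => t h; rewrite -[t](subrK t0) addrC (le_trans (ler_normD _ _))//.
  by rewrite distrC lerD2l.
have near_z := (@cont_fst R (t0, x0)) _ near_t; near=> z.
have ht : `|z.1| <= `|t0| + 1 by near: z; exact: near_z.
exact: le_trans (hB N z.1 z.2 ht) hN.
Unshelve. all: by end_near. Qed.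

Lemma flow_log_periodic t : periodic1 (flow_log t).
Proof.
move=> x; rewrite /flow_log; congr (lim (_ @ \oo)); apply/funext => k.
by have [_ -> _] := picard_props k.
Qed.

Lemma flow_log_bound t x : `|flow_log t x| <= K * `|t|.
Proof.
apply/ler_addgt0Pr => e e0; have [B B0 hB] := flow_log_close (normr_ge0 t).
have [N hN] := half_pow_small B e0; have [_ _ /(_ t x) h] := picard_props N.
rewrite -[flow_log t x](subrK (picard N t x)) addrC (le_trans (ler_normD _ _))//.
by rewrite lerD// (le_trans (hB N t x _)).
Qed.

Lemma flow_log_admissible t : admissible (K * `|t|) (flow_log t).
Proof.
split; [exact: jc_fun flow_log_jc|exact: flow_log_periodic|exact: flow_log_bound].
Qed.

Lemma flow_log_eq t x : flow_log t x = prim (fun s => field_clip (flow_log s) x) t.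
Proof.
apply/eqP; rewrite -subr_eq0 -normr_le0; apply/ler_addgt0Pr => e e0; rewrite add0r.
have [B B0 hB] := flow_log_close (normr_ge0 t).
have [L L0 hL] := field_clip_lip (K * `|t|).
have [N hN] := half_pow_small (B + L * B * `|t|) e0.
have jl := jc_field_clip flow_log_jc flow_log_periodic.
have [h1 h2 _] := picard_props N; have jN := jc_field_clip h1 h2.
have -> : flow_log t x - prim (fun s => field_clip (flow_log s) x) t =
  (flow_log t x - picard N.+1 t x) + prim (fun s => field_clip (picard N s) x -
     field_clip (flow_log s) x) t.
  rewrite primB; [|exact: (jc_cst (x := x) jN)|exact: (jc_cst (x := x) jl)].
  by rewrite -/(picard N.+1 t x) addrA subrK.
have p0 k : 0 <= 2^-1 ^+ k :> R by rewrite exprn_ge0// invr_ge0.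
rewrite (le_trans (ler_normD _ _))// (le_trans _ hN)// mulrDl lerD//.
  rewrite (le_trans (hB N.+1 t x _))// ler_wpM2l// exprS.
  by have := p0 N; lra.
rewrite mulrAC -[L * B * _]mulrA; apply: prim_bound.
  by apply: contB; [exact: (jc_cst (x := x) jN)|exact: (jc_cst (x := x) jl)].
move=> s st; apply: hL.
- exact: picard_admissible.
- have [c1 c2 c3] := flow_log_admissible s; split => // y.
  by rewrite (le_trans (c3 y))// ler_wpM2l.
- by move=> y; rewrite distrC; exact: hB.
Qed.

Lemma der_flow_log t x : der (flow_log ^~ x) t (field_clip (flow_log t) x).
Proof.
have jl := jc_field_clip flow_log_jc flow_log_periodic.
have := der_prim t (jc_cst (x := x) jl).
by apply: der_ext => s; rewrite flow_log_eq.
Qed.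

Lemma flow_log0 x : flow_log 0 x = 0.
Proof. by rewrite flow_log_eq prim0. Qed.

End picard.

(** * The flow and the velocity *)

Section lagrangian_flow.
Context {R : realType}.
Local Notation der f x a := (is_derive (x : R) (1 : R) (f : R -> R) (a : R)).

Variables (m0 : R -> R) (c : R).
Hypotheses (m0c : continuous m0) (m0p : periodic1 m0) (m0i : circle_int m0 = c).
Hypothesis m0b : forall x, `|m0 x - c| <= `|c|.

Definition logq := flow_log m0 `|c|.
Let K0 : 0 <= `|c|. Proof. exact: normr_ge0. Qed.

Lemma logq_jc : jc logq.
Proof. exact: flow_log_jc. Qed.

Lemma logq_periodic t : periodic1 (logq t).
Proof. exact: flow_log_periodic. Qed.

Lemma logq_cont t : continuous (logq t).
Proof. exact: jc_fun logq_jc. Qed.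

Lemma logq_bound t x : `|logq t x| <= `|c| * `|t|.
Proof. exact: flow_log_bound. Qed.

Lemma logq0 x : logq 0 x = 0.
Proof. exact: flow_log0. Qed.

Definition qx t x := expR (logq t x).
(** [V] before truncation, as a function of the label. Its truncation [Z] is what drives [logq]
    until [vel_x_bound] identifies the two. *)
Definition vel_x t := field m0 (logq t).
Let Z t := field_clip m0 `|c| (logq t).

Lemma qx_jc : jc qx.
Proof. exact: expR_cont logq_jc. Qed.

Lemma qx_cont t : continuous (qx t).
Proof. exact: jc_fun qx_jc. Qed.

Lemma qx_gt0 t x : 0 < qx t x.
Proof. exact: expR_gt0. Qed.

Lemma qx_periodic t : periodic1 (qx t).
Proof. by move=> x; rewrite /qx logq_periodic. Qed.

Lemma vel_x_jc : jc vel_x.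
Proof. exact: (jc_field m0c logq_jc logq_periodic). Qed.

Lemma vel_x_cont t : continuous (vel_x t).
Proof. exact: jc_fun vel_x_jc. Qed.

Lemma vel_x_periodic t : periodic1 (vel_x t).
Proof. by apply: field_periodic => //; [exact: logq_cont|exact: logq_periodic]. Qed.

Let Z_jc : jc Z.
Proof. exact: (jc_field_clip (K := `|c|) m0c logq_jc logq_periodic). Qed.

Let der_Z t x : der (logq ^~ x) t (Z t x).
Proof. exact: der_flow_log. Qed.

Let mq t x := m0 x * expR (- logq t x).

Let mq_jc : jc mq.
Proof.
apply: contM; first exact: cont_comp cont_snd m0c.
by apply: expR_cont; apply: contN; exact: logq_jc.
Qed.

Let der_W t : der (fun t => fieldW (logq t)) t (circle_int (fun x => qx t x * Z t x)).
Proof.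
have := @der_prim_param _ qx (fun t x => qx t x * Z t x) t 1
  (fun t x => der_exp (der_Z t x)) qx_cont (contM qx_jc Z_jc).
by rewrite -circle_int_prim; apply: der_ext => s; rewrite -circle_int_prim.
Qed.

Let der_N t : der (fun t => fieldN m0 (logq t)) t (- circle_int (fun x => mq t x * Z t x)).
Proof.
have d s x : der (mq ^~ x) s (- (mq s x * Z s x)).
  by apply: (der_eq (derZ (m0 x) (der_exp (derN (der_Z s x))))); rewrite /mq; ring.
have j : jc (fun s x => - (mq s x * Z s x)) by apply: contN; exact: contM.
have cm s : continuous (mq s) by exact: jc_fun mq_jc.
have := @der_prim_param _ mq (fun s x => - (mq s x * Z s x)) t 1 d cm j.
rewrite -circle_int_prim cintN; last exact: (contM (cm t) (jc_fun (t := t) Z_jc)).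
by apply: der_ext => s; rewrite -circle_int_prim.
Qed.

(* The derivative of the product is the integral of [V_x clip(V)], an exact
   derivative on the circle. *)
Lemma fieldNW t : fieldN m0 (logq t) * fieldW (logq t) = c.
Proof.
have d s : der (fun t => fieldN m0 (logq t) * fieldW (logq t)) s 0.
  apply: (der_eq (derM (der_N s) (der_W s))).
  have cz : continuous (Z s) by exact: jc_fun Z_jc.
  have cm : continuous (mq s) by exact: jc_fun mq_jc.
  have cs := field_slope_cont m0c (@logq_cont s).
  have c1 : continuous (fun x => mq s x * Z s x) by exact: contM.
  have c2 : continuous (fun x => qx s x * Z s x) by apply: contM => //; exact: qx_cont.
  transitivity (circle_int (fun x => Z s x * field_slope m0 (logq s) x)).
    transitivity (circle_int (fun x => fieldN m0 (logq s) * (qx s x * Z s x) -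
        fieldW (logq s) * (mq s x * Z s x))).
      by rewrite cintB ?cintZ//; [ring|exact: contZ|exact: contZ].
    by apply: eq_cint => x; rewrite /field_slope /qx /mq; ring.
  apply: (cint_der (f := fun x => prim (clip `|c|) (field m0 (logq s) x))).
  - by move=> x; congr (prim _ _); exact: vel_x_periodic.
  - exact: contM.
  - move=> x; apply: (der_eq (der_comp (der_field m0c x (@logq_cont s))
      (der_prim _ (@clip_cont _ `|c|)))).
    by [].
have := is_derive_0_is_cst t 0 d => ->.
rewrite /fieldN /fieldW.
rewrite (eq_cint (g := m0)); last by move=> x; rewrite logq0 oppr0 expR0 mulr1.
rewrite (eq_cint (f := fun y => expR (logq 0 y)) (g := fun=> 1)); last first.
  by move=> x; rewrite logq0 expR0.
by rewrite m0i cintC mulr1.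
Qed.

Let W_gt0 t : 0 < fieldW (logq t).
Proof. by apply: fieldW_gt0; [exact: logq_cont|exact: logq_periodic]. Qed.

(** The increment of [V] is [N] times a part of the integral [W] of [e^phi], minus [W] times a part
    of the integral [N] of [m_0 e^(- phi)]. Both integrands having constant sign, each product lies
    between 0 and [N W = c], so their difference is at most [|c|]. *)
Lemma vel_x_osc t x y : 0 <= y <= x -> x <= 1 -> `|vel_x t x - vel_x t y| <= `|c|.
Proof.
move=> /andP[y0 yx] x1; have := fieldNW t; have := W_gt0 t.
set W := fieldW _; set N := fieldN _ _ => W0 NW.
have cm : continuous (mq t) by exact: jc_fun mq_jc.
have cq := @qx_cont t.
have x0 : 0 <= x by exact: le_trans yx.
have mono (g : R -> R) a b : continuous g -> 0 <= a -> a <= b -> b <= 1 ->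
    (forall z, 0 <= g z) -> prim g a <= prim g b.
  by move=> cg a0 ab b1 g0; apply: (der_mono (fun z => der_prim z cg)).
have E1 : 0 <= prim (qx t) x - prim (qx t) y.
  by rewrite subr_ge0; apply: mono => // z; rewrite ltW// qx_gt0.
have E2 : prim (qx t) x - prim (qx t) y <= W.
  rewrite /W /fieldW circle_int_prim -[X in _ <= prim _ X]addr0.
  have : prim (qx t) x <= prim (qx t) 1 by apply: mono => // z; rewrite ltW// qx_gt0.
  have : prim (qx t) 0 <= prim (qx t) y.
    by apply: mono => //; [exact: le_trans x1|move=> z; rewrite ltW// qx_gt0].
  by rewrite addr0 prim0; lra.
have -> : vel_x t x - vel_x t y = N * (prim (qx t) x - prim (qx t) y) -
    W * (prim (mq t) x - prim (mq t) y).
  rewrite /vel_x /field /field_prim /field_slope.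
  rewrite !primB ?primZ//; try exact: contZ.
  by rewrite -/N -/W /qx /mq; ring.
have [c0|c0] := leP 0 c.
  have m0q z : 0 <= mq t z.
    rewrite mulr_ge0 ?expR_ge0//; have := m0b z.
    by rewrite (ger0_norm c0) ler_norml => /andP[]; lra.
  have F1 : 0 <= prim (mq t) x - prim (mq t) y by rewrite subr_ge0; exact: mono.
  have F2 : prim (mq t) x - prim (mq t) y <= N.
    have -> : N = prim (mq t) 1 by rewrite -circle_int_prim.
    have : prim (mq t) x <= prim (mq t) 1 by exact: mono.
    have : prim (mq t) 0 <= prim (mq t) y by apply: mono => //; exact: le_trans x1.
    by rewrite prim0; lra.
  rewrite (ger0_norm c0) -NW ler_norml; apply/andP; split; nra.
have m0q z : mq t z <= 0.
  rewrite mulr_le0_ge0 ?expR_ge0//; have := m0b z.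
  by rewrite (ltr0_norm c0) ler_norml => /andP[]; lra.
have cmN : continuous (fun z => - mq t z) by exact: contN.
have mN z : 0 <= - mq t z by rewrite oppr_ge0.
have F1 : prim (mq t) x - prim (mq t) y <= 0.
  by have := mono _ y x cmN y0 yx x1 mN; rewrite !primN//; lra.
have F2 : N <= prim (mq t) x - prim (mq t) y.
  have -> : N = prim (mq t) 1 by rewrite -circle_int_prim.
  have := mono _ x 1 cmN x0 x1 (lexx _) mN; have := mono _ 0 y cmN (lexx _) y0 (le_trans yx x1) mN.
  by rewrite !primN// prim0; lra.
rewrite (ltr0_norm c0) -NW ler_norml; apply/andP; split; nra.
Qed.

(** As [V] has mean zero for the weight [e^phi], [V(x) W] is the integral of
    [(V(x) - V(y)) e^phi(y)], and the oscillation bound applies under the integral. *)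
Lemma vel_x_bound t x : `|vel_x t x| <= `|c|.
Proof.
apply: (periodic_ind (P := fun z => `|z| <= `|c|) (@vel_x_periodic t)) => {}x x01.
have W0 := W_gt0 t; have cv := @vel_x_cont t; have cq := @qx_cont t.
have e : vel_x t x * fieldW (logq t) = circle_int (fun y => (vel_x t x - vel_x t y) * qx t y).
  rewrite (eq_cint (g := fun y => vel_x t x * qx t y - vel_x t y * qx t y)); last first.
    by move=> y; ring.
  rewrite cintB ?cintZ//; [|exact: contZ|exact: contM].
  rewrite [X in _ = _ - X](field_mean m0c (@logq_cont t) (@logq_periodic t)).
  by rewrite subr0.
have b y : 0 <= y <= 1 -> `|vel_x t x - vel_x t y| <= `|c|.
  move=> y01; case/andP: (x01) => x0 x1; case/andP: (y01) => y0 y1.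
  have [h|/ltW h] := leP y x; first by apply: vel_x_osc; rewrite ?y0.
  by rewrite distrC; apply: vel_x_osc; rewrite ?x0.
have cd : continuous (fun y => (vel_x t x - vel_x t y) * qx t y).
  by apply: contM => //; apply: contB => //; exact: contC.
have : `|circle_int (fun y => (vel_x t x - vel_x t y) * qx t y)| <= `|c| * fieldW (logq t).
  rewrite -[fieldW _]/(circle_int (qx t)) -cintZ// ler_norml.
  apply/andP; split.
    rewrite lerNl -cintN//; apply: le_cint; [exact: contN|exact: contZ|].
    move=> y /b; rewrite ler_norml -mulNr => /andP[h _].
    by rewrite ler_wpM2r ?(ltW (qx_gt0 t y))// lerNl.
  apply: le_cint => //; first exact: contZ.
  move=> y /b; rewrite ler_norml => /andP[_ h].
  by rewrite ler_wpM2r ?(ltW (qx_gt0 t y)).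
by rewrite -e normrM (ger0_norm (ltW W0)) ler_pM2r.
Qed.

Lemma der_logq t x : der (logq ^~ x) t (vel_x t x).
Proof. by apply: (der_eq (der_Z t x)); rewrite /Z /field_clip clip_id// vel_x_bound. Qed.

(** Once the truncation is inactive, the derivative of [W] is the integral of [V e^phi], which is
    zero. The flow therefore preserves the length of the circle, and [fieldNW] leaves [c] for the
    other weight. *)
Lemma cint_qx t : circle_int (qx t) = 1.
Proof.
have d s : der (fun t => fieldW (logq t)) s 0.
  apply: (der_eq (der_W s)); rewrite -[RHS](field_mean m0c (@logq_cont s) (@logq_periodic s)).
  apply: eq_cint => x; rewrite mulrC /Z /field_clip clip_id//; exact: vel_x_bound.
rewrite -[LHS]/(fieldW (logq t)) (is_derive_0_is_cst t 0 d).
rewrite -[RHS]cintC; apply: eq_cint => x; by rewrite logq0 expR0.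
Qed.

Definition vel_xx t x := c * qx t x - m0 x * expR (- logq t x).

Lemma der_vel_x t x : der (vel_x t) x (vel_xx t x).
Proof.
apply: (der_eq (der_field m0c x (@logq_cont t))).
have W1 : fieldW (logq t) = 1 := cint_qx t.
have N1 : fieldN m0 (logq t) = c by have := fieldNW t; rewrite W1 mulr1.
by rewrite /field_slope W1 N1 mul1r.
Qed.

Lemma vel_x_mean t : circle_int (fun y => vel_x t y * qx t y) = 0.
Proof. exact: (field_mean m0c (@logq_cont t) (@logq_periodic t)). Qed.

Lemma vel_xx_jc : jc vel_xx.
Proof. by apply: contB; [exact: contZ qx_jc|exact: mq_jc]. Qed.

Definition logq_x t x := prim (fun s => vel_xx s x) t.

Lemma logq_x_jc : jc logq_x.
Proof. exact: (jc_primT vel_xx_jc). Qed.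

(** [phi] is the time integral of [V], which is C^1 in the label; [phi] is thus C^1 as well although
    [m0] is only continuous. *)
Lemma der_logq_x t x : der (logq t) x (logq_x t x).
Proof.
have cv y : continuous (fun s => vel_x s y) by exact: (jc_cst (x := y) vel_x_jc).
have := @der_prim_param _ (fun y s => vel_x s y) (fun y s => vel_xx s y) x t
  (fun y s => der_vel_x s y) cv (jc_swap vel_xx_jc).
apply: der_ext => y.
by rewrite (prim_der t (cv y) (fun s => der_logq s y)) logq0 subr0.
Qed.

Lemma logq_x_bound t T x : `|t| <= T -> `|logq_x t x| <= 3 * `|c| * expR (`|c| * T) * T.
Proof.
move=> tT; have T0 : 0 <= T by exact: le_trans tT.
apply: (@le_trans _ _ (3 * `|c| * expR (`|c| * T) * `|t|)); last first.
  by rewrite ler_wpM2l// !mulr_ge0// expR_ge0.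
apply: prim_bound; first exact: (jc_cst (x := x) vel_xx_jc).
move=> s st; rewrite /vel_xx.
have lb : `|logq s x| <= `|c| * T.
  by rewrite (le_trans (logq_bound s x))// ler_wpM2l// (le_trans st).
(* [3 |c|] is the sum of [|c|] for the first term of [vel_xx] and [2 |c|] for the second. *)
have m02 : `|m0 x| <= 2 * `|c|.
  rewrite -[m0 x](subrK c) (le_trans (ler_normD _ _))//.
  by have := m0b x; lra.
rewrite (le_trans (ler_normB _ _))// !normrM.
rewrite (ger0_norm (ltW (qx_gt0 s x))) (ger0_norm (expR_ge0 _)).
have e1 : qx s x <= expR (`|c| * T).
  by rewrite ler_expR (le_trans (ler_norm _)).
have e2 : expR (- logq s x) <= expR (`|c| * T).
  by rewrite ler_expR (le_trans (ler_norm _))// normrN.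
have -> : 3 * `|c| * expR (`|c| * T) =
  `|c| * expR (`|c| * T) + 2 * `|c| * expR (`|c| * T) by ring.
by rewrite lerD// ?ler_wpM2l// ler_pM// expR_ge0.
Qed.

(** * Velocity, flow map and its inverse *)

Variable mean : R.

Definition qxt t x := qx t x * vel_x t x.
(** The velocity at the particle with label [x]: its label derivative is [q_x V], and the additive
    constant makes the mean of [u] over the circle, which is the integral of [u(q) q_x], equal to
    [mean]. *)
Definition vel t x :=
  prim (qxt t) x + mean - circle_int (fun y => prim (qxt t) y * qx t y).
(** Built by following the particle 0 in time and then integrating [q_x] in space; that it solves
    [q_t = u (t, q)] is [der_flow_t]. *)
Definition flow t x := prim (fun s => vel s 0) t + prim (qx t) x.

Lemma qxt_jc : jc qxt.
Proof. by apply: contM; [exact: qx_jc|exact: vel_x_jc]. Qed.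

Lemma qxt_cont t : continuous (qxt t).
Proof. exact: jc_fun qxt_jc. Qed.

Lemma vel_jc : jc vel.
Proof.
have jB := jc_prim qxt_jc; apply: contB.
  by apply: contD => //; exact: contC.
by apply: (jc_cint (G := fun t y => prim (qxt t) y * qx t y)); apply: contM => //; exact: qx_jc.
Qed.

Lemma der_vel t x : der (vel t) x (qxt t x).
Proof.
have := derB (derD (der_prim x (@qxt_cont t)) (derC mean x))
  (derC (circle_int (fun y => prim (qxt t) y * qx t y)) x).
by rewrite addr0 subr0.
Qed.

Lemma vel_periodic t : periodic1 (vel t).
Proof.
move=> x; rewrite /vel prim_periodic; [|exact: qxt_cont|]; last first.
  by move=> y; rewrite /qxt qx_periodic vel_x_periodic.
rewrite (eq_cint (g := fun y => vel_x t y * qx t y)); last by move=> y; rewrite /qxt mulrC.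
by rewrite vel_x_mean addr0.
Qed.

Lemma vel_mean t : circle_int (fun x => vel t x * qx t x) = mean.
Proof.
have cB : continuous (prim (qxt t)) by apply: prim_cont; exact: qxt_cont.
have cq := @qx_cont t.
set I := circle_int (fun y => prim (qxt t) y * qx t y).
transitivity (circle_int (fun x => prim (qxt t) x * qx t x + (mean - I) * qx t x)).
  by apply: eq_cint => x; rewrite /vel -/I; ring.
by rewrite cintD ?cintZ//; [rewrite cint_qx -/I; ring|exact: contM|exact: contZ].
Qed.

Lemma flow_jc : jc flow.
Proof.
apply: contD; last exact: jc_prim qx_jc.
apply: (cont_comp cont_fst); apply: prim_cont; exact: (jc_cst (x := 0) vel_jc).
Qed.

Lemma flow_cont t : continuous (flow t).
Proof. exact: jc_fun flow_jc. Qed.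

Lemma der_flow t x : der (flow t) x (qx t x).
Proof.
have := derD (derC (prim (fun s => vel s 0) t) x) (der_prim x (@qx_cont t)).
by rewrite add0r.
Qed.

Lemma der_flow_t t x : der (flow ^~ x) t (vel t x).
Proof.
have d1 := der_prim t (jc_cst (x := 0) vel_jc).
have d2 := @der_prim_param _ qx qxt t x (fun t x => der_exp (der_logq t x)) qx_cont qxt_jc.
by apply: (der_eq (derD d1 d2)); rewrite /vel prim0; ring.
Qed.

Lemma flowD1 t x : flow t (x + 1) = flow t x + 1.
Proof.
rewrite /flow prim_periodic; [|exact: qx_cont|exact: qx_periodic].
by rewrite cint_qx addrA.
Qed.

Lemma flow0 x : flow 0 x = x.
Proof.
rewrite /flow prim0 add0r (_ : qx 0 = fun=> 1) ?primC ?mul1r//.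
by apply/funext => y; rewrite /qx logq0 expR0.
Qed.

Lemma qx_ge t x : expR (- (`|c| * `|t|)) <= qx t x.
Proof. by rewrite ler_expR; have := logq_bound t x; rewrite ler_norml => /andP[]. Qed.

Lemma flow_dist t x y : `|x - y| <= expR (`|c| * `|t|) * `|flow t x - flow t y|.
Proof.
have [z _ ->] := mvt y x (der_flow t).
rewrite normrM (ger0_norm (ltW (qx_gt0 t z))) mulrA ler_peMl//.
by rewrite -(expRxMexpNx_1 (`|c| * `|t|)) ler_wpM2l ?expR_ge0// qx_ge.
Qed.

Lemma flow_inj t : injective (flow t).
Proof.
move=> x y e; apply/eqP; rewrite -subr_eq0 -normr_le0.
by rewrite (le_trans (flow_dist t x y))// e subrr normr0 mulr0.
Qed.

Lemma flow_surj t z : exists x, flow t x = z.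
Proof.
have shift (k : nat) x : flow t (x + k%:R) = flow t x + k%:R.
  elim: k => [|k IH]; first by rewrite !addr0.
  by rewrite -natr1 !addrA flowD1 IH.
have [k hk] : exists k : nat, `|z - flow t 0| <= k%:R.
  by exists (Num.truncn `|z - flow t 0|).+1; rewrite ltW// truncnS_gt.
move: hk; rewrite ler_norml => /andP[h1 h2].
have e1 : flow t (- k%:R) = flow t 0 - k%:R.
  by have := shift k (- k%:R); rewrite addNr => ->; ring.
have e2 : flow t k%:R = flow t 0 + k%:R by have := shift k 0; rewrite add0r.
have kk : - k%:R <= k%:R :> R by have := ler0n R k; lra.
have [|x _ <-] := @IVT R (flow t) (- k%:R) k%:R z kk (continuous_subspaceT (@flow_cont t)).
  by rewrite e1 e2 ge_min le_max; apply/andP; split; apply/orP; [left|right]; lra.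
by exists x.
Qed.

Definition label t z := get [set x | flow t x = z].

Lemma flowK t z : flow t (label t z) = z.
Proof. by have := flow_surj t z => /getPex. Qed.

Lemma labelK t x : label t (flow t x) = x.
Proof. by apply: (@flow_inj t); rewrite flowK. Qed.

Lemma labelD1 t z : label t (z + 1) = label t z + 1.
Proof. by apply: (@flow_inj t); rewrite flowD1 !flowK. Qed.

Lemma label_jc : jc label.
Proof.
move=> [t0 z0]; set x0 := label t0 z0.
(* A continuous majorant of the distance between [label t z] and [label t0 z0], obtained from
   [flow_dist] and vanishing at [(t0, z0)]. *)
pose g (z : R * R) := expR (`|c| * `|z.1|) * (`|z.2 - z0| + `|flow z.1 x0 - z0|).
have cg : continuous g.
  have ca (f : R * R -> R) : continuous f -> continuous (fun z => `|f z|).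
    by move=> cf; exact: cont_comp cf (@norm_continuous _ R).
  apply: contM; first by apply: expR_cont; apply: contZ; apply: ca; exact: cont_fst.
  apply: contD; apply: ca; apply: contB; try exact: contC; first exact: cont_snd.
  exact: (jc_comp flow_jc cont_fst (@contC _ _ x0)).
have g0 : g (t0, z0) = 0 by rewrite /g /= /x0 flowK subrr normr0 addr0 mulr0.
apply/cvgrPdist_le => e e0 /=.
have /cvgrPdist_le/(_ _ e0) := cg (t0, z0); rewrite g0; apply: filterS => -[t z] /=.
rewrite sub0r normrN => h; apply: le_trans (le_trans (ler_norm _) h).
rewrite distrC (le_trans (flow_dist t _ _))// ler_wpM2l ?expR_ge0// flowK.
have -> : z - flow t x0 = (z - z0) - (flow t x0 - z0) by ring.
exact: ler_normB.
Qed.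

Lemma der_label t z : der (label t) z (qx t (label t z))^-1.
Proof.
rewrite -{1}(flowK t z); apply: (@is_derive_inverse _ (flow t)).
- by apply: filterE => x; rewrite labelK.
- by apply: filterE => x; exact: flow_cont.
- exact: der_flow.
- by rewrite gt_eqF// qx_gt0.
Qed.

Lemma jc_label (F : R -> R -> R) : jc F -> jc (fun t z => F t (label t z)).
Proof. by move=> jF; exact: (jc_comp jF cont_fst label_jc). Qed.

Lemma der_eulerian (F F' : R -> R -> R) t z : (forall t x, der (F t) x (F' t x)) ->
  der (fun z => F t (label t z)) z (F' t (label t z) / qx t (label t z)).
Proof. by move=> dF; exact: der_comp (der_label t z) (dF t _). Qed.

Lemma eulerian_periodic (F : R -> R) t : periodic1 F -> periodic1 (fun z => F (label t z)).
Proof. by move=> pF z; rewrite labelD1 pF. Qed.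

Lemma cint_eulerian f t : continuous f -> periodic1 f ->
  circle_int f = circle_int (fun x => f (flow t x) * qx t x).
Proof.
by move=> cf pf; exact: cint_subst cf pf (@qx_cont t) (der_flow t) (flowD1 t).
Qed.

(* The transport of a density of weight 2: [transport m0 t] is the momentum. *)
Definition transport (g : R -> R) t z :=
  g (label t z) * expR (- (2 * logq t (label t z))).

(** The exponent 3 is 2 from the density plus 1 from the division by [q_x] in Eulerian
    coordinates. *)
Definition transport_x (g g' : R -> R) t z :=
  (g' (label t z) - 2 * g (label t z) * logq_x t (label t z)) *
  expR (- (3 * logq t (label t z))).

Lemma der_transport (g g' : R -> R) t z : (forall x, der g x (g' x)) ->
  der (transport g t) z (transport_x g g' t z).
Proof.
move=> dg.
have d s x : der (fun x => g x * expR (- (2 * logq s x))) x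
    ((g' x - 2 * g x * logq_x s x) * expR (- (2 * logq s x))).
  by apply: (der_eq (derM (dg x) (der_exp (derN (derZ 2 (der_logq_x s x)))))); ring.
apply: (der_eq (der_eulerian t z d)); rewrite /transport_x /qx.
rewrite -expRN -mulrA -expRD; congr (_ * expR _); ring.
Qed.

Lemma transport_jc g : continuous g -> jc (transport g).
Proof.
move=> cg; apply: contM; first exact: cont_comp label_jc cg.
apply: expR_cont; apply: contN; apply: contZ; exact: (jc_label logq_jc).
Qed.

Lemma transport_x_jc g g' : continuous g -> continuous g' -> jc (transport_x g g').
Proof.
move=> cg cg'; apply: contM.
  apply: contB; first exact: cont_comp label_jc cg'.
  apply: contM; last exact: (jc_label logq_x_jc).
  by apply: contZ; exact: cont_comp label_jc cg.
apply: expR_cont; apply: contN; apply: contZ; exact: (jc_label logq_jc).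
Qed.

Lemma transport_periodic g t : periodic1 g -> periodic1 (transport g t).
Proof. by move=> pg z; rewrite /transport labelD1 pg logq_periodic. Qed.

Lemma transport_H1contC1 (g g' : R -> R) : periodic1 g -> continuous g' ->
  (forall x, der g x (g' x)) -> H1cont (transport g).
Proof.
move=> pg cg' dg; have cg := ders_cont dg.
apply: (H1contC1 (F' := transport_x g g')).
- by move=> t; exact: transport_periodic.
- exact: transport_jc.
- exact: transport_x_jc.
- by move=> t x; exact: der_transport.
Qed.

Lemma transportB (g h : R -> R) t z :
  transport (fun x => g x - h x) t z = transport g t z - transport h t z.
Proof. exact: mulrBl. Qed.

Lemma transport_sup (g : R -> R) t T z (e : R) : `|t| <= T -> (forall x, `|g x| <= e) ->
  `|transport g t z| <= expR (2 * `|c| * T) * e.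
Proof.
move=> tT ge; rewrite normrM mulrC (ger0_norm (expR_ge0 _)) ler_pM ?expR_ge0//.
rewrite ler_expR (le_trans (ler_norm _))// normrN normrM ger0_norm//.
rewrite -mulrA ler_wpM2l// (le_trans (logq_bound t _))// ler_wpM2l//.
Qed.

Lemma transport_H1b T : 0 <= T -> exists2 C, 1 <= C & forall g e t, `|t| <= T ->
  H1b g e -> H1b (transport g t) (C * e).
Proof.
move=> T0; pose X := 3 * `|c| * expR (`|c| * T) * T.
have X0 : 0 <= X by rewrite /X !mulr_ge0// expR_ge0.
(* Squaring [e^(- 3 phi)] and multiplying by the Jacobian [e^phi] leaves [e^(- 5 phi)]. The other
   factor comes from [(a + b)^2 <= 2 a^2 + 2 b^2] with [|logq_x| <= X]. *)
pose E := expR (5 * `|c| * T); pose C := E * (2 + 8 * X ^+ 2).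
have E1 : 1 <= E by rewrite -expR0 ler_expR !mulr_ge0.
have X2 : 0 <= X ^+ 2 by exact: sqr_ge0.
have EC : E <= C by rewrite /C; nra.
have C1 : 1 <= C by exact: le_trans EC.
exists C => // g e t tT hg d d0; have e0 := H1b_ge0 hg.
have E2 : expR (2 * `|c| * T) <= E.
  by rewrite ler_expR -!mulrA ler_wpM2r ?mulr_ge0// ler_nat.
have d0' : 0 < d / E by rewrite divr_gt0// (lt_le_trans ltr01).
have [h [h' [[ph ch' dh] gh he h'e]]] := hg _ d0'; have ch := ders_cont dh.
exists (transport h t), (transport_x h h' t); split.
- split; [exact: transport_periodic|exact: (jc_fun (t := t) (transport_x_jc ch ch'))|].
  by move=> x; exact: der_transport.
- move=> z; rewrite -transportB (le_trans (transport_sup z tT gh))//.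
  by rewrite mulrCA ler_piMr ?(ltW d0)// ler_pdivrMr ?mul1r// (lt_le_trans ltr01).
- move=> z; rewrite (le_trans (transport_sup z tT he))// ler_wpM2r//.
  exact: le_trans E2 EC.
- have cx : continuous (transport_x h h' t) by exact: (jc_fun (t := t) (transport_x_jc ch ch')).
  have px : periodic1 (transport_x h h' t).
    exact: periodic_der (transport_periodic t ph) (fun z => der_transport t z dh).
  rewrite (cint_eulerian t (cont_sqr cx)); last by move=> z; rewrite px.
  have chx : continuous (fun x => - (2 * h x * logq_x t x)).
    by apply: contN; apply: contM; [exact: contZ|exact: (jc_fun (t := t) logq_x_jc)].
  have b2 : circle_int (fun x => (- (2 * h x * logq_x t x)) ^+ 2) <= 4 * X ^+ 2 * e ^+ 2.
    rewrite -[leRHS]cintC; apply: le_cint; [exact: cont_sqr|exact: contC|].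
    move=> x _; rewrite sqrrN -[leLHS]real_normK ?num_real// !normrM ger0_norm//.
    have -> : 4 * X ^+ 2 * e ^+ 2 = (2 * e * X) ^+ 2 by ring.
    rewrite lerXn2r ?nnegrE ?mulr_ge0//; apply: ler_pM => //.
      by rewrite ler_wpM2l.
    exact: logq_x_bound.
  have b3 := le_cint_sqrD ch' chx h'e b2.
  have cs : continuous (fun x => (h' x + - (2 * h x * logq_x t x)) ^+ 2).
    by apply: cont_sqr; exact: contD.
  apply: (@le_trans _ _ (circle_int (fun x => E * (h' x + - (2 * h x * logq_x t x)) ^+ 2))).
    apply: le_cint; [|exact: contZ|].
      apply: contM; last exact: qx_cont.
      by apply: cont_sqr; exact: cont_comp (@flow_cont t) cx.
    move=> x _; rewrite /transport_x labelK; set A := h' x - _.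
    rewrite exprMn -mulrA [leRHS]mulrC; apply: ler_wpM2l; first exact: sqr_ge0.
    rewrite -expRM_natl /qx -expRD ler_expR.
    have := logq_bound t x; rewrite ler_norml => /andP[l1 l2].
    have : `|c| * `|t| <= `|c| * T by rewrite ler_wpM2l.
    by lra.
  rewrite cintZ//; apply: (@le_trans _ _ (E * (2 * e ^+ 2 + 2 * (4 * X ^+ 2 * e ^+ 2)))).
    by rewrite ler_wpM2l// (le_trans ler01).
  have -> : E * (2 * e ^+ 2 + 2 * (4 * X ^+ 2 * e ^+ 2)) = C * e ^+ 2 by rewrite /C; ring.
  rewrite exprMn; apply: ler_wpM2r; first exact: sqr_ge0.
  by rewrite expr2; apply: ler_peMl => //; exact: le_trans C1.
Qed.

Hypothesis m0a : forall e, 0 < e -> exists h h' : R -> R,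
  [/\ periodic1 h, continuous h', forall x, der h x (h' x) &
      H1b (fun x => m0 x - h x) e].

Lemma momentum_H1b t : exists M, H1b (transport m0 t) M.
Proof.
have [C _ hC] := transport_H1b (normr_ge0 t).
have [h [h' [ph ch' dh hr]]] := m0a ltr01.
have [M hM] := H1b_bounded ph ch' dh.
exists (C * (2 * (1 + M))); apply: hC => //.
by apply: (H1b_ext _ (H1bD hr hM)) => x; rewrite subrK.
Qed.

(** A density argument: the transport of a C^1 function is C^1 in space, jointly continuous with its
    space derivative, hence H^1-continuous in time, and [transport_H1b] controls the remainder
    uniformly for times near [t0]. *)
Lemma momentum_H1cont : H1cont (transport m0).
Proof.
move=> t0 e e0; have T0 : 0 <= `|t0| + 1 by rewrite addr_ge0.
have [C C1 hC] := transport_H1b T0.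
have C0 : 0 < C by exact: lt_le_trans C1.
(* Two remainders of size [e / 16] and one difference of size [e / 4], combined by two uses of
   [H1bD], add up to exactly [e]. *)
have d0 : 0 < e / (16 * C) by rewrite divr_gt0// mulr_gt0.
have [h [h' [ph ch' dh hr]]] := m0a d0.
have e4 : 0 < e / 4 by rewrite divr_gt0.
have h1 := transport_H1contC1 ph ch' dh t0 e4.
have h2 : \forall t \near t0, `|t| <= `|t0| + 1.
  have /cvgrPdist_le/(_ _ ltr01) : t @[t --> t0] --> t0 by exact: cvg_id.
  apply: filterS => t ht; rewrite -[t](subrK t0) addrC (le_trans (ler_normD _ _))//.
  by rewrite distrC lerD2l.
near=> t.
have k1 : H1b (fun x => transport h t x - transport h t0 x) (e / 4) by near: t.
have k2 : `|t| <= `|t0| + 1 by near: t.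
have k3 := hC _ _ _ k2 hr.
have t00 : `|t0| <= `|t0| + 1 by rewrite lerDl.
have k4 : H1b (fun x => - transport (fun x => m0 x - h x) t0 x) (C * (e / (16 * C))).
  move=> d dd; have [k [k' [[pk ck dk] g1 g2 g3]]] := hC _ _ _ t00 hr _ dd.
  exists (fun x => - k x), (fun x => - k' x); split.
  - split; [by move=> x; rewrite pk|exact: contN|by move=> x; exact: derN (dk x)].
  - by move=> x; rewrite -opprD normrN.
  - by move=> x; rewrite normrN.
  - by rewrite (eq_cint (g := fun x => k' x ^+ 2))// => x; rewrite sqrrN.
have k5 := H1bD (H1bD k3 k4) k1.
apply: (H1b_ext _ (H1b_le _ k5)).
  have alg (a b a' b' : R) : a - b + - (a' - b') + (b - b') = a - a' by ring.
  by move=> x; rewrite !transportB alg.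
have -> : C * (e / (16 * C)) = e / 16 by field; rewrite gt_eqF.
by lra.
Unshelve. all: by end_near. Qed.

(** * The Eulerian solution and its pressure *)

Definition sol t z := vel t (label t z).
Definition sol_x t z := vel_x t (label t z).
Definition sol_xx t z := c - transport m0 t z.

Lemma sol_jc : jc sol. Proof. exact: jc_label vel_jc. Qed.
Lemma sol_x_jc : jc sol_x. Proof. exact: jc_label vel_x_jc. Qed.
Lemma sol_xx_jc : jc sol_xx.
Proof. by apply: contB; [exact: contC|exact: transport_jc]. Qed.

Lemma sol_cont t : continuous (sol t). Proof. exact: jc_fun sol_jc. Qed.
Lemma sol_x_cont t : continuous (sol_x t). Proof. exact: jc_fun sol_x_jc. Qed.
Lemma sol_xx_cont t : continuous (sol_xx t). Proof. exact: jc_fun sol_xx_jc. Qed.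

Lemma sol_periodic t : periodic1 (sol t).
Proof. exact: eulerian_periodic (@vel_periodic t). Qed.

Lemma sol_x_periodic t : periodic1 (sol_x t).
Proof. exact: eulerian_periodic (@vel_x_periodic t). Qed.

Lemma der_sol t z : der (sol t) z (sol_x t z).
Proof.
apply: (der_eq (der_eulerian t z der_vel)).
by rewrite /qxt /sol_x mulrAC mulfV ?mul1r// gt_eqF// qx_gt0.
Qed.

Lemma der_sol_x t z : der (sol_x t) z (sol_xx t z).
Proof.
apply: (der_eq (der_eulerian t z der_vel_x)).
set x := label t z; rewrite /vel_xx mulrBl mulfK; last by rewrite gt_eqF// qx_gt0.
rewrite /sol_xx /transport -/x /qx -expRN -mulrA -expRD; congr (_ - _ * expR _); ring.
Qed.

Lemma sol_mean t : circle_int (sol t) = mean.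
Proof.
rewrite (cint_eulerian t (@sol_cont t) (@sol_periodic t)) -[RHS](vel_mean t).
by apply: eq_cint => x; rewrite /sol labelK.
Qed.

(** The right-hand side of the pressure equation, with [2 mu(u) u + 2 kappa u] gathered into
    [2 c u]. Taking means shows that [mu(P)] is the mean of [source], which dictates [pressure_xx];
    the two integrations then fix their constants by the means. *)
Definition source t z := 2 * c * sol t z + 2^-1 * sol_x t z ^+ 2.
Definition source_x t z := 2 * c * sol_x t z + sol_x t z * sol_xx t z.
Definition pressure_xx t z := circle_int (source t) - source t z.
Definition pressure_x t z := prim (pressure_xx t) z - circle_int (prim (pressure_xx t)).
Definition pressure t z := circle_int (source t) + (prim (pressure_x t) z - circle_int (prim (pressure_x t))).
(** Defined by the equation; that it is the time derivative of [sol] is shown on Fourier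
    coefficients. *)
Definition sol_t t z := - (sol t z * sol_x t z + pressure_x t z).
Definition sol_tx t z := - (sol_x t z ^+ 2 + sol t z * sol_xx t z + pressure_xx t z).

Lemma source_jc : jc source.
Proof.
by apply: contD; apply: contZ; [exact: sol_jc|apply: cont_sqr; exact: sol_x_jc].
Qed.

Lemma source_cont t : continuous (source t). Proof. exact: jc_fun source_jc. Qed.

Lemma source_periodic t : periodic1 (source t).
Proof. by move=> z; rewrite /source sol_periodic sol_x_periodic. Qed.

Lemma source_x_jc : jc source_x.
Proof.
apply: contD; first by apply: contZ; exact: sol_x_jc.
by apply: contM; [exact: sol_x_jc|exact: sol_xx_jc].
Qed.

Lemma der_source t z : der (source t) z (source_x t z).
Proof.
apply: (der_eq (derD (derZ (2 * c) (der_sol t z)) (derZ 2^-1 (der_sqr (der_sol_x t z))))).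
by rewrite /source_x; field.
Qed.

Lemma pressure_xx_jc : jc pressure_xx.
Proof. by apply: contB; [exact: jc_cint source_jc|exact: source_jc]. Qed.

Lemma pressure_xx_cont t : continuous (pressure_xx t). Proof. exact: jc_fun pressure_xx_jc. Qed.

Lemma pressure_xx_periodic t : periodic1 (pressure_xx t).
Proof. by move=> z; rewrite /pressure_xx source_periodic. Qed.

Lemma der_pressure_xx t z : der (pressure_xx t) z (- source_x t z).
Proof.
by apply: (der_eq (derB (derC (circle_int (source t)) z) (der_source t z))); rewrite sub0r.
Qed.

Lemma pressure_xx_mean t : circle_int (pressure_xx t) = 0.
Proof.
rewrite /pressure_xx cintB; [|exact: contC|exact: source_cont].
by rewrite cintC subrr.
Qed.

Lemma pressure_x_jc : jc pressure_x.
Proof.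
have j := jc_prim pressure_xx_jc; apply: contB => //; exact: (jc_cint j).
Qed.

Lemma pressure_x_cont t : continuous (pressure_x t). Proof. exact: jc_fun pressure_x_jc. Qed.

Lemma der_pressure_x t z : der (pressure_x t) z (pressure_xx t z).
Proof.
by apply: (der_eq (derB (der_prim z (@pressure_xx_cont t)) (derC _ z))); rewrite subr0.
Qed.

Lemma pressure_x_periodic t : periodic1 (pressure_x t).
Proof.
move=> z; rewrite /pressure_x prim_mean0_periodic//; [exact: pressure_xx_cont|exact: pressure_xx_periodic|exact: pressure_xx_mean].
Qed.

Lemma pressure_x_mean t : circle_int (pressure_x t) = 0.
Proof.
rewrite /pressure_x cintB; [|exact/prim_cont/pressure_xx_cont|exact: contC].
by rewrite cintC subrr.
Qed.

Lemma der_pressure t z : der (pressure t) z (pressure_x t z).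
Proof.
apply: (der_eq (derD (derC (circle_int (source t)) z)
  (derB (der_prim z (@pressure_x_cont t)) (derC (circle_int (prim (pressure_x t))) z)))).
by rewrite add0r subr0.
Qed.

Lemma pressure_periodic t : periodic1 (pressure t).
Proof.
move=> z; rewrite /pressure prim_mean0_periodic//; [exact: pressure_x_cont|exact: pressure_x_periodic|exact: pressure_x_mean].
Qed.

Lemma pressure_mean t : circle_int (pressure t) = circle_int (source t).
Proof.
have cP : continuous (prim (pressure_x t)) by apply: prim_cont; exact: pressure_x_cont.
rewrite /pressure cintD; [|exact: contC|by apply: contB => //; exact: contC].
by rewrite cintB ?cintC ?subrr ?addr0//; exact: contC.
Qed.

Lemma sol_t_jc : jc sol_t.
Proof.
apply: contN; apply: contD; last exact: pressure_x_jc.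
by apply: contM; [exact: sol_jc|exact: sol_x_jc].
Qed.

Lemma sol_t_cont t : continuous (sol_t t). Proof. exact: jc_fun sol_t_jc. Qed.

Lemma sol_t_periodic t : periodic1 (sol_t t).
Proof. by move=> z; rewrite /sol_t sol_periodic sol_x_periodic pressure_x_periodic. Qed.

Lemma sol_tx_jc : jc sol_tx.
Proof.
apply: contN; apply: contD; last exact: pressure_xx_jc.
apply: contD; first by apply: cont_sqr; exact: sol_x_jc.
by apply: contM; [exact: sol_jc|exact: sol_xx_jc].
Qed.

Lemma sol_tx_cont t : continuous (sol_tx t). Proof. exact: jc_fun sol_tx_jc. Qed.

Lemma der_sol_sol_x t z : der (fun z => sol t z * sol_x t z) z (sol_x t z ^+ 2 + sol t z * sol_xx t z).
Proof. by apply: (der_eq (derM (der_sol t z) (der_sol_x t z))); rewrite expr2. Qed.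

Lemma der_sol_t t z : der (sol_t t) z (sol_tx t z).
Proof. exact: derN (derD (der_sol_sol_x t z) (der_pressure_x t z)). Qed.

Lemma sol_t_mean t : circle_int (sol_t t) = 0.
Proof.
have cuu : continuous (fun z => sol t z * sol_x t z).
  by apply: contM; [exact: sol_cont|exact: sol_x_cont].
rewrite /sol_t cintN; last by apply: contD => //; exact: pressure_x_cont.
rewrite cintD//; last exact: pressure_x_cont.
rewrite pressure_x_mean addr0; apply/eqP; rewrite oppr_eq0; apply/eqP.
apply: (cint_der (f := fun z => 2^-1 * sol t z ^+ 2)); last 2 first.
- exact: cuu.
- by move=> z; apply: (der_eq (derZ 2^-1 (der_sqr (der_sol t z)))); field.
by move=> z; rewrite sol_periodic.
Qed.

Lemma sol_xx_H1cont : H1cont sol_xx.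
Proof.
have alg (a b : R) : -1 * a - -1 * b = (c - a) - (c - b) by ring.
move=> t0 e e0; have := H1contZ (-1) momentum_H1cont t0 e0.
by apply: filterS => t; apply: H1b_ext => x; exact: alg.
Qed.

Lemma sol_xx_H1b t : exists M, H1b (sol_xx t) M.
Proof.
have [M hM] := momentum_H1b t.
have p1 : periodic1 (fun _ : R => -1 : R) by [].
have n1 (x : R) : `|-1 : R| <= 1 by rewrite normrN normr1.
have n0 (x : R) : `|0 : R| <= 1 by rewrite normr0.
have h1 := H1bM p1 (@contC _ _ 0) (derC (-1)) n1 n0 hM.
have pc : periodic1 (fun _ : R => c) by [].
have nc (x : R) : `|c| <= `|c| by [].
have n0c (x : R) : `|0 : R| <= `|c| by rewrite normr0.
have h2 := H1b_C1 pc (@contC _ _ 0) (derC c) nc n0c.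
exists (2 * (`|c| + 2 * (1 * M))); apply: (H1b_ext _ (H1bD h2 h1)) => x.
by rewrite /sol_xx mulN1r.
Qed.

Lemma sol_tx_H1cont : H1cont sol_tx.
Proof.
have h1 : H1cont (fun t z => sol_x t z ^+ 2).
  apply: (H1contC1 (F' := fun t z => 2 * sol_x t z * sol_xx t z)).
  - by move=> t z; rewrite sol_x_periodic.
  - by apply: cont_sqr; exact: sol_x_jc.
  - by apply: contM; [apply: contZ; exact: sol_x_jc|exact: sol_xx_jc].
  - by move=> t z; exact: der_sqr (der_sol_x t z).
have h2 : H1cont (fun t z => sol t z * sol_xx t z).
  exact: H1contM sol_periodic sol_jc sol_x_jc der_sol sol_xx_H1b sol_xx_H1cont.
have h3 : H1cont pressure_xx.
  apply: (H1contC1 (F' := fun t z => - source_x t z)).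
  - exact: pressure_xx_periodic.
  - exact: pressure_xx_jc.
  - by apply: contN; exact: source_x_jc.
  - exact: der_pressure_xx.
have h4 := H1contZ (-1) (H1contD (H1contD h1 h2) h3).
have alg (a b : R) : -1 * a - -1 * b = - a - - b by ring.
move=> t0 e e0; have := h4 t0 e e0.
by apply: filterS => t; apply: H1b_ext => x; exact: alg.
Qed.

(** The weak form of [m_t + u m_x + 2 u_x m = 0]. In Lagrangian coordinates the pairing is the
    integral of [m_0 e^(- phi) f(q)], which depends on time only through [phi] and [q], so [m_0] is
    never differentiated. *)
Lemma der_momentum_pairing (f f' : R -> R) t : periodic1 f -> continuous f' ->
  (forall x, der f x (f' x)) ->
  der (fun t => circle_int (fun z => transport m0 t z * f z)) t
    (circle_int (fun z => transport m0 t z * (sol t z * f' z - sol_x t z * f z))).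
Proof.
move=> pf cf' df; have cf := ders_cont df; have pf' := periodic_der pf df.
pose F t x := m0 x * expR (- logq t x) * f (flow t x).
pose F' t x := m0 x * expR (- logq t x) *
  (vel t x * f' (flow t x) - vel_x t x * f (flow t x)).
have dF s x : der (F ^~ x) s (F' s x).
  apply: (der_eq (derM (derZ (m0 x) (der_exp (derN (der_logq s x))))
    (der_comp (der_flow_t s x) (df (flow s x))))).
  by rewrite /F'; ring.
have jm : jc (fun t x => m0 x * expR (- logq t x)).
  apply: contM; first exact: cont_comp cont_snd m0c.
  by apply: expR_cont; apply: contN; exact: logq_jc.
have jf : jc (fun t x => f (flow t x)) by exact: cont_comp flow_jc cf.
have jf' : jc (fun t x => f' (flow t x)) by exact: cont_comp flow_jc cf'.
have jF : jc F by exact: contM.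
have jF' : jc F'.
  exact: contM jm (contB (contM vel_jc jf') (contM vel_x_jc jf)).
have qq s x : expR (- (2 * logq s x)) * qx s x = expR (- logq s x).
  by rewrite /qx -expRD; congr expR; ring.
have cT s : continuous (transport m0 s) by exact: jc_fun (transport_jc m0c).
have pT s : periodic1 (transport m0 s) by exact: transport_periodic.
have e1 s : circle_int (fun z => transport m0 s z * f z) = prim (F s) 1.
  rewrite (cint_eulerian s (contM (cT s) cf)); last by move=> z; rewrite pT pf.
  rewrite -circle_int_prim; apply: eq_cint => x.
  by rewrite /transport labelK /F -(qq s x); ring.
have e2 : circle_int (fun z => transport m0 t z * (sol t z * f' z - sol_x t z * f z)) = prim (F' t) 1.
  rewrite (cint_eulerian (f := fun z => transport m0 t z * (sol t z * f' z - sol_x t z * f z)) t).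
  - rewrite -circle_int_prim; apply: eq_cint => x.
    by rewrite /transport /sol /sol_x labelK /F' -(qq t x); ring.
  - apply: contM => //; apply: contB; apply: contM => //; [exact: sol_cont|exact: sol_x_cont].
  - by move=> z; rewrite pT pf pf' sol_periodic sol_x_periodic.
rewrite e2; apply: (der_ext _ (der_prim_param t 1 dF _ jF')) => [s|s]; first by rewrite e1.
exact: jc_fun jF.
Qed.

(* With [m = c - u_xx], [P_xx = s - 2 c u - u_x^2 / 2] where [s] is the mean of
   [P], and [f'' = - k f], the difference of the two integrands is the
   derivative of [(s - c u + u_x^2 / 2) f - (u u_x + P_x) f']. *)
Lemma momentum_pairing_sol_t (f f' : R -> R) k t : periodic1 f -> (forall x, der f x (f' x)) ->
  (forall x, der f' x (- k * f x)) ->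
  circle_int (fun z => transport m0 t z * (sol t z * f' z - sol_x t z * f z)) =
  k * circle_int (fun z => sol_t t z * f z).
Proof.
move=> pf df df'; have cf := ders_cont df; have cf' := ders_cont df'.
have pf' := periodic_der pf df.
have cu := @sol_cont t; have cux := @sol_x_cont t.
have cT : continuous (transport m0 t) by exact: jc_fun (transport_jc m0c).
have c1 : continuous (fun z => transport m0 t z * (sol t z * f' z - sol_x t z * f z)).
  by apply: contM => //; apply: contB; exact: contM.
have c2 : continuous (fun z => sol_t t z * f z) by apply: contM => //; exact: sol_t_cont.
apply/eqP; rewrite -subr_eq0 -cintZ// -cintB//; last exact: contZ.
apply/eqP; apply: (cint_der (f := fun z =>
  (circle_int (source t) - c * sol t z + 2^-1 * sol_x t z ^+ 2) * f z -
  (sol t z * sol_x t z + pressure_x t z) * f' z)).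
- by move=> z; rewrite sol_periodic sol_x_periodic pressure_x_periodic pf pf'.
- by apply: contB => //; exact: contZ.
- move=> z; apply: (der_eq (derB (derM (derD (derB (derC (circle_int (source t)) z)
    (derZ c (der_sol t z))) (derZ 2^-1 (der_sqr (der_sol_x t z)))) (df z))
    (derM (derD (der_sol_sol_x t z) (der_pressure_x t z)) (df' z)))).
  have -> : transport m0 t z = c - sol_xx t z by rewrite /sol_xx; ring.
  by rewrite /pressure_xx /sol_t /source; field.
Qed.

(** Two integrations by parts move the derivatives of [m = c - u_xx] onto [f], and the mean zero of
    [f] removes [c]. *)
Lemma sol_momentum_pairing (f f' : R -> R) k t : periodic1 f -> (forall x, der f x (f' x)) ->
  (forall x, der f' x (- k * f x)) -> circle_int f = 0 ->
  k * circle_int (fun z => sol t z * f z) = circle_int (fun z => transport m0 t z * f z).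
Proof.
move=> pf df df' f0; have cf := ders_cont df; have cf' := ders_cont df'.
have pf' := periodic_der pf df.
have cu := @sol_cont t; have cux := @sol_x_cont t.
have cT : continuous (transport m0 t) by exact: jc_fun (transport_jc m0c).
have c1 : continuous (fun z => sol t z * f z) by exact: contM.
have c2 : continuous (fun z => transport m0 t z * f z) by exact: contM.
have : circle_int (fun z => (c * f z - transport m0 t z * f z) + k * (sol t z * f z)) = 0.
  apply: (cint_der (f := fun z => sol_x t z * f z - sol t z * f' z)).
  - by move=> z; rewrite sol_periodic sol_x_periodic pf pf'.
  - apply: contD; last exact: contZ.
    by apply: contB => //; exact: contZ.
  - move=> z; apply: (der_eq (derB (derM (der_sol_x t z) (df z)) (derM (der_sol t z) (df' z)))).
    by rewrite /sol_xx; ring.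
rewrite cintD ?cintZ//; [|by apply: contB => //; exact: contZ|exact: contZ].
rewrite cintB ?cintZ ?f0//; [by lra|exact: contZ].
Qed.

(** Dividing the momentum identities by [k] recovers [u]. At frequency zero, where [k = 0],
    conservation of the mean takes over. *)
Lemma der_sol_pairing (f f' : R -> R) k t : periodic1 f -> (forall x, der f x (f' x)) ->
  (forall x, der f' x (- k * f x)) -> circle_int f = 0 -> k != 0 ->
  der (fun t => circle_int (fun z => sol t z * f z)) t (circle_int (fun z => sol_t t z * f z)).
Proof.
move=> pf df df' f0 k0; have cf' := ders_cont df'.
have := derZ k^-1 (der_momentum_pairing t pf cf' df).
rewrite (momentum_pairing_sol_t t pf df df') mulrA mulVf// mul1r.
by apply: der_ext => s; rewrite -(sol_momentum_pairing s pf df df' f0) mulrA mulVf ?mul1r.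
Qed.

Lemma der_sol_fcos t n : der (fun t => circle_int (fun x => sol t x * cosn n x)) t
  (circle_int (fun x => sol_t t x * cosn n x)).
Proof.
have [->|n0] := eqVneq n 0.
  rewrite fcos0 sol_t_mean; apply: der_ext (derC mean t) => s.
  by rewrite fcos0 sol_mean.
apply: (@der_sol_pairing _ (fun x => - freq n * sinn n x) (freq n ^+ 2)).
- exact: cosn_periodic.
- exact: der_cosn.
- by move=> x; apply: (der_eq (derZ (- freq n) (der_sinn n x))); ring.
- by rewrite cint_cosn (negbTE n0).
- by rewrite expf_neq0// freq_eq0.
Qed.

Lemma der_sol_fsin t n : der (fun t => circle_int (fun x => sol t x * sinn n x)) t
  (circle_int (fun x => sol_t t x * sinn n x)).
Proof.
have [->|n0] := eqVneq n 0.
  by rewrite fsin0; apply: der_ext (derC 0 t) => s; rewrite fsin0.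
apply: (@der_sol_pairing _ (fun x => freq n * cosn n x) (freq n ^+ 2)).
- exact: sinn_periodic.
- exact: der_sinn.
- by move=> x; apply: (der_eq (derZ (freq n) (der_cosn n x))); ring.
- exact: cint_sinn.
- by rewrite expf_neq0// freq_eq0.
Qed.

Lemma sol_tx_H1b t : exists M, H1b (sol_tx t) M.
Proof.
have [a a0 ha] := periodic_bounded (@sol_cont t) (@sol_periodic t).
have [b b0 hb] := periodic_bounded (@sol_x_cont t) (@sol_x_periodic t).
have ua x : `|sol t x| <= a + b by have := ha x; lra.
have uxa x : `|sol_x t x| <= a + b by have := hb x; lra.
have [M1 h1] := sol_xx_H1b t.
have h2 := H1bM (@sol_periodic t) (@sol_x_cont t) (der_sol t) ua uxa h1.
have [|||M3 h3] := @H1b_bounded R (fun z => sol_x t z ^+ 2 + pressure_xx t z)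
  (fun z => 2 * sol_x t z * sol_xx t z - source_x t z).
- by move=> z; rewrite sol_x_periodic pressure_xx_periodic.
- apply: contB; last exact: (jc_fun (t := t) source_x_jc).
  by apply: contM; [apply: contZ; exact: sol_x_cont|exact: sol_xx_cont].
- by move=> z; exact: derD (der_sqr (der_sol_x t z)) (der_pressure_xx t z).
have p1 : periodic1 (fun _ : R => -1 : R) by [].
have n1 (x : R) : `|-1 : R| <= 1 by rewrite normrN normr1.
have n0 (x : R) : `|0 : R| <= 1 by rewrite normr0.
have h4 := H1bM p1 (@contC _ _ 0) (derC (-1)) n1 n0 (H1bD h3 h2).
exists (2 * (1 * (2 * (M3 + 2 * ((a + b) * M1))))).
by apply: (H1b_ext _ h4) => x; rewrite /sol_tx; ring.
Qed.

(** * Regularity in the Sobolev scale *)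

Lemma Hs_le_sol_cvg s t0 e : s <= 3 -> 0 < e ->
  \forall t \near t0, Hs_le s (fun x => sol t x - sol t0 x) e.
Proof.
move=> s3 e0; have := sol_xx_H1cont t0 e0; apply: filterS => t h.
apply: (Hs_le_H3 (f1 := fun x => sol_x t x - sol_x t0 x) s3 _ _ _ _ h).
- by move=> x; rewrite !sol_periodic.
- by move=> x; exact: derB (der_sol t x) (der_sol t0 x).
- by move=> x; exact: derB (der_sol_x t x) (der_sol_x t0 x).
- by apply: contB; exact: sol_xx_cont.
- apply: sqr_eq0_addl_le; rewrite cintB; [|exact: sol_cont|exact: sol_cont].
  exact: sub_eq0 (sol_mean t) (sol_mean t0).
Qed.

Lemma Hs_le_sol_t_cvg s t0 e : s <= 2 -> 0 < e ->
  \forall t \near t0, Hs_le s (fun x => sol_t t x - sol_t t0 x) e.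
Proof.
move=> s3 e0; have := sol_tx_H1cont t0 e0; apply: filterS => t h.
apply: (Hs_le_H2 s3 _ _ _ h).
- by move=> x; rewrite !sol_t_periodic.
- by move=> x; exact: derB (der_sol_t t x) (der_sol_t t0 x).
- by apply: contB; exact: sol_tx_cont.
- apply: sqr_eq0_addl_le; rewrite cintB; [|exact: sol_t_cont|exact: sol_t_cont].
  exact: sub_eq0 (sol_t_mean t) (sol_t_mean t0).
Qed.

Lemma C0_sol s (T : \bar R) : s <= 3 -> C0_Hs s T sol.
Proof.
move=> s3 t0 _; split; last first.
  by apply: Hs_norm_cvg0 => e e0; exact: near_within (Hs_le_sol_cvg t0 s3 e0).
split; first exact: cont_L2 (@sol_cont t0) (@sol_periodic t0).
have [M hM] := sol_xx_H1b t0; have M0 := H1b_ge0 hM.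
apply: (@Hs_le_finite _ _ _ (`|circle_int (sol t0)| + M)); first exact: addr_ge0.
apply: (Hs_le_H3 s3 (@sol_periodic t0) (der_sol t0) (der_sol_x t0) (@sol_xx_cont t0) hM).
by rewrite sqrrD real_normK ?num_real// -addrA lerD2l lerDr mulrn_wge0// mulr_ge0.
Qed.

Lemma C0_sol_t s (T : \bar R) : s <= 2 -> C0_Hs s T sol_t.
Proof.
move=> s2 t0 _; split; last first.
  by apply: Hs_norm_cvg0 => e e0; exact: near_within (Hs_le_sol_t_cvg t0 s2 e0).
split; first exact: cont_L2 (@sol_t_cont t0) (@sol_t_periodic t0).
have [M hM] := sol_tx_H1b t0; have M0 := H1b_ge0 hM.
apply: (@Hs_le_finite _ _ _ M M0).
apply: (Hs_le_H2 s2 (@sol_t_periodic t0) (der_sol_t t0) (@sol_tx_cont t0) hM).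
exact: sqr_eq0_addl_le (sol_t_mean t0).
Qed.

Lemma time_deriv_sol s (T : \bar R) : s <= 2 -> time_deriv_Hs s T sol sol_t.
Proof.
move=> s2 t0 _; apply: Hs_norm_cvg0 => e e0.
have /nbhs_ballP[d /= d0 hd] := Hs_le_sol_t_cvg t0 s2 e0.
apply/nbhs_ballP; exists d => //= t td tt0 _.
apply: (Hs_le_difference_quotient sol_cont sol_t_cont der_sol_fcos der_sol_fsin tt0) => r rt.
apply: hd; rewrite /ball/= distrC (le_lt_trans rt)// distrC.
exact: td.
Qed.

Lemma muCH_sol kappa t : c = mean + kappa -> muCH_eq kappa (sol t) (sol_t t).
Proof.
move=> ce; exists (sol_x t), (pressure t), (pressure_x t), (pressure_xx t); split.
- split; apply: cont_L2.
  + exact: sol_x_cont.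
  + exact: sol_x_periodic.
  + exact: ders_cont (der_pressure t).
  + exact: pressure_periodic.
  + exact: pressure_x_cont.
  + exact: pressure_x_periodic.
  + exact: pressure_xx_cont.
  + exact: pressure_xx_periodic.
- split.
  + exact: weak_deriv1 (@sol_periodic t) (der_sol t) (@sol_x_cont t).
  + exact: weak_deriv1 (@pressure_periodic t) (der_pressure t) (@pressure_x_cont t).
  + exact: weak_deriv2 (@pressure_periodic t) (der_pressure t) (der_pressure_x t) (@pressure_xx_cont t).
- by apply: aeW => x; rewrite /sol_t; ring.
- by apply: aeW => x; rewrite pressure_mean sol_mean /pressure_xx /source ce; ring.
Qed.

(** * The initial condition *)

Lemma transport0 z : transport m0 0 z = m0 z.
Proof.
have e : label 0 z = z by rewrite -[in LHS](flow0 z) labelK.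
by rewrite /transport e logq0 mulr0 oppr0 expR0 mulr1.
Qed.

Lemma sol0_fcos n : n != 0 -> freq n ^+ 2 * circle_int (fun x => sol 0 x * cosn n x) =
  circle_int (fun x => m0 x * cosn n x).
Proof.
move=> n0; have d2 x : der (fun x => - freq n * sinn n x) x (- freq n ^+ 2 * cosn n x).
  by apply: (der_eq (derZ (- freq n) (der_sinn n x))); ring.
have z0 : circle_int (cosn n) = 0 :> R by rewrite cint_cosn (negbTE n0).
rewrite (sol_momentum_pairing 0 (@cosn_periodic _ n) (der_cosn n) d2 z0).
by apply: eq_cint => x; rewrite transport0.
Qed.

Lemma sol0_fsin n : freq n ^+ 2 * circle_int (fun x => sol 0 x * sinn n x) =
  circle_int (fun x => m0 x * sinn n x).
Proof.
have d2 x : der (fun x => freq n * cosn n x) x (- freq n ^+ 2 * sinn n x).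
  by apply: (der_eq (derZ (freq n) (der_cosn n x))); ring.
rewrite (sol_momentum_pairing 0 (@sinn_periodic _ n) (der_sinn n) d2 (cint_sinn n)).
by apply: eq_cint => x; rewrite transport0.
Qed.

End lagrangian_flow.

(** Every existence time is at most [+oo], so one solution on [[0, +oo)] settles the maximal time;
    the solution built from [momentum0] belongs to the required class for every [s] allowed here. *)
Theorem theorem4p2 (R : realType) (kappa : R) (u0 d3u0 : R -> R)
  (hu0 : Hs 3 u0)
  (hd3 : L2_circle d3u0) (hd3u0 : weak_deriv 3 u0 d3u0)
  (hbound : L2_norm d3u0 <= 2 * Num.sqrt 3 * `|circle_int u0 + kappa|)
  (s : R) (hs : 3 / 2 < s) (hs3 : s <= 3) :
  maximal_existence_time s kappa u0 +oo%E.
Proof.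
have [u0L2 _] := hu0; have [pu0 _ _] := u0L2.
pose mean := circle_int u0; pose c := mean + kappa.
(* The square of [2 sqrt 3] is the factor 12 of [sobolev_sup]. *)
have d2 : circle_int (fun x => d3u0 x ^+ 2) <= 12 * c ^+ 2.
  have I0 : 0 <= circle_int (fun x => d3u0 x ^+ 2).
    by apply: Rintegral_ge0 => x _; exact: sqr_ge0.
  rewrite -[leLHS]sqr_sqrtr// -/(L2_norm d3u0).
  have -> : 12 * c ^+ 2 = (2 * Num.sqrt 3 * `|c|) ^+ 2.
    by rewrite !exprMn sqr_sqrtr// real_normK ?num_real//; ring.
  by rewrite lerXn2r ?nnegrE ?sqrtr_ge0// !mulr_ge0// sqrtr_ge0.
pose m0 := momentum0 u0 c.
have m0c : continuous m0 := momentum0_cont u0L2 hd3 hd3u0 (c := c).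
have m0p : periodic1 m0 := @momentum0_periodic R u0 c.
have m0i : circle_int m0 = c := cint_momentum0 u0L2 hd3 hd3u0 c.
have m0b : forall x, `|m0 x - c| <= `|c| := @momentum0_bound R u0 d3u0 u0L2 hd3 hd3u0 c c d2.
have m0a e (e0 : 0 < e) := @momentum0_approx R u0 d3u0 u0L2 hd3 hd3u0 c e e0.
have s12 : s - 1 <= 2 by lra.
split; last by move=> T' u' _; exact: leey.
exists (sol m0 c mean); split.
- by rewrite lt0y.
- exact: C0_sol.
- have cu := @sol_cont R m0 c m0c m0p m0i m0b mean 0.
  have pu := @sol_periodic R m0 c m0c m0p m0i m0b mean 0.
  have iu0 := L2_integrable u0L2; have iu := cont_cintegrable cu.
  (* Both functions have mean [mean], and for [n != 0] both coefficients become those of [m0] after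
     multiplication by the nonzero [freq n ^+ 2]. *)
  have : {ae @lebesgue_measure R, forall x, sol m0 c mean 0 x - u0 x = 0}.
    apply: trig_complete.
    + by move=> x; rewrite pu pu0.
    + exact: cintegrableB.
    + move=> n; rewrite (eq_cint (g := fun x =>
        sol m0 c mean 0 x * cosn n x - u0 x * cosn n x)); last by move=> x; ring.
      have cn := @cosn_cont R n.
      rewrite cint_integrableB; [|exact: cintegrableM|exact: cintegrableM].
      have [->|n0] := eqVneq n 0.
        by rewrite !fcos0 sol_mean// subrr.
      apply/eqP; rewrite subr_eq0; apply/eqP.
      have f0 : freq n ^+ 2 != 0 :> R by rewrite expf_neq0// freq_eq0.
      apply: (mulfI f0); rewrite sol0_fcos//.
      exact: (fcos_momentum0 u0L2 hd3 hd3u0 c n0).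
    + move=> n; rewrite (eq_cint (g := fun x =>
        sol m0 c mean 0 x * sinn n x - u0 x * sinn n x)); last by move=> x; ring.
      have cn := @sinn_cont R n.
      rewrite cint_integrableB; [|exact: cintegrableM|exact: cintegrableM].
      have [->|n0] := eqVneq n 0.
        by rewrite !fsin0 subrr.
      apply/eqP; rewrite subr_eq0; apply/eqP.
      have f0 : freq n ^+ 2 != 0 :> R by rewrite expf_neq0// freq_eq0.
      apply: (mulfI f0); rewrite sol0_fsin//.
      exact: (fsin_momentum0 u0L2 hd3 hd3u0 c n0).
  case=> N [mN N0 hN]; exists N; split => // x nx; apply: hN => /= h; apply: nx.
  by apply/eqP; rewrite -subr_eq0 h.
- exists (sol_t m0 c mean); split.
  + exact: C0_sol_t.
  + exact: time_deriv_sol.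
  + by move=> t _; exact: muCH_sol.
Qed.
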